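(* Given a weighted pushdown system $\mathcal{A}$, the following problems can be solved in polynomial time: (1) whether there exists a stack bounded infinite path $\pi$ from the initial configuration with $\mathrm{LimInfAvg}(\pi)\bowtie 0$ (respectively $\mathrm{LimSupAvg}(\pi)\bowtie 0$), for $\bowtie\in\{\geq,>\}$; (2) whether $\sup\{\mathrm{LimInfAvg}(\pi): \pi \text{ a stack bounded infinite path from the initial configuration}\}\geq 0$ (respectively the same with $\mathrm{LimSupAvg}$).
   Context: A weighted pushdown system (WPS) is $\mathcal{A}=\langle Q,\Gamma,q_0,E,w\rangle$ with finite states $Q$, finite stack alphabet $\Gamma\ni\bot$ ($\bot$ never pushed or popped), edges $E\subseteq(Q\times\Gamma)\times(Q\times\mathrm{Com}(\Gamma))$ with $\mathrm{Com}(\Gamma)=\{\mathit{skip},\mathit{pop}\}\cup\{\mathit{push}(z)\}$, weights $w:E\to\mathbb{Z}$; initial configuration $(\bot,q_0)$; successor of $(\alpha,q)$ via edge $(q,\mathrm{Top}(\alpha),q',\mathit{com})$ is $(\mathit{com}(\alpha),q')$. An infinite path $\langle(\alpha_1,q_1),(\alpha_2,q_2),\dots\rangle$ is stack bounded if there is $n\in\mathbb{N}$ with $|\alpha_i|\leq n$ for all $i$. For an infinite path, $\mathrm{LimSupAvg}(\pi)=\limsup_i w(\pi[0,i])/i$ and $\mathrm{LimInfAvg}(\pi)=\liminf_i w(\pi[0,i])/i$, with $w(\pi[0,i])$ the total weight of the first $i$ edges. *)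

(* Defs.v *)
From Stdlib Require Import ZArith Reals List.
From Coquelicot Require Import Coquelicot.
Import ListNotations.
Local Open Scope nat_scope.

(* States are 0..nQ-1, stack symbols are 0..nG-1, and the bottom       *)
(* symbol \bot is the symbol 0.  A stack is a list with top at head.   *)

Inductive com := Skip | Pop | Push (z : nat).

Record edge := mkEdge {
  e_src : nat;
  e_top : nat;
  e_dst : nat;
  e_com : com;
  e_w   : Z
}.

Record WPS := mkWPS {
  nQ : nat;
  nG : nat;
  q0 : nat;
  edges : list edge
}.

Definition bot : nat := 0.

Definition key (e : edge) := (e_src e, e_top e, e_dst e, e_com e).

(* Well-formedness: finite data in range, bot never pushed nor popped,
   and E is a set with a weight function (no two weights for one edge). *)
Definition wf_WPS (A : WPS) : Prop :=
  0 < nG A /\ q0 A < nQ A /\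
  NoDup (map key (edges A)) /\
  forall e, In e (edges A) ->
    e_src e < nQ A /\ e_dst e < nQ A /\ e_top e < nG A /\
    (forall z, e_com e = Push z -> 0 < z < nG A) /\
    (e_top e = bot -> e_com e <> Pop).

Definition config := (list nat * nat)%type.

Definition Top (s : list nat) : nat := match s with [] => bot | z :: _ => z end.

Definition apply_com (c : com) (s : list nat) : list nat :=
  match c with
  | Skip => s
  | Pop => tl s
  | Push z => z :: s
  end.

Definition init_config (A : WPS) : config := ([bot], q0 A).

Definition is_path (A : WPS) (c : nat -> config) (e : nat -> edge) : Prop :=
  c 0 = init_config A /\
  forall i, In (e i) (edges A) /\
            e_src (e i) = snd (c i) /\
            e_top (e i) = Top (fst (c i)) /\
            c (S i) = (apply_com (e_com (e i)) (fst (c i)), e_dst (e i)).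

Definition stack_bounded (c : nat -> config) : Prop :=
  exists n, forall i, (length (fst (c i)) <= n)%nat.

Fixpoint wprefix (e : nat -> edge) (i : nat) : Z :=
  match i with O => 0%Z | S k => (wprefix e k + e_w (e k))%Z end.

Definition avg (e : nat -> edge) (i : nat) : R := (IZR (wprefix e i) / INR i)%R.

Definition LimInfAvg (e : nat -> edge) : Rbar := LimInf_seq (avg e).
Definition LimSupAvg (e : nat -> edge) : Rbar := LimSup_seq (avg e).

Inductive avg_kind := LInf | LSup.
Definition Avg (k : avg_kind) := match k with LInf => LimInfAvg | LSup => LimSupAvg end.

Inductive cmp := Ge | Gt.
Definition cmp0 (b : cmp) (x : Rbar) : Prop :=
  match b with Ge => Rbar_le (Finite 0) x | Gt => Rbar_lt (Finite 0) x end.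

Definition exists_path_problem (k : avg_kind) (b : cmp) (A : WPS) : Prop :=
  exists c e, is_path A c e /\ stack_bounded c /\ cmp0 b (Avg k e).

Definition sup_problem (k : avg_kind) (A : WPS) : Prop :=
  Rbar_le (Finite 0)
    (Rbar_lub (fun x => exists c e, is_path A c e /\ stack_bounded c /\ x = Avg k e)).

(* Input encoding over the alphabet {1,2,3,4} (0 is the blank).        *)
(* Numbers of states/symbols and indices in unary, weights in binary.  *)

Definition unary (n : nat) : list nat := repeat 1%nat n ++ [3%nat].

Fixpoint bin_pos (p : positive) : list nat :=
  match p with
  | xH => [2%nat]
  | xO p' => bin_pos p' ++ [1%nat]
  | xI p' => bin_pos p' ++ [2%nat]
  end.

Definition enc_Z (z : Z) : list nat :=
  match z with
  | Z0 => [2%nat; 3%nat]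
  | Zpos p => 2%nat :: bin_pos p ++ [3%nat]
  | Zneg p => 4%nat :: bin_pos p ++ [3%nat]
  end.

Definition enc_com (c : com) : list nat :=
  match c with
  | Skip => unary 0
  | Pop => unary 1
  | Push z => unary 2 ++ unary z
  end.

Definition enc_edge (e : edge) : list nat :=
  unary (e_src e) ++ unary (e_top e) ++ unary (e_dst e) ++ enc_com (e_com e) ++ enc_Z (e_w e).

Definition enc_WPS (A : WPS) : list nat :=
  unary (nQ A) ++ unary (nG A) ++ unary (q0 A) ++
  flat_map (fun e => 4%nat :: enc_edge e) (edges A).

(* States 0..tm_n-1, tape symbols 0..tm_k-1, 0 = blank.                *)

Inductive dir := L | Rt | Stay.

Record TM := mkTM {
  tm_n : nat; tm_k : nat;
  tm_start : nat; tm_acc : nat; tm_rej : nat;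
  tm_delta : nat -> nat -> nat * nat * dir
}.

Definition TM_ok (M : TM) : Prop :=
  (5 <= tm_k M)%nat /\ tm_start M < tm_n M /\ tm_acc M < tm_n M /\
  tm_rej M < tm_n M /\ tm_acc M <> tm_rej M /\
  forall q a, q < tm_n M -> a < tm_k M ->
    let '(q', a', _) := tm_delta M q a in q' < tm_n M /\ a' < tm_k M.

(* configuration: state, reversed left part, head symbol, right part *)
Definition tconf := (nat * list nat * nat * list nat)%type.

Definition hd0 (l : list nat) := match l with [] => 0%nat | a :: _ => a end.

Definition tstep (M : TM) (c : tconf) : tconf :=
  let '(q, l, a, r) := c in
  if orb (Nat.eqb q (tm_acc M)) (Nat.eqb q (tm_rej M)) then c else
  let '(q', a', d) := tm_delta M q a in
  match d with
  | Stay => (q', l, a', r)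
  | L => (q', tl l, hd0 l, a' :: r)
  | Rt => (q', a' :: l, hd0 r, tl r)
  end.

Definition tinit (M : TM) (w : list nat) : tconf := (tm_start M, [], hd0 w, tl w).

Definition trun (M : TM) (t : nat) (w : list nat) : tconf := Nat.iter t (tstep M) (tinit M w).

Definition tstate (c : tconf) : nat := let '(q, _, _, _) := c in q.

Definition poly_time_decidable (P : WPS -> Prop) : Prop :=
  exists (M : TM) (c d : nat), TM_ok M /\
    forall A, wf_WPS A ->
      let x := enc_WPS A in
      let s := tstate (trun M (c * length x ^ d + c) x) in
      (P A -> s = tm_acc M) /\ (~ P A -> s = tm_rej M).

(* Main.v *)
Require Import Defs.
From Stdlib Require Import ZArith Reals List Lia Lra Bool Arith Classical.
From Coquelicot Require Import Coquelicot.
Import ListNotations.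
Local Open Scope nat_scope.

(** A stack bounded path lives in a finite graph of configurations, so the three questions only depend
    on the weights [w] and lengths [l] of the cycles of reachable configurations: there must be a cycle
    with [w >= 0], one with [w > 0], or, for the supremum, for every [K] a cycle with [K * w + l >= 0].
    Started at a configuration of minimal height, a cycle never touches the stack below the top symbol,
    so cycles are derived by the context-free grammar of summaries, whose variables are triples of two
    states and a stack symbol.

    The maximal weight derived from each of the [N] variables is computed by value iteration.  A
    variable whose value still grows in round [N + 1] has a chain of [N + 1] growing descendants, hence
    a repeated one, and the difference of its two values is the positive weight of a pump; its value is
    set to infinity, and [N] more rounds propagate infinity.  Numbers gain a bounded number of bits per
    round, so this takes polynomial time.  For the supremum, weights are replaced by [K * w + 1] with
    [K = 2 ^ (N + 2)] larger than the length of every pump that the argument produces, so that a pump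
    of positive value has [w >= 0].

    Polynomial time is handled by a class [FP] of functions on tree encoded data that is closed under
    composition, pairing, case distinction and folds with polynomially bounded intermediate values.
    Its members are computed by programs that keep a stack of serialised trees, and such programs run
    on a one-tape machine whose cells hold one symbol of each of three stacks. *)

(** * A three-stack machine on a one-tape Turing machine *)

(** Both kinds of average get the same answer. A lasso path repeats a cycle forever and its lower
    average is at least the mean of the cycle; conversely, if no cycle has the wanted property,
    cutting cycles out of a prefix bounds even the upper average of every path of bounded height.
    The supremum differs from the existence problems because the height bound depends on the path.
    One path sees finitely many configurations, so if all cycles have negative weight, its averages
    stay below a fixed negative number. Over all paths the means of such cycles may still tend to 0:
    a pump of weight 0 makes a cycle of negative weight arbitrarily long. Hence a condition for
    every [K], which one large [K] decides: a nonnegative finite value belongs to a derivation too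
    short to have negative weight, and an infinite value provides a pump that lengthens a cycle
    without lowering its weight. Reachability of states and top symbols is part of the same grammar,
    because a summary counts only at a reachable top, and tops become reachable through pushes and
    summaries. *)

Inductive sid := X0 | X1 | X2.
Inductive sym := s1 | s2 | s3 | s4.

Definition toN (a : sym) : nat := match a with s1 => 1 | s2 => 2 | s3 => 3 | s4 => 4 end.
Definition ofN (n : nat) : option sym :=
  match n with 1 => Some s1 | 2 => Some s2 | 3 => Some s3 | 4 => Some s4 | _ => None end.

Record stk := St { g0 : list sym; g1 : list sym; g2 : list sym }.

Definition get (i : sid) (s : stk) := match i with X0 => g0 s | X1 => g1 s | X2 => g2 s end.
Definition set (i : sid) (l : list sym) (s : stk) :=
  match i with
  | X0 => St l (g1 s) (g2 s)
  | X1 => St (g0 s) l (g2 s)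
  | X2 => St (g0 s) (g1 s) l
  end.
Definition top (i : sid) (s : stk) := hd_error (get i s).
Definition push (i : sid) (a : sym) (s : stk) := set i (a :: get i s) s.
Definition pop (i : sid) (s : stk) := set i (tl (get i s)) s.

Inductive instr :=
  | IPush (i : sid) (a : sym)
  | IPop (i : sid)
  | IJmp (i : sid) (f : option sym -> bool) (target : nat)
  | IHalt (b : bool).

Definition fetch (p : list instr) (pc : nat) := nth pc p (IHalt false).

Inductive fstep (p : list instr) : nat * stk -> nat * stk -> Prop :=
  | fs_push pc s i a : pc < length p -> fetch p pc = IPush i a ->
      fstep p (pc, s) (S pc, push i a s)
  | fs_pop pc s i : pc < length p -> fetch p pc = IPop i ->
      fstep p (pc, s) (S pc, pop i s)
  | fs_jmp pc s i f t : pc < length p -> fetch p pc = IJmp i f t ->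
      fstep p (pc, s) (if f (top i s) then S pc else t, s).

Inductive fsteps (p : list instr) : nat -> nat * stk -> nat * stk -> Prop :=
  | fs_refl c : fsteps p 0 c c
  | fs_next n c c' c'' : fstep p c c' -> fsteps p n c' c'' -> fsteps p (S n) c c''.

Lemma fsteps_trans p n m c c' c'' :
  fsteps p n c c' -> fsteps p m c' c'' -> fsteps p (n + m) c c''.
Proof. induction 1; intros; simpl; auto. econstructor; eauto. Qed.

(* A tape cell holds one digit per stack in base 5; the code 125 marks cell 0. *)
Definition mark := 125.

Definition code (a b c : nat) := a + 5 * b + 25 * c.
Definition dig (i : sid) (c : nat) :=
  match i with X0 => c mod 5 | X1 => (c / 5) mod 5 | X2 => (c / 25) mod 5 end.
Definition setdig (i : sid) (a c : nat) :=
  match i with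
  | X0 => code a (dig X1 c) (dig X2 c)
  | X1 => code (dig X0 c) a (dig X2 c)
  | X2 => code (dig X0 c) (dig X1 c) a
  end.

(** The head of the list is the top of the stack. The reversal puts the bottom at position 0, so
    that a push or a pop changes a single cell and shifts no other. *)
Definition cell (l : list sym) (j : nat) : nat := nth j (map toN (rev l)) 0.

Definition colf (s : stk) (j : nat) : nat :=
  match j with
  | 0 => mark
  | S j => code (cell (g0 s) j) (cell (g1 s) j) (cell (g2 s) j)
  end.

Lemma toN_bounds a : 1 <= toN a <= 4.
Proof. destruct a; simpl; lia. Qed.

Lemma cell_bound l j : cell l j < 5.
Proof.
  unfold cell. destruct (nth_in_or_default j (map toN (rev l)) 0) as [H|H].
  - apply in_map_iff in H. destruct H as [a [Ha _]]. pose proof (toN_bounds a). lia.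
  - rewrite H. lia.
Qed.

Lemma cell_out l j : length l <= j -> cell l j = 0.
Proof. intros. unfold cell. apply nth_overflow. rewrite length_map, length_rev. lia. Qed.

Lemma cell_in l j : j < length l -> cell l j <> 0.
Proof.
  intros. unfold cell.
  assert (H1 : In (nth j (map toN (rev l)) 0) (map toN (rev l))).
  { apply nth_In. rewrite length_map, length_rev. lia. }
  apply in_map_iff in H1. destruct H1 as [a [Ha _]]. pose proof (toN_bounds a). lia.
Qed.

Lemma cell_cons a l j : cell (a :: l) j = if j =? length l then toN a else cell l j.
Proof.
  unfold cell. simpl. rewrite map_app.
  destruct (Nat.eqb_spec j (length l)) as [->|E].
  - rewrite app_nth2; rewrite length_map, length_rev; [|lia].
    rewrite Nat.sub_diag. reflexivity.
  - destruct (lt_dec j (length l)).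
    + rewrite app_nth1; [reflexivity|]. rewrite length_map, length_rev. lia.
    + rewrite (nth_overflow (map toN (rev l))); [|rewrite length_map, length_rev; lia].
      apply nth_overflow. rewrite length_app, length_map, length_rev. simpl. lia.
Qed.

Lemma code_dig a b c : a < 5 -> b < 5 -> c < 5 ->
  dig X0 (code a b c) = a /\ dig X1 (code a b c) = b /\ dig X2 (code a b c) = c.
Proof.
  intros Ha Hb Hc.
  do 5 (destruct a as [|a]; [do 5 (destruct b as [|b];
    [do 5 (destruct c as [|c]; [repeat split; reflexivity|]); lia|]); lia|]); lia.
Qed.

Lemma dig_bound i c : dig i c < 5.
Proof. destruct i; unfold dig; apply Nat.mod_upper_bound; lia. Qed.

Lemma setdig_bound i a c : a < 5 -> setdig i a c < 125.
Proof.
  intros. pose proof (dig_bound X0 c). pose proof (dig_bound X1 c). pose proof (dig_bound X2 c).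
  destruct i; unfold setdig, code; lia.
Qed.

Lemma colf_bound s j : 0 < j -> colf s j < 125.
Proof.
  destruct j; [lia|]. intros _. simpl. unfold code.
  pose proof (cell_bound (g0 s) j). pose proof (cell_bound (g1 s) j).
  pose proof (cell_bound (g2 s) j). lia.
Qed.

Lemma colf_dig s i j : dig i (colf s (S j)) = cell (get i s) j.
Proof.
  simpl. destruct (code_dig (cell (g0 s) j) (cell (g1 s) j) (cell (g2 s) j)) as (A & B & C);
    try apply cell_bound. destruct i; assumption.
Qed.

Lemma colf_set s i l j :
  colf (set i l s) (S j) = setdig i (cell l j) (colf s (S j)).
Proof.
  assert (H := fun k => colf_dig s k j).
  destruct i; unfold setdig; rewrite !H; reflexivity.
Qed.

Lemma setdig_same s i j : setdig i (cell (get i s) j) (colf s (S j)) = colf s (S j).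
Proof. rewrite <- colf_set. destruct s, i; reflexivity. Qed.

(** * Simulation of the stack machine by a Turing machine *)

Section Compile.
Variable prog : list instr.
Let n := length prog.

(** Each instruction has four phases: 0 dispatches on the mark, 1 walks right to the first empty
    digit of the stack concerned, 2 sits on its top cell, 3 walks back to the mark. Jumps out of the
    program lead to the rejecting state [4 * n + 1]. *)
Definition st (pc ph : nat) : nat := if pc <? n then 4 * pc + ph else 4 * n + 1.

Definition delta_at (pc ph a : nat) : nat * nat * dir :=
  match ph with
  | 0 => match fetch prog pc with
         | IHalt b => (if b then 4 * n else 4 * n + 1, a, Stay)
         | _ => (st pc 1, a, Rt)
         end
  | 1 => match fetch prog pc with
         | IPush i s => if dig i a =? 0 then (st (S pc) 3, setdig i (toN s) a, L)
                        else (st pc 1, a, Rt)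
         | IPop i | IJmp i _ _ => if dig i a =? 0 then (st pc 2, a, L) else (st pc 1, a, Rt)
         | IHalt _ => (4 * n + 1, a, Stay)
         end
  | 2 => match fetch prog pc with
         | IPop i => (st (S pc) 3, if a =? mark then a else setdig i 0 a, Stay)
         | IJmp i f t =>
             (st (if f (if a =? mark then None else ofN (dig i a)) then S pc else t) 3, a, Stay)
         | _ => (4 * n + 1, a, Stay)
         end
  | _ => if a =? mark then (st pc 0, a, Stay) else (st pc 3, a, L)
  end.

(** The states [4 * n + 2] and [4 * n + 3] prepare the tape: the head moves to the blank left of the
    input and turns it into cell 0. The input letters are already valid codes, with digits 0 for
    [X1] and [X2], so they form the stack [X0] with the last letter on top. *)
Definition delta (q a : nat) : nat * nat * dir :=
  if q =? 4 * n + 2 then (4 * n + 3, a, L) else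
  if q =? 4 * n + 3 then (st 0 0, mark, Stay) else
  delta_at (q / 4) (q mod 4) a.

Definition machine : TM := mkTM (4 * n + 4) 126 (4 * n + 2) (4 * n) (4 * n + 1) delta.

Lemma st_bound pc ph : ph < 4 -> st pc ph < 4 * n + 4.
Proof. intros. unfold st. destruct (Nat.ltb_spec pc n); lia. Qed.

Lemma delta_bound q a : a < 126 ->
  fst (fst (delta q a)) < 4 * n + 4 /\ snd (fst (delta q a)) < 126.
Proof.
  intros Ha.
  assert (H0 : forall pc ph, ph < 4 -> st pc ph < 4 * n + 4) by exact st_bound.
  assert (H1 : forall i s, setdig i (toN s) a < 126).
  { intros. pose proof (setdig_bound i (toN s) a). pose proof (toN_bounds s). lia. }
  assert (H2 : forall i, setdig i 0 a < 126).
  { intros. pose proof (setdig_bound i 0 a). lia. }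
  unfold delta, delta_at, mark.
  repeat match goal with
  | |- context [if ?b then _ else _] => destruct b
  | |- context [match ?x with _ => _ end] => destruct x
  end; cbn [fst snd]; split; auto; try lia; try apply H0; lia.
Qed.

Lemma machine_ok : TM_ok machine.
Proof.
  unfold TM_ok, machine. cbn [tm_k tm_n tm_start tm_acc tm_rej tm_delta].
  do 5 (split; [lia|]). intros q a Hq Ha.
  destruct (delta_bound q a Ha) as [H1 H2].
  destruct (delta q a) as [[q' a'] d]. auto.
Qed.

Lemma st_in pc ph : pc < n -> st pc ph = 4 * pc + ph.
Proof. intros. unfold st. destruct (Nat.ltb_spec pc n); lia. Qed.

Lemma delta_in pc ph a : pc < n -> ph < 4 -> delta (st pc ph) a = delta_at pc ph a.
Proof.
  intros Hp Hh. unfold delta.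
  rewrite (st_in pc ph) by assumption.
  destruct (Nat.eqb_spec (4 * pc + ph) (4 * n + 2)); [lia|].
  destruct (Nat.eqb_spec (4 * pc + ph) (4 * n + 3)); [lia|].
  replace ((4 * pc + ph) / 4) with pc
    by (rewrite Nat.mul_comm, Nat.div_add_l, (Nat.div_small ph 4); lia).
  replace ((4 * pc + ph) mod 4) with ph
    by (rewrite Nat.add_comm, Nat.mul_comm, Nat.Div0.mod_add, Nat.mod_small; lia).
  reflexivity.
Qed.

(* The head is on cell [p] of a tape whose cells [0, 1, ...] hold [f]; nothing is left of cell 0. *)
Definition at_cell (q p : nat) (f : nat -> nat) (c : tconf) : Prop :=
  exists r, c = (q, rev (map f (seq 0 p)), f p, r) /\ forall j, nth j r 0 = f (S (p + j)).

Lemma at_cell_ext q p f g c : (forall j, f j = g j) -> at_cell q p f c -> at_cell q p g c.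
Proof.
  intros E [r [-> H]]. exists r. split.
  - rewrite (map_ext f g E), E. reflexivity.
  - intros. rewrite <- E. apply H.
Qed.

Definition updf (f : nat -> nat) (p a : nat) (j : nat) := if j =? p then a else f j.

Lemma updf_same f p j : updf f p (f p) j = f j.
Proof. unfold updf. destruct (Nat.eqb_spec j p); congruence. Qed.

Lemma map_updf f p a k : map (updf f (k + p) a) (seq 0 k) = map f (seq 0 k).
Proof.
  apply map_ext_in. intros j Hj. apply in_seq in Hj. unfold updf.
  destruct (Nat.eqb_spec j (k + p)); [lia|reflexivity].
Qed.

Lemma nth_hd0_tl r : hd0 r = nth 0 r 0 /\ forall j, nth j (tl r) 0 = nth (S j) r 0.
Proof. destruct r; simpl; split; auto. intros []; reflexivity. Qed.

Lemma tstep_at q p f c q' a' d :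
  q < 4 * n -> at_cell q p f c -> delta q (f p) = (q', a', d) ->
  match d with
  | Stay => at_cell q' p (updf f p a') (tstep machine c)
  | Rt => at_cell q' (S p) (updf f p a') (tstep machine c)
  | L => 0 < p -> at_cell q' (pred p) (updf f p a') (tstep machine c)
  end.
Proof.
  intros Hq [r [-> Hr]] Hd.
  assert (E : tstep machine (q, rev (map f (seq 0 p)), f p, r) =
    match d with
    | Stay => (q', rev (map f (seq 0 p)), a', r)
    | L => (q', tl (rev (map f (seq 0 p))), hd0 (rev (map f (seq 0 p))), a' :: r)
    | Rt => (q', a' :: rev (map f (seq 0 p)), hd0 r, tl r)
    end).
  { unfold tstep. cbn [machine tm_acc tm_rej tm_delta]. rewrite Hd.
    destruct (Nat.eqb_spec q (4 * n)); [lia|].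
    destruct (Nat.eqb_spec q (4 * n + 1)); [lia|]. simpl.
    destruct d; reflexivity. }
  rewrite E. destruct (nth_hd0_tl r) as [R0 R1]. destruct d.
  - intros Hp. destruct p as [|p]; [lia|]. simpl pred.
    assert (M : map (updf f (S p) a') (seq 0 p) = map f (seq 0 p)).
    { rewrite <- (Nat.add_1_r p). apply map_updf. }
    assert (U : updf f (S p) a' p = f p).
    { unfold updf. destruct (Nat.eqb_spec p (S p)); [lia|reflexivity]. }
    exists (a' :: r). split.
    + rewrite M, U, seq_S, map_app, rev_app_distr. reflexivity.
    + intros [|j]; simpl; unfold updf.
      * rewrite Nat.add_0_r, Nat.eqb_refl. reflexivity.
      * rewrite Hr, Nat.add_succ_r. destruct (Nat.eqb_spec (S (S (p + j))) (S p)); [lia|]. reflexivity.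
  - assert (M : map (updf f p a') (seq 0 p) = map f (seq 0 p)).
    { rewrite <- (Nat.add_0_r p) at 1. apply map_updf. }
    assert (U : updf f p a' (S p) = f (S p)).
    { unfold updf. destruct (Nat.eqb_spec (S p) p); [lia|reflexivity]. }
    exists (tl r). split.
    + rewrite seq_S, map_app, rev_app_distr, M, U, R0, Hr, Nat.add_0_r. simpl.
      unfold updf. rewrite Nat.eqb_refl. reflexivity.
    + intros j. rewrite R1, Hr. unfold updf.
      rewrite Nat.add_succ_r. destruct (Nat.eqb_spec (S (S p + j)) p); [lia|]. reflexivity.
  - assert (M : map (updf f p a') (seq 0 p) = map f (seq 0 p)).
    { rewrite <- (Nat.add_0_r p) at 1. apply map_updf. }
    exists r. split.
    + rewrite M. unfold updf. rewrite Nat.eqb_refl. reflexivity.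
    + intros j. rewrite Hr. unfold updf.
      destruct (Nat.eqb_spec (S (p + j)) p); [lia|reflexivity].
Qed.

Lemma tstep_left q p f c q' a' :
  q < 4 * n -> at_cell q (S p) f c -> delta q (f (S p)) = (q', a', L) ->
  at_cell q' p (updf f (S p) a') (tstep machine c).
Proof. intros Hq Hc Hd. apply (tstep_at _ _ _ _ _ _ _ Hq Hc Hd). lia. Qed.

Definition reaches (k : nat) (c : tconf) (P : tconf -> Prop) : Prop :=
  exists t, t <= k /\ P (Nat.iter t (tstep machine) c).

Lemma reaches_trans k1 k2 c P Q :
  reaches k1 c P -> (forall c', P c' -> reaches k2 c' Q) -> reaches (k1 + k2) c Q.
Proof.
  intros [t1 [H1 P1]] H. destruct (H _ P1) as [t2 [H2 P2]].
  exists (t2 + t1). split; [lia|]. rewrite Nat.iter_add. exact P2.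
Qed.

Lemma reaches_step c P : P (tstep machine c) -> reaches 1 c P.
Proof. intros. exists 1. auto. Qed.

Lemma reaches_now k c (P : tconf -> Prop) : P c -> reaches k c P.
Proof. intros. exists 0. split; [lia|auto]. Qed.

Lemma reaches_le k k' c P : reaches k c P -> k <= k' -> reaches k' c P.
Proof. intros [t [H1 H2]] H. exists t. split; [lia|auto]. Qed.

Lemma scan_left pc s p c : pc < n -> at_cell (st pc 3) p (colf s) c ->
  reaches (S p) c (at_cell (st pc 0) 0 (colf s)).
Proof.
  intros Hpc. revert c. induction p as [|p IH]; intros c Hc.
  - apply reaches_step.
    eapply at_cell_ext; [|eapply (tstep_at _ _ _ _ _ _ Stay); [|exact Hc|]].
    + apply updf_same.
    + rewrite st_in by assumption. lia.
    + rewrite delta_in by lia. unfold delta_at. reflexivity.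
  - apply (reaches_trans 1 (S p) _ (at_cell (st pc 3) p (colf s))); [|exact IH].
    apply reaches_step.
    eapply at_cell_ext; [|eapply tstep_left; [|exact Hc|]].
    + apply updf_same.
    + rewrite st_in by assumption. lia.
    + rewrite delta_in by lia. unfold delta_at.
      pose proof (colf_bound s (S p)). unfold mark.
      destruct (Nat.eqb_spec (colf s (S p)) 125); [lia|reflexivity].
Qed.

Definition on_stack (i : sid) (ins : instr) : Prop :=
  match ins with
  | IPush j _ | IPop j | IJmp j _ _ => i = j
  | IHalt _ => False
  end.

Lemma scan_right pc s i p k c : pc < n -> on_stack i (fetch prog pc) ->
  p + k = length (get i s) ->
  at_cell (st pc 1) (S p) (colf s) c ->
  reaches k c (at_cell (st pc 1) (S (length (get i s))) (colf s)).
Proof.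
  intros Hpc Hi. revert p c. induction k as [|k IH]; intros p c Hk Hc.
  - apply reaches_now. replace (length (get i s)) with p by lia. exact Hc.
  - apply (reaches_trans 1 k _ (at_cell (st pc 1) (S (S p)) (colf s)));
      [|intros; eapply (IH (S p)); [lia|assumption]].
    apply reaches_step.
    eapply at_cell_ext; [|eapply (tstep_at _ _ _ _ _ _ Rt); [|exact Hc|]].
    + apply updf_same.
    + rewrite st_in by assumption. lia.
    + rewrite delta_in by lia. unfold delta_at.
      assert (D : dig i (colf s (S p)) =? 0 = false).
      { rewrite colf_dig. apply Nat.eqb_neq, cell_in. lia. }
      destruct (fetch prog pc); simpl in Hi; subst; try rewrite D; try reflexivity. easy.
Qed.

Lemma find_top pc s i c : pc < n -> on_stack i (fetch prog pc) ->
  at_cell (st pc 0) 0 (colf s) c ->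
  reaches (S (length (get i s))) c (at_cell (st pc 1) (S (length (get i s))) (colf s)).
Proof.
  intros Hpc Hi Hc.
  apply (reaches_trans 1 (length (get i s)) _ (at_cell (st pc 1) 1 (colf s))).
  - apply reaches_step.
    eapply at_cell_ext; [|eapply (tstep_at _ _ _ _ _ _ Rt); [|exact Hc|]].
    + apply updf_same.
    + rewrite st_in by assumption. lia.
    + rewrite delta_in by lia. unfold delta_at. destruct (fetch prog pc); try reflexivity. easy.
  - intros c'. apply scan_right with (p := 0); auto.
Qed.

Lemma read_top pc s i c : pc < n ->
  match fetch prog pc with IPop j | IJmp j _ _ => i = j | _ => False end ->
  at_cell (st pc 0) 0 (colf s) c ->
  reaches (S (S (length (get i s)))) c (at_cell (st pc 2) (length (get i s)) (colf s)).
Proof.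
  intros Hpc Hi Hc.
  apply reaches_le with (S (length (get i s)) + 1); [|lia].
  assert (Hi' : on_stack i (fetch prog pc)) by (destruct (fetch prog pc); simpl in *; easy).
  eapply reaches_trans; [exact (find_top pc s i c Hpc Hi' Hc)|].
  - intros c' Hc'. apply reaches_step.
    eapply at_cell_ext; [|eapply tstep_left; [|exact Hc'|]].
    + apply updf_same.
    + rewrite st_in by assumption. lia.
    + rewrite delta_in by lia. unfold delta_at.
      assert (D : dig i (colf s (S (length (get i s)))) =? 0 = true).
      { rewrite colf_dig. apply Nat.eqb_eq, cell_out. lia. }
      destruct (fetch prog pc); subst; try rewrite D; try reflexivity; easy.
Qed.

(** For an empty stack, phase 2 stands on cell 0, and the mark has to be read as the absence of a
    top symbol. *)
Lemma top_colf s i :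
  (if colf s (length (get i s)) =? mark then None
   else ofN (dig i (colf s (length (get i s))))) = top i s.
Proof.
  unfold top. destruct (get i s) as [|a l] eqn:E; simpl length.
  - reflexivity.
  - pose proof (colf_bound s (S (length l))). unfold mark.
    destruct (Nat.eqb_spec (colf s (S (length l))) 125); [lia|].
    rewrite colf_dig, E, cell_cons, Nat.eqb_refl. destruct a; reflexivity.
Qed.

(** The head walks to the top of one stack and back to the mark, which takes time linear in the
    height [h]. *)
Lemma sim_step pc s pc' s' c : fstep prog (pc, s) (pc', s') -> pc' < n ->
  at_cell (st pc 0) 0 (colf s) c ->
  forall h, (forall i, length (get i s) <= h) ->
  reaches (2 * h + 5) c (at_cell (st pc' 0) 0 (colf s')).
Proof.
  intros Hs Hpc' Hc h Hh. inversion Hs; subst; clear Hs.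
  - specialize (Hh i).
    apply reaches_le with (S (length (get i s)) + (1 + S (length (get i s)))); [|lia].
    eapply reaches_trans; [apply find_top with (i := i); eauto|].
    { rewrite H4. reflexivity. }
    intros c' Hc'.
    eapply reaches_trans; [|intros c2 Hc2; exact (scan_left _ _ _ _ Hpc' Hc2)].
    apply reaches_step.
    eapply at_cell_ext; [|eapply tstep_left; [|exact Hc'|]].
    2: rewrite st_in; unfold n in *; lia.
    2: { rewrite delta_in by (unfold n; lia). unfold delta_at. rewrite H4.
         rewrite colf_dig, cell_out by lia. reflexivity. }
    intros j. unfold updf, push.
    destruct (Nat.eqb_spec j (S (length (get i s)))) as [->|Hj].
    + rewrite colf_set, cell_cons, Nat.eqb_refl. reflexivity.
    + destruct j as [|j]; [reflexivity|].
      rewrite colf_set, cell_cons.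
      destruct (Nat.eqb_spec j (length (get i s))); [lia|].
      symmetry. apply setdig_same.
  - specialize (Hh i).
    apply reaches_le with (S (S (length (get i s))) + (1 + S (length (get i s)))); [|lia].
    eapply reaches_trans; [apply read_top with (i := i); eauto|].
    { rewrite H4. reflexivity. }
    intros c' Hc'.
    eapply reaches_trans; [|intros c2 Hc2; exact (scan_left _ _ _ _ Hpc' Hc2)].
    apply reaches_step.
    eapply at_cell_ext; [|eapply (tstep_at _ _ _ _ _ _ Stay); [|exact Hc'|]].
    2: rewrite st_in; unfold n in *; lia.
    2: { rewrite delta_in by (unfold n; lia). unfold delta_at. rewrite H4. reflexivity. }
    intros j. unfold updf, pop.
    destruct (get i s) as [|a l] eqn:E; simpl length.
    + destruct j; simpl; [reflexivity|].
      change (colf s (S j) = colf (set i [] s) (S j)).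
      rewrite colf_set, <- E. symmetry. apply setdig_same.
    + destruct (Nat.eqb_spec j (S (length l))) as [->|Hj].
      * pose proof (colf_bound s (S (length l))). unfold mark.
        destruct (Nat.eqb_spec (colf s (S (length l))) 125); [lia|].
        rewrite colf_set. f_equal. simpl. symmetry. apply cell_out. lia.
      * destruct j as [|j]; [reflexivity|].
        rewrite colf_set. simpl tl.
        rewrite <- (setdig_same s i j) at 1. f_equal. rewrite E, cell_cons.
        destruct (Nat.eqb_spec j (length l)); [lia|reflexivity].
  - specialize (Hh i).
    apply reaches_le with (S (S (length (get i s'))) + (1 + S (length (get i s')))); [|lia].
    eapply reaches_trans; [apply read_top with (i := i); eauto|].
    { rewrite H4. reflexivity. }
    intros c' Hc'.
    eapply reaches_trans; [|intros c2 Hc2; exact (scan_left _ _ _ _ Hpc' Hc2)].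
    apply reaches_step.
    eapply at_cell_ext; [|eapply (tstep_at _ _ _ _ _ _ Stay); [|exact Hc'|]].
    + apply updf_same.
    + rewrite st_in; unfold n in *; lia.
    + rewrite delta_in by (unfold n; lia). unfold delta_at. rewrite H4, top_colf. reflexivity.
Qed.

Lemma fstep_length pc s pc' s' h : fstep prog (pc, s) (pc', s') ->
  (forall i, length (get i s) <= h) -> forall i, length (get i s') <= S h.
Proof.
  intros Hs Hh j. specialize (Hh j).
  inversion Hs; subst; auto; unfold push, pop; destruct i, j; simpl in *;
    rewrite ?length_tl; lia.
Qed.

(** A step raises a stack by at most one symbol, so heights stay below [h + t] and the overhead is
    quadratic. *)
Lemma sim_steps t pc s pc' s' c : fsteps prog t (pc, s) (pc', s') -> pc' < n ->
  at_cell (st pc 0) 0 (colf s) c ->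
  forall h, (forall i, length (get i s) <= h) ->
  reaches (t * (2 * (h + t) + 5)) c (at_cell (st pc' 0) 0 (colf s')).
Proof.
  intros Hs. remember (pc, s) as d eqn:E. remember (pc', s') as d' eqn:E'.
  revert pc s pc' s' c E E'.
  induction Hs as [d|t d [pc1 r1] d' H1 H2 IH]; intros pc s pc' s' c -> E' Hpc' Hc h Hh.
  - injection E' as -> ->. apply reaches_now. exact Hc.
  - subst d'. assert (Hpc1 : pc1 < n).
    { inversion H2; subst; auto. inversion H; subst; auto. }
    apply reaches_le with ((2 * h + 5) + t * (2 * (S h + t) + 5)); [|lia].
    eapply reaches_trans; [eapply sim_step; eauto|].
    intros c' Hc'. eapply IH; eauto. eapply fstep_length; eauto.
Qed.

Lemma tinit_start (x : list sym) :
  reaches 2 (tinit machine (map toN x)) (at_cell (st 0 0) 0 (colf (St (rev x) [] []))).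
Proof.
  exists 2. split; [lia|].
  change (at_cell (st 0 0) 0 (colf (St (rev x) [] []))
    (tstep machine (tstep machine (tinit machine (map toN x))))).
  unfold tinit. cbn [machine tm_start].
  assert (E1 : tstep machine (4 * n + 2, [], hd0 (map toN x), tl (map toN x)) =
    (4 * n + 3, [], 0, hd0 (map toN x) :: tl (map toN x))).
  { unfold tstep. cbn [machine tm_acc tm_rej tm_delta].
    destruct (Nat.eqb_spec (4 * n + 2) (4 * n)); [lia|].
    destruct (Nat.eqb_spec (4 * n + 2) (4 * n + 1)); [lia|]. cbn [orb].
    unfold delta. rewrite Nat.eqb_refl. reflexivity. }
  rewrite E1.
  set (r := hd0 (map toN x) :: tl (map toN x)).
  assert (E2 : tstep machine (4 * n + 3, [], 0, r) = (st 0 0, [], mark, r)).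
  { unfold tstep. cbn [machine tm_acc tm_rej tm_delta].
    destruct (Nat.eqb_spec (4 * n + 3) (4 * n)); [lia|].
    destruct (Nat.eqb_spec (4 * n + 3) (4 * n + 1)); [lia|]. cbn [orb].
    unfold delta. rewrite Nat.eqb_refl.
    destruct (Nat.eqb_spec (4 * n + 3) (4 * n + 2)); [lia|]. reflexivity. }
  rewrite E2. exists r. split; [reflexivity|].
  intros j. cbn [Nat.add colf g0 g1 g2]. unfold code, cell. rewrite rev_involutive.
  replace (nth j r 0) with (nth j (map toN x) 0).
  - assert (E : nth j (map toN (rev [])) 0 = 0) by (destruct j; reflexivity).
    rewrite E. lia.
  - unfold r. destruct x; simpl; [|reflexivity]. destruct j as [|[]]; reflexivity.
Qed.

Lemma tstep_acc_rej c : tstate c = 4 * n \/ tstate c = 4 * n + 1 -> tstep machine c = c.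
Proof.
  destruct c as [[[q l] a] r]. unfold tstep, tstate. cbn [machine tm_acc tm_rej tm_delta].
  intros H. destruct (Nat.eqb_spec q (4 * n)), (Nat.eqb_spec q (4 * n + 1)); auto. lia.
Qed.

Lemma iter_acc_rej c k : tstate c = 4 * n \/ tstate c = 4 * n + 1 ->
  Nat.iter k (tstep machine) c = c.
Proof. intros H. induction k; simpl; auto. rewrite IHk. apply tstep_acc_rej, H. Qed.

(** The halting states are fixed points of [tstep], so any [T] beyond the halting time gives the
    same verdict. *)
Theorem machine_run (x : list sym) t pc s b :
  fsteps prog t (0, St (rev x) [] []) (pc, s) -> pc < n -> fetch prog pc = IHalt b ->
  forall T, t * (2 * (length x + t) + 5) + 3 <= T ->
  tstate (trun machine T (map toN x)) = if b then tm_acc machine else tm_rej machine.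
Proof.
  intros Hs Hpc Hb T HT.
  assert (H : reaches T (tinit machine (map toN x))
    (fun c => tstate c = if b then 4 * n else 4 * n + 1)).
  { apply reaches_le with (2 + (t * (2 * (length x + t) + 5) + 1)); [|lia].
    eapply reaches_trans; [apply tinit_start|]. intros c1 H1.
    eapply reaches_trans; [eapply sim_steps; eauto|].
    - intros []; simpl; rewrite ?length_rev; lia.
    - intros c2 H2. apply reaches_step.
      assert (D : delta (st pc 0) (colf s 0) = (if b then 4 * n else 4 * n + 1, colf s 0, Stay)).
      { rewrite delta_in by lia. unfold delta_at. rewrite Hb. reflexivity. }
      eapply (tstep_at _ _ _ _ _ _ Stay) in D; [|rewrite st_in by assumption; lia|exact H2].
      destruct D as [r [-> _]]. reflexivity. }
  destruct H as [t' [Ht' H]]. unfold trun.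
  replace T with ((T - t') + t') by lia.
  rewrite Nat.iter_add, iter_acc_rej; [exact H|].
  destruct b; rewrite H; auto.
Qed.

End Compile.

(** * Structured programs and their compilation to jumps *)

Inductive cmd :=
  | CSkip
  | CPush (i : sid) (a : sym)
  | CPop (i : sid)
  | CSeq (c1 c2 : cmd)
  | CIf (i : sid) (f : option sym -> bool) (c1 c2 : cmd)
  | CWhile (i : sid) (f : option sym -> bool) (c : cmd).

(** The times count compiled instructions: a true branch pays for the test and for the jump over the
    other branch, a false branch for the test only, and a round of a loop for the test and the jump
    back. *)
Inductive exec : cmd -> stk -> nat -> stk -> Prop :=
  | ex_skip s : exec CSkip s 0 s
  | ex_push i a s : exec (CPush i a) s 1 (push i a s)
  | ex_pop i s : exec (CPop i) s 1 (pop i s)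
  | ex_seq c1 c2 s t1 s1 t2 s2 :
      exec c1 s t1 s1 -> exec c2 s1 t2 s2 -> exec (CSeq c1 c2) s (t1 + t2) s2
  | ex_if_true i f c1 c2 s t s' : f (top i s) = true ->
      exec c1 s t s' -> exec (CIf i f c1 c2) s (t + 2) s'
  | ex_if_false i f c1 c2 s t s' : f (top i s) = false ->
      exec c2 s t s' -> exec (CIf i f c1 c2) s (t + 1) s'
  | ex_while_false i f c s : f (top i s) = false -> exec (CWhile i f c) s 1 s
  | ex_while_true i f c s t1 s1 t2 s2 : f (top i s) = true ->
      exec c s t1 s1 -> exec (CWhile i f c) s1 t2 s2 ->
      exec (CWhile i f c) s (t1 + t2 + 2) s2.

Definition goto (t : nat) := IJmp X0 (fun _ => false) t.

Fixpoint csize (c : cmd) : nat :=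
  match c with
  | CSkip => 0
  | CPush _ _ | CPop _ => 1
  | CSeq c1 c2 => csize c1 + csize c2
  | CIf _ _ c1 c2 => csize c1 + csize c2 + 2
  | CWhile _ _ c => csize c + 2
  end.

Fixpoint comp (o : nat) (c : cmd) : list instr :=
  match c with
  | CSkip => []
  | CPush i a => [IPush i a]
  | CPop i => [IPop i]
  | CSeq c1 c2 => comp o c1 ++ comp (o + csize c1) c2
  | CIf i f c1 c2 =>
      IJmp i f (o + csize c1 + 2) :: comp (S o) c1 ++
      goto (o + csize c1 + csize c2 + 2) :: comp (o + csize c1 + 2) c2
  | CWhile i f c => IJmp i f (o + csize c + 2) :: comp (S o) c ++ [goto o]
  end.

Lemma comp_length c o : length (comp o c) = csize c.
Proof.
  revert o. induction c; intros; simpl; auto; rewrite ?length_app; simpl;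
    rewrite ?IHc, ?IHc1, ?IHc2; lia.
Qed.

Lemma fetch_app pre ins post : fetch (pre ++ ins :: post) (length pre) = ins.
Proof. unfold fetch. rewrite app_nth2, Nat.sub_diag; [reflexivity|lia]. Qed.

Lemma fetch_mid p pre ins post k : p = pre ++ ins :: post -> k = length pre ->
  fetch p k = ins /\ k < length p.
Proof. intros -> ->. split; [apply fetch_app|]. rewrite length_app. simpl. lia. Qed.

Lemma goto_step p pre t post k s : p = pre ++ goto t :: post -> k = length pre ->
  fstep p (k, s) (t, s).
Proof.
  intros Hp Hk. destruct (fetch_mid _ _ _ _ _ Hp Hk) as [F G].
  exact (fs_jmp p k s X0 (fun _ => false) t G F).
Qed.

Lemma jmp_step p pre i f t post k s pc : p = pre ++ IJmp i f t :: post -> k = length pre ->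
  pc = (if f (top i s) then S k else t) -> fstep p (k, s) (pc, s).
Proof.
  intros Hp Hk ->. destruct (fetch_mid _ _ _ _ _ Hp Hk) as [F G]. constructor; auto.
Qed.

(** Jump targets are absolute, so the code is placed in an arbitrary context [pre], [post], which
    lets the induction treat subcommands inside the code of their parent. *)
Lemma comp_correct c s t s' : exec c s t s' ->
  forall p pre post, p = pre ++ comp (length pre) c ++ post ->
  fsteps p t (length pre, s) (length pre + csize c, s').
Proof.
  induction 1; intros p pre post Hp; simpl in Hp.
  - simpl. rewrite Nat.add_0_r. constructor.
  - destruct (fetch_mid _ _ _ _ _ Hp eq_refl). simpl. rewrite Nat.add_1_r.
    econstructor; [eapply fs_push; eauto|constructor].
  - destruct (fetch_mid _ _ _ _ _ Hp eq_refl). simpl. rewrite Nat.add_1_r.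
    econstructor; [eapply fs_pop; eauto|constructor].
  - rewrite <- app_assoc in Hp. simpl. rewrite Nat.add_assoc.
    eapply fsteps_trans; [eapply IHexec1; eauto|].
    replace (length pre + csize c1) with (length (pre ++ comp (length pre) c1))
      by (rewrite length_app, comp_length; reflexivity).
    eapply IHexec2 with (post := post).
    rewrite length_app, comp_length, Hp, !app_assoc. reflexivity.
  - replace (t + 2) with (1 + (t + 1)) by lia.
    eapply fsteps_trans; [econstructor; [|constructor]|].
    { eapply jmp_step; [exact Hp|reflexivity|]. rewrite H. reflexivity. }
    eapply fsteps_trans.
    + replace (S (length pre)) with (length (pre ++ [IJmp i f (length pre + csize c1 + 2)]))
        by (rewrite length_app; simpl; lia).
      eapply IHexec.
      rewrite Hp, length_app, <- !app_assoc. simpl. rewrite Nat.add_1_r, <- ?app_assoc. reflexivity.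
    + econstructor; [|constructor].
      rewrite length_app. simpl.
      replace (length pre + (csize c1 + csize c2 + 2)) with
        (length pre + csize c1 + csize c2 + 2) by lia.
      eapply goto_step with
        (pre := pre ++ IJmp i f (length pre + csize c1 + 2) :: comp (S (length pre)) c1).
      * rewrite Hp. repeat (rewrite <- app_assoc; simpl). reflexivity.
      * rewrite length_app. simpl. rewrite comp_length. lia.
  - replace (t + 1) with (1 + t) by lia.
    eapply fsteps_trans; [econstructor; [|constructor]|].
    { eapply jmp_step; [exact Hp|reflexivity|]. rewrite H. reflexivity. }
    set (pre' := pre ++ IJmp i f (length pre + csize c1 + 2) :: comp (S (length pre)) c1 ++
           [goto (length pre + csize c1 + csize c2 + 2)]).
    assert (Hl : length pre' = length pre + csize c1 + 2).
    { unfold pre'. rewrite length_app. simpl. rewrite length_app, comp_length. simpl. lia. }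
    simpl. replace (length pre + (csize c1 + csize c2 + 2)) with
      (length pre + csize c1 + 2 + csize c2) by lia.
    rewrite <- Hl. eapply IHexec with (post := post).
    rewrite Hl, Hp. unfold pre'. repeat (rewrite <- app_assoc; simpl). reflexivity.
  - simpl. econstructor; [|constructor].
    eapply jmp_step; [exact Hp|reflexivity|]. rewrite H. lia.
  - replace (t1 + t2 + 2) with (1 + (t1 + (1 + t2))) by lia.
    eapply fsteps_trans; [econstructor; [|constructor]|].
    { eapply jmp_step; [exact Hp|reflexivity|]. rewrite H. reflexivity. }
    eapply fsteps_trans.
    + replace (S (length pre)) with (length (pre ++ [IJmp i f (length pre + csize c + 2)]))
        by (rewrite length_app; simpl; lia).
      eapply IHexec1.
      rewrite Hp, length_app, <- !app_assoc. simpl. rewrite Nat.add_1_r, <- ?app_assoc. reflexivity.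
    + eapply fsteps_trans; [econstructor; [|constructor]|].
      * eapply goto_step with
          (pre := pre ++ IJmp i f (length pre + csize c + 2) :: comp (S (length pre)) c).
        -- rewrite Hp. repeat (rewrite <- app_assoc; simpl). reflexivity.
        -- rewrite !length_app. simpl. rewrite comp_length. lia.
      * eapply IHexec2 with (post := post). exact Hp.
Qed.

Definition decider (c : cmd) (i : sid) (f : option sym -> bool) : TM :=
  machine (comp 0 c ++ [IJmp i f (csize c + 2); IHalt true; IHalt false]).

Theorem decider_run c i f (x : list sym) t s :
  exec c (St (rev x) [] []) t s ->
  forall T, (t + 1) * (2 * (length x + t + 1) + 5) + 3 <= T ->
  tstate (trun (decider c i f) T (map toN x)) =
    if f (top i s) then tm_acc (decider c i f) else tm_rej (decider c i f).
Proof.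
  intros Hx T HT. unfold decider.
  set (p := comp 0 c ++ [IJmp i f (csize c + 2); IHalt true; IHalt false]).
  assert (Hlen : length p = csize c + 3).
  { unfold p. rewrite length_app, comp_length. reflexivity. }
  apply machine_run with (t := t + 1) (s := s)
    (pc := if f (top i s) then S (csize c) else csize c + 2).
  - eapply fsteps_trans.
    + apply (comp_correct _ _ _ _ Hx p [] [IJmp i f (csize c + 2); IHalt true; IHalt false]).
      reflexivity.
    + econstructor; [|constructor]. simpl.
      eapply jmp_step; [reflexivity|symmetry; apply comp_length|]. reflexivity.
  - rewrite Hlen. destruct (f (top i s)); lia.
  - unfold fetch, p. rewrite app_nth2; rewrite comp_length; destruct (f (top i s)); try lia.
    + replace (S (csize c) - csize c) with 1 by lia. reflexivity.
    + replace (csize c + 2 - csize c) with 2 by lia. reflexivity.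
  - lia.
Qed.

(** * Polynomially bounded programs on trees *)

Inductive poly : (nat -> nat) -> Prop :=
  | poly_id : poly (fun n => n)
  | poly_const c : poly (fun _ => c)
  | poly_add p q : poly p -> poly q -> poly (fun n => p n + q n)
  | poly_mul p q : poly p -> poly q -> poly (fun n => p n * q n)
  | poly_comp p q : poly p -> poly q -> poly (fun n => p (q n)).

Lemma poly_mono p : poly p -> forall n m, n <= m -> p n <= p m.
Proof.
  induction 1; intros n m H'; auto.
  - apply Nat.add_le_mono; auto.
  - apply Nat.mul_le_mono; auto.
Qed.

(** The base is at least 2 for every [n], so one more factor absorbs a sum of two powers and a power
    absorbs a constant. For a composition, [q n + 2] is at most [(n + 2) ^ (b + 2)]. *)
Lemma poly_bound p : poly p -> exists k, forall n, p n <= (n + 2) ^ k.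
Proof.
  assert (M : forall n a b, a <= b -> (n + 2) ^ a <= (n + 2) ^ b).
  { intros. apply Nat.pow_le_mono_r; lia. }
  induction 1 as [|c|p q _ [a Ha] _ [b Hb]|p q _ [a Ha] _ [b Hb]|p q _ [a Ha] _ [b Hb]].
  - exists 1. intros. rewrite Nat.pow_1_r. lia.
  - exists c. intros. pose proof (Nat.pow_gt_lin_r (n + 2) c). lia.
  - exists (S (a + b)). intros n. specialize (Ha n). specialize (Hb n).
    pose proof (M n a (a + b)). pose proof (M n b (a + b)).
    rewrite Nat.pow_succ_r'. nia.
  - exists (a + b). intros n. rewrite Nat.pow_add_r. apply Nat.mul_le_mono; auto.
  - exists (S (S b) * a). intros n. rewrite Nat.pow_mul_r.
    eapply Nat.le_trans; [apply Ha|]. apply Nat.pow_le_mono_l.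
    specialize (Hb n). pose proof (M n 0 b ltac:(lia)). simpl in H.
    rewrite !Nat.pow_succ_r'. nia.
Qed.

Ltac poly := cbv beta; repeat first
  [ assumption
  | apply poly_const
  | apply poly_id
  | apply poly_add
  | apply poly_mul
  | match goal with |- poly (fun n => ?p (@?q n)) => apply (poly_comp p q) end ].

Inductive tree := Leaf | Node (a b : tree).

Fixpoint ser (t : tree) : list sym :=
  match t with
  | Leaf => [s1]
  | Node a b => s2 :: ser a ++ ser b
  end.

Fixpoint tsize (t : tree) : nat :=
  match t with Leaf => 1 | Node a b => S (tsize a + tsize b) end.

Lemma ser_length t : length (ser t) = tsize t.
Proof. induction t; simpl; auto. rewrite length_app. lia. Qed.

Lemma tsize_pos t : 1 <= tsize t.
Proof. destruct t; simpl; lia. Qed.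

Definition is (a : sym) (o : option sym) : bool :=
  match o, a with
  | Some s1, s1 | Some s2, s2 | Some s3, s3 | Some s4, s4 => true
  | _, _ => false
  end.
Definition is12 (o : option sym) : bool := is s1 o || is s2 o.

(** Serialised trees use only [s1] and [s2]; the other two symbols remain free as a counter and as a
    separator, and [movs] stops at them. *)
Definition bits (l : list sym) := List.Forall (fun a => a = s1 \/ a = s2) l.

Lemma ser_bits t : bits (ser t).
Proof.
  unfold bits. induction t; simpl; constructor; auto. apply Forall_app. auto.
Qed.

Lemma bits_rev l : bits l -> bits (rev l).
Proof. apply Forall_rev. Qed.

Definition runs (c : cmd) (s : stk) (t : nat) (s' : stk) := exists t', t' <= t /\ exec c s t' s'.

Lemma runs_le c s t t' s' : runs c s t s' -> t <= t' -> runs c s t' s'.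
Proof. intros [k [H1 H2]] H. exists k. split; [lia|auto]. Qed.

Lemma runs_skip s : runs CSkip s 0 s.
Proof. exists 0. split; [lia|constructor]. Qed.

Lemma runs_push i a s : runs (CPush i a) s 1 (push i a s).
Proof. exists 1. split; [lia|constructor]. Qed.

Lemma runs_pop i s : runs (CPop i) s 1 (pop i s).
Proof. exists 1. split; [lia|constructor]. Qed.

Lemma runs_seq c1 c2 s t1 r1 t2 r2 :
  runs c1 s t1 r1 -> runs c2 r1 t2 r2 -> runs (CSeq c1 c2) s (t1 + t2) r2.
Proof.
  intros [k1 [H1 E1]] [k2 [H2 E2]]. exists (k1 + k2). split; [lia|].
  econstructor; eauto.
Qed.

Lemma runs_if_true i f c1 c2 s t s' : f (top i s) = true ->
  runs c1 s t s' -> runs (CIf i f c1 c2) s (t + 2) s'.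
Proof. intros H [k [H1 H2]]. exists (k + 2). split; [lia|]. apply ex_if_true; auto. Qed.

Lemma runs_if_false i f c1 c2 s t s' : f (top i s) = false ->
  runs c2 s t s' -> runs (CIf i f c1 c2) s (t + 2) s'.
Proof. intros H [k [H1 H2]]. exists (k + 1). split; [lia|]. apply ex_if_false; auto. Qed.

Lemma runs_while_false i f c s : f (top i s) = false -> runs (CWhile i f c) s 1 s.
Proof. intros H. exists 1. split; [lia|constructor; auto]. Qed.

Lemma runs_while_true i f c s t1 r1 t2 r2 : f (top i s) = true ->
  runs c s t1 r1 -> runs (CWhile i f c) r1 t2 r2 -> runs (CWhile i f c) s (t1 + t2 + 2) r2.
Proof.
  intros H [k1 [H1 E1]] [k2 [H2 E2]]. exists (k1 + k2 + 2). split; [lia|].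
  eapply ex_while_true; eauto.
Qed.

Infix ";;" := CSeq (at level 60, right associativity).

Ltac run1 := first
  [ eapply runs_push | eapply runs_pop | eapply runs_skip
  | eapply runs_seq | eapply runs_if_true; [reflexivity|] | eapply runs_if_false; [reflexivity|] ].
Ltac run := repeat run1.

Definition mov (i j : sid) : cmd :=
  CIf i (is s1) (CPop i ;; CPush j s1) (CPop i ;; CPush j s2).

Definition movs (i j : sid) : cmd := CWhile i is12 (mov i j).

Lemma runs_movs i j l rest s : i <> j -> bits l -> is12 (hd_error rest) = false ->
  get i s = l ++ rest ->
  runs (movs i j) s (6 * length l + 1) (set j (rev l ++ get j s) (set i rest s)).
Proof.
  intros Hij Hl Hr. revert s. induction Hl as [|a l Ha Hl IH]; intros s Hs.
  - replace (set j _ _) with s; [|destruct s, i, j; simpl in *; subst; congruence].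
    apply runs_while_false. unfold top. rewrite Hs. exact Hr.
  - set (s' := push j a (pop i s)).
    assert (Hs' : get i s' = l ++ rest).
    { unfold s', pop. rewrite Hs. destruct s, i, j; simpl in *; congruence. }
    assert (T : top i s = Some a) by (unfold top; rewrite Hs; reflexivity).
    apply runs_le with (4 + (6 * length l + 1) + 2); [|simpl; lia].
    eapply runs_while_true.
    + rewrite T. destruct Ha; subst; reflexivity.
    + instantiate (1 := s'). unfold mov, s'.
      destruct Ha; subst a.
      * eapply runs_le; [eapply runs_if_true; [rewrite T; reflexivity|run]|]; lia.
      * eapply runs_le; [eapply runs_if_false; [rewrite T; reflexivity|run]|]; lia.
    + replace (set j _ _) with (set j (rev l ++ get j s') (set i rest s')); [apply IH; exact Hs'|].
      unfold s'. destruct s, i, j; simpl in *; try congruence; rewrite <- app_assoc; reflexivity.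
Qed.

(* Moves the tree on top of X1, reversed, to X0; the number of subtrees
   still to be read is counted in unary by [s3] on X2. *)
Definition take_loop : cmd :=
  CWhile X2 (is s3)
    (CIf X1 (is s1) (CPop X1 ;; CPush X0 s1 ;; CPop X2)
                    (CPop X1 ;; CPush X0 s2 ;; CPush X2 s3)).
Definition take_tree : cmd := CPush X2 s3 ;; take_loop.

(** The rest of the run is a hypothesis, so that in the case of a node the two subtrees are consumed
    one after the other by the same loop. *)
Lemma runs_take_loop t : forall a m c k s',
  runs take_loop (St (rev (ser t) ++ a) m c) k s' ->
  runs take_loop (St a (ser t ++ m) (s3 :: c)) (7 * tsize t + k) s'.
Proof.
  induction t as [|t1 IH1 t2 IH2]; intros a m c k s' H.
  - apply runs_le with (5 + k + 2); [|simpl; lia].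
    eapply runs_while_true; [reflexivity| |exact H].
    eapply runs_le; [run|simpl; lia].
  - apply runs_le with (5 + (7 * tsize t1 + (7 * tsize t2 + k)) + 2); [|simpl; lia].
    eapply runs_while_true; [reflexivity| |].
    + eapply runs_le; [simpl; run|simpl; lia].
    + unfold push, pop. simpl. rewrite <- app_assoc. apply IH1, IH2.
      simpl in H. rewrite rev_app_distr, <- !app_assoc in H. exact H.
Qed.

Lemma runs_take_tree t a m c : is s3 (hd_error c) = false ->
  runs take_tree (St a (ser t ++ m) c) (7 * tsize t + 2) (St (rev (ser t) ++ a) m c).
Proof.
  intros Hc. unfold take_tree.
  apply runs_le with (1 + (7 * tsize t + 1)); [|lia].
  eapply runs_seq; [run|]. apply runs_take_loop. apply runs_while_false. exact Hc.
Qed.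

Lemma runs_movs01 l m c : bits l ->
  runs (movs X0 X1) (St l m c) (6 * length l + 1) (St [] (rev l ++ m) c).
Proof.
  intros H. apply (runs_movs X0 X1 l [] (St l m c)); auto; [easy|].
  simpl. rewrite app_nil_r. reflexivity.
Qed.

Definition drop_tree : cmd := take_tree ;; CWhile X0 is12 (CPop X0).

Lemma runs_drop_tree t m :
  runs drop_tree (St [] (ser t ++ m) []) (10 * tsize t + 3) (St [] m []).
Proof.
  apply runs_le with (7 * tsize t + 2 + (3 * tsize t + 1)); [|lia].
  eapply runs_seq; [apply runs_take_tree; reflexivity|].
  rewrite app_nil_r, <- ser_length, <- length_rev.
  pose proof (bits_rev _ (ser_bits t)) as B. induction B as [|a l Ha _ IH].
  - apply runs_while_false. reflexivity.
  - apply runs_le with (1 + (3 * length l + 1) + 2); [|simpl; lia].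
    eapply runs_while_true; [destruct Ha; subst; reflexivity|run|exact IH].
Qed.

(** The first tree is parked on [X2] while the second is lifted to [X0]. It is then laid over the
    second one, above a separator [s4] that keeps the reversed serialisations apart while they
    return to [X1]. *)
Definition swap_tree : cmd :=
  take_tree ;; movs X0 X2 ;; take_tree ;; CPush X0 s4 ;; movs X2 X0 ;; movs X0 X1 ;;
  CPop X0 ;; movs X0 X1.

Lemma runs_swap_tree t u m :
  runs swap_tree (St [] (ser t ++ ser u ++ m) []) (30 * (tsize t + tsize u) + 20)
    (St [] (ser u ++ ser t ++ m) []).
Proof.
  pose proof (bits_rev _ (ser_bits t)) as Bt. pose proof (bits_rev _ (ser_bits u)) as Bu.
  eapply runs_le.
  { eapply runs_seq; [apply runs_take_tree; reflexivity|]. rewrite app_nil_r.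
    eapply runs_seq; [apply (runs_movs X0 X2 (rev (ser t)) []);
      [easy|exact Bt|reflexivity|symmetry; apply app_nil_r]|].
    cbn [set get g0 g1 g2]. rewrite rev_involutive, app_nil_r.
    (* The counter of [take_tree] now lies on top of the parked [ser t], whose first symbol is never
       [s3]. *)
    eapply runs_seq; [apply runs_take_tree; destruct t; reflexivity|]. rewrite app_nil_r.
    eapply runs_seq; [run|]. cbn [push set get g0 g1 g2].
    eapply runs_seq; [apply (runs_movs X2 X0 (ser t) []);
      [easy|apply ser_bits|reflexivity|symmetry; apply app_nil_r]|].
    cbn [set get g0 g1 g2].
    eapply runs_seq; [apply (runs_movs X0 X1 (rev (ser t)) (s4 :: rev (ser u)));
      [easy|exact Bt|reflexivity|reflexivity]|].
    cbn [set get g0 g1 g2]. rewrite rev_involutive.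
    eapply runs_seq; [run|]. cbn [pop set get g0 g1 g2 tl].
    pose proof (runs_movs01 (rev (ser u)) (ser t ++ m) [] Bu) as H.
    rewrite rev_involutive in H. exact H. }
  rewrite !length_rev, !ser_length. lia.
Qed.

Definition dup_loop : cmd :=
  CWhile X0 is12 (CIf X0 (is s1) (CPop X0 ;; CPush X1 s1 ;; CPush X2 s1)
                                 (CPop X0 ;; CPush X1 s2 ;; CPush X2 s2)).
Definition dup_tree : cmd := take_tree ;; dup_loop ;; movs X2 X0 ;; movs X0 X1.

Lemma runs_dup_loop l : bits l -> forall m c,
  runs dup_loop (St l m c) (8 * length l + 1) (St [] (rev l ++ m) (rev l ++ c)).
Proof.
  induction 1 as [|a l Ha _ IH]; intros m c.
  - apply runs_while_false. reflexivity.
  - apply runs_le with (5 + (8 * length l + 1) + 2); [|simpl; lia].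
    eapply runs_while_true; [destruct Ha; subst; reflexivity| |].
    + instantiate (1 := St l (a :: m) (a :: c)).
      destruct Ha; subst; eapply runs_le; [run|lia|run|lia].
    + simpl. rewrite <- !app_assoc. apply IH.
Qed.

Lemma runs_dup_tree t m :
  runs dup_tree (St [] (ser t ++ m) []) (30 * tsize t + 10) (St [] (ser t ++ ser t ++ m) []).
Proof.
  pose proof (bits_rev _ (ser_bits t)) as Bt.
  eapply runs_le.
  { eapply runs_seq; [apply runs_take_tree; reflexivity|]. rewrite app_nil_r.
    eapply runs_seq; [apply runs_dup_loop, Bt|]. rewrite rev_involutive, app_nil_r.
    eapply runs_seq; [apply (runs_movs X2 X0 (ser t) []);
      [easy|apply ser_bits|reflexivity|symmetry; apply app_nil_r]|].
    cbn [set get g0 g1 g2]. rewrite app_nil_r.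
    pose proof (runs_movs01 (rev (ser t)) (ser t ++ m) [] Bt) as H.
    rewrite rev_involutive in H. exact H. }
  rewrite !length_rev, !ser_length. lia.
Qed.

(** * Encodings and functions computable in polynomial time *)

Class Enc (A : Type) := enc : A -> tree.

Definition sz {A} `{Enc A} (a : A) : nat := tsize (enc a).
Arguments sz : simpl never.

#[export] Instance Enc_unit : Enc unit := fun _ => Leaf.
#[export] Instance Enc_bool : Enc bool := fun b => if b then Node Leaf Leaf else Leaf.
#[export] Instance Enc_prod A B `{Enc A} `{Enc B} : Enc (A * B) :=
  fun p => Node (enc (fst p)) (enc (snd p)).
#[export] Instance Enc_list A `{Enc A} : Enc (list A) :=
  fix go l := match l with [] => Leaf | a :: l => Node (enc a) (go l) end.
#[export] Instance Enc_nat : Enc nat :=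
  fix go n := match n with 0 => Leaf | S n => Node Leaf (go n) end.
#[export] Instance Enc_option A `{Enc A} : Enc (option A) :=
  fun o => match o with None => Leaf | Some a => Node (enc a) Leaf end.

(* A program for [f] replaces the encoding of [a] on top of X1 by that of [f a]. *)
Definition FP {A B} `{Enc A} `{Enc B} (f : A -> B) : Prop :=
  exists c p, poly p /\ forall a, sz (f a) <= p (sz a) /\ forall m,
    runs c (St [] (ser (enc a) ++ m) []) (p (sz a)) (St [] (ser (enc (f a)) ++ m) []).

(** A change of type that keeps the tree costs nothing. The encodings are chosen for this: a cons is
    a pair, an option is a list with at most one element, and a number is a list of units. *)
Lemma FP_cast {A B} `{Enc A} `{Enc B} (f : A -> B) : (forall a, enc (f a) = enc a) -> FP f.
Proof.
  intros E. exists CSkip, (fun n => n). split; [poly|]. intros a. unfold sz. rewrite E.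
  split; auto. intros m. eapply runs_le; [apply runs_skip|lia].
Qed.

Lemma FP_id {A} `{Enc A} : FP (fun a : A => a).
Proof. apply FP_cast. auto. Qed.

(** The bound on the size of results in [FP] bounds the input, and hence the time, of the second
    program. *)
Lemma FP_comp {A B C} `{Enc A} `{Enc B} `{Enc C} (g : B -> C) (f : A -> B) :
  FP g -> FP f -> FP (fun a => g (f a)).
Proof.
  intros (cg & pg & Pg & Hg) (cf & pf & Pf & Hf).
  exists (cf ;; cg), (fun n => pf n + pg (pf n)). split; [poly|].
  intros a. destruct (Hf a) as [Sf Rf]. destruct (Hg (f a)) as [Sg Rg].
  pose proof (poly_mono _ Pg _ _ Sf). split; [lia|].
  intros m. eapply runs_le; [eapply runs_seq; [apply Rf|apply Rg]|lia].
Qed.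

Lemma FP_ext {A B} `{Enc A} `{Enc B} (f g : A -> B) : (forall a, f a = g a) -> FP f -> FP g.
Proof.
  intros E (c & p & P & Q). exists c, p. split; auto. intros a. rewrite <- E. apply Q.
Qed.

Fixpoint push_list (l : list sym) : cmd :=
  match l with [] => CSkip | a :: l => push_list l ;; CPush X1 a end.

Lemma runs_push_list l a m c :
  runs (push_list l) (St a m c) (length l) (St a (l ++ m) c).
Proof.
  induction l; simpl; [run|].
  eapply runs_le; [eapply runs_seq; [exact IHl|run]|lia].
Qed.

Lemma FP_const {A B} `{Enc A} `{Enc B} (b : B) : FP (fun _ : A => b).
Proof.
  exists (drop_tree ;; push_list (ser (enc b))), (fun n => 10 * n + 3 + sz b).
  split; [poly|]. intros a. split; [lia|]. intros m.
  eapply runs_le; [eapply runs_seq; [apply runs_drop_tree|apply runs_push_list]|].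
  unfold sz. rewrite ser_length. lia.
Qed.

Lemma FP_pair {A B C} `{Enc A} `{Enc B} `{Enc C} (f : A -> B) (g : A -> C) :
  FP f -> FP g -> FP (fun a => (f a, g a)).
Proof.
  intros (cf & pf & Pf & Hf) (cg & pg & Pg & Hg).
  exists (dup_tree ;; cf ;; swap_tree ;; cg ;; swap_tree ;; CPush X1 s2),
    (fun n => 100 * n + 100 * pf n + 100 * pg n + 100).
  split; [poly|]. intros a. destruct (Hf a) as [Sf Rf]. destruct (Hg a) as [Sg Rg].
  unfold sz in *. simpl. split; [lia|]. intros m.
  eapply runs_le.
  - eapply runs_seq; [apply runs_dup_tree|].
    eapply runs_seq; [apply Rf|].
    eapply runs_seq; [apply runs_swap_tree|].
    eapply runs_seq; [apply Rg|].
    eapply runs_seq; [apply runs_swap_tree|].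
    rewrite <- app_assoc. apply runs_push.
  - lia.
Qed.

Lemma FP_fst0 {A B} `{Enc A} `{Enc B} : FP (@fst A B).
Proof.
  exists (CPop X1 ;; swap_tree ;; drop_tree), (fun n => 100 * n + 100). split; [poly|].
  intros [a b]. unfold sz. simpl. split; [lia|]. intros m.
  eapply runs_le.
  - eapply runs_seq; [apply runs_pop|]. cbn [pop set get g0 g1 g2 tl].
    rewrite <- app_assoc.
    eapply runs_seq; [apply runs_swap_tree|]. apply runs_drop_tree.
  - lia.
Qed.

Lemma FP_snd0 {A B} `{Enc A} `{Enc B} : FP (@snd A B).
Proof.
  exists (CPop X1 ;; drop_tree), (fun n => 100 * n + 100). split; [poly|].
  intros [a b]. unfold sz. simpl. split; [lia|]. intros m.
  eapply runs_le.
  - eapply runs_seq; [apply runs_pop|]. cbn [pop set get g0 g1 g2 tl].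
    rewrite <- app_assoc. apply runs_drop_tree.
  - lia.
Qed.

Lemma FP_if {A B} `{Enc A} `{Enc B} (b : A -> bool) (f g : A -> B) :
  FP b -> FP f -> FP g -> FP (fun a => if b a then f a else g a).
Proof.
  intros (cb & pb & Pb & Hb) (cf & pf & Pf & Hf) (cg & pg & Pg & Hg).
  exists (dup_tree ;; cb ;; CIf X1 (is s1) (CPop X1 ;; cg) (CPop X1 ;; CPop X1 ;; CPop X1 ;; cf)),
    (fun n => 30 * n + 30 + pb n + pf n + pg n).
  split; [poly|]. intros a.
  destruct (Hb a) as [Sb Rb]. destruct (Hf a) as [Sf Rf]. destruct (Hg a) as [Sg Rg].
  split; [destruct (b a); lia|]. intros m. unfold sz in *.
  apply runs_le with (30 * tsize (enc a) + 10 +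
    (pb (tsize (enc a)) + (3 + pf (tsize (enc a)) + pg (tsize (enc a)) + 2))); [|lia].
  eapply runs_seq; [apply runs_dup_tree|].
  eapply runs_seq; [apply Rb|].
  destruct (b a).
  - change (ser (enc true)) with [s2; s1; s1]. eapply runs_if_false; [reflexivity|].
    eapply runs_le; [do 3 (eapply runs_seq; [apply runs_pop|]; cbn [pop set get g0 g1 g2 tl app]);
      apply Rf|lia].
  - change (ser (enc false)) with [s1]. eapply runs_if_true; [reflexivity|].
    eapply runs_le; [eapply runs_seq; [apply runs_pop|]; cbn [pop set get g0 g1 g2 tl app];
      apply Rg|lia].
Qed.

Lemma FP_list_case {A X B} `{Enc A} `{Enc X} `{Enc B}
    (l : A -> list X) (f : A -> B) (g : A -> X -> list X -> B) :
  FP l -> FP f -> FP (fun p : A * (X * list X) => g (fst p) (fst (snd p)) (snd (snd p))) ->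
  FP (fun a => match l a with [] => f a | x :: r => g a x r end).
Proof.
  intros (cl & pl & Pl & Hl) (cf & pf & Pf & Hf) (cg & pg & Pg & Hg).
  exists (dup_tree ;; cl ;; CIf X1 (is s1) (CPop X1 ;; cf) (swap_tree ;; CPush X1 s2 ;; cg)),
    (fun n => 100 * n + 100 + 100 * pl n + pf n + pg (n + pl n + 1)).
  split; [poly|]. intros a.
  destruct (Hl a) as [Sl Rl]. destruct (Hf a) as [Sf Rf]. unfold sz in *.
  destruct (l a) as [|x r].
  - split; [lia|]. intros m.
    eapply runs_le.
    + eapply runs_seq; [apply runs_dup_tree|].
      eapply runs_seq; [apply Rl|]. simpl.
      eapply runs_if_true; [reflexivity|].
      eapply runs_seq; [apply runs_pop|]. cbn [pop set get g0 g1 g2 tl]. apply Rf.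
    + lia.
  - destruct (Hg (a, (x, r))) as [Sg Rg]. simpl in Sg, Rg.
    change (S (tsize (enc x) + tsize (enc r))) with (tsize (enc (x :: r))) in *.
    change (s2 :: ser (enc x) ++ ser (enc r)) with (ser (enc (x :: r))) in *.
    assert (M : pg (S (tsize (enc a) + tsize (enc (x :: r)))) <=
      pg (tsize (enc a) + pl (tsize (enc a)) + 1)) by (apply poly_mono; [auto|lia]).
    split; [lia|]. intros m.
    eapply runs_le.
    + eapply runs_seq; [apply runs_dup_tree|].
      eapply runs_seq; [apply Rl|].
      eapply runs_if_false; [reflexivity|].
      eapply runs_seq; [apply runs_swap_tree|].
      eapply runs_seq; [apply runs_push|]. cbn [push set get g0 g1 g2].
      specialize (Rg m). rewrite <- app_assoc in Rg. exact Rg.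
    + lia.
Qed.

Lemma FP_fst {A B C} `{Enc A} `{Enc B} `{Enc C} (f : A -> B * C) :
  FP f -> FP (fun a => fst (f a)).
Proof. apply FP_comp, FP_fst0. Qed.

Lemma FP_snd {A B C} `{Enc A} `{Enc B} `{Enc C} (f : A -> B * C) :
  FP f -> FP (fun a => snd (f a)).
Proof. apply FP_comp, FP_snd0. Qed.

Lemma FP_cast_of {A B C} `{Enc A} `{Enc B} `{Enc C} (g : B -> C) (f : A -> B) :
  (forall b, enc (g b) = enc b) -> FP f -> FP (fun a => g (f a)).
Proof. intros. apply FP_comp; auto. apply FP_cast. auto. Qed.

Lemma FP_cons {A X} `{Enc A} `{Enc X} (x : A -> X) (l : A -> list X) :
  FP x -> FP l -> FP (fun a => x a :: l a).
Proof.
  intros Hx Hl.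
  apply (FP_cast_of (fun p : X * list X => fst p :: snd p) (fun a => (x a, l a))).
  - intros []; reflexivity.
  - apply FP_pair; auto.
Qed.

Lemma sz_pos {A} `{Enc A} (a : A) : 1 <= sz a.
Proof. apply tsize_pos. Qed.

Lemma sz_cons {X} `{Enc X} (x : X) l : sz (x :: l) = S (sz x + sz l).
Proof. reflexivity. Qed.

Lemma sz_pair {A B} `{Enc A} `{Enc B} (a : A) (b : B) : sz (a, b) = S (sz a + sz b).
Proof. reflexivity. Qed.

Lemma sz_length {X} `{Enc X} (l : list X) : length l < sz l.
Proof. induction l; [unfold sz; simpl; lia|]. rewrite sz_cons. simpl. lia. Qed.

Lemma sz_app {X} `{Enc X} (l r : list X) : sz (l ++ r) + 1 = sz l + sz r.
Proof.
  induction l; [unfold sz; simpl; lia|]. rewrite <- app_comm_cons, !sz_cons. lia.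
Qed.

Lemma sz_in {X} `{Enc X} (x : X) l : In x l -> sz x < sz l.
Proof.
  induction l as [|y l IH]; [easy|]. rewrite sz_cons. intros [->|Hi]; [lia|]. apply IH in Hi. lia.
Qed.

Lemma FP_size {A B} `{Enc A} `{Enc B} (f : A -> B) : FP f ->
  exists p, poly p /\ forall a, sz (f a) <= p (sz a).
Proof. intros (c & p & P & Hp). exists p. split; auto. intros a. apply Hp. Qed.

Lemma ser_pair {A B} `{Enc A} `{Enc B} (a : A) (b : B) m :
  ser (enc (a, b)) ++ m = s2 :: ser (enc a) ++ ser (enc b) ++ m.
Proof. simpl. rewrite <- app_assoc. reflexivity. Qed.

Section Fold.
Context {A X S : Type} `{Enc A} `{Enc X} `{Enc S}.
Variable l : A -> list X.
Variable s0 : A -> S.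
Variable g : A -> S -> X -> S.
Hypothesis Fl : FP l.
Hypothesis Fs : FP s0.
Hypothesis Fg : FP (fun p : (A * S) * X => g (fst (fst p)) (snd (fst p)) (snd p)).

Let body (p : (X * list X) * (A * S)) : list X * (A * S) :=
  (snd (fst p), (fst (snd p), g (fst (snd p)) (snd (snd p)) (fst (fst p)))).

Let FP_body : FP body.
Proof.
  unfold body. repeat apply FP_pair.
  - apply FP_snd, FP_fst, FP_id.
  - apply FP_fst, FP_snd, FP_id.
  - refine (FP_comp _ (fun p : (X * list X) * (A * S) => (snd p, fst (fst p))) Fg _).
    apply FP_pair; [apply FP_snd, FP_id|apply FP_fst, FP_fst, FP_id].
Qed.

(** The remaining list and [(a, s)] lie on the stack without the tag of their pair, so that the top
    symbol tells whether the list is empty; the tag is pushed back before each run of the body.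
    Since polynomial steps can be iterated to exponential size, the accumulator is required to stay
    polynomial after every prefix of the list. *)
Lemma FP_fold :
  (exists q, poly q /\ forall a r1 r2, l a = r1 ++ r2 -> sz (fold_left (g a) r1 (s0 a)) <= q (sz a)) ->
  FP (fun a => fold_left (g a) (l a) (s0 a)).
Proof.
  intros (q & Pq & Hq).
  assert (FI : FP (fun a => (l a, (a, s0 a)))) by (repeat apply FP_pair; auto; apply FP_id).
  destruct FI as (ci & p0 & Pi & Hi). destruct FP_body as (cb & pb & Pb & Hb).
  destruct (FP_snd0 (A := A) (B := S)) as (cs & ps & Ps & Hs).
  destruct (FP_size l Fl) as (pl & Pl & Hl).
  set (N := fun n => pl n + n + q n + 2).
  assert (PN : poly N) by (unfold N; poly).
  exists (ci ;; CPop X1 ;; CWhile X1 (is s2) (CPush X1 s2 ;; cb ;; CPop X1) ;; CPop X1 ;; cs),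
    (fun n => p0 n + 10 + pl n * (pb (N n) + 4) + ps (N n) + q n).
  split; [poly|]. intros a. split.
  { specialize (Hq a (l a) [] (eq_sym (app_nil_r _))). lia. }
  intros m.
  assert (L : forall r2 r1, l a = r1 ++ r2 ->
    runs (CWhile X1 (is s2) (CPush X1 s2 ;; cb ;; CPop X1))
      (St [] (ser (enc r2) ++ ser (enc (a, fold_left (g a) r1 (s0 a))) ++ m) [])
      (length r2 * (pb (N (sz a)) + 4) + 1)
      (St [] (s1 :: ser (enc (a, fold_left (g a) (l a) (s0 a))) ++ m) [])).
  { induction r2 as [|x r2 IH]; intros r1 E.
    - rewrite app_nil_r in E. rewrite E. apply runs_while_false. reflexivity.
    - specialize (IH (r1 ++ [x])). rewrite fold_left_app in IH. simpl fold_left in IH.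
      set (s := fold_left (g a) r1 (s0 a)) in *.
      assert (Hsz : sz (x :: r2, (a, s)) <= N (sz a)).
      { unfold N. rewrite !sz_pair. specialize (Hq a r1 (x :: r2) E). fold s in Hq.
        pose proof (Hl a) as Sl. rewrite E in Sl. pose proof (sz_app r1 (x :: r2)).
        pose proof (sz_pos r1). lia. }
      destruct (Hb ((x, r2), (a, s))) as [_ Rb]. unfold body in Rb. cbn [fst snd] in Rb.
      apply runs_le with (1 + (pb (N (sz a)) + 1) +
        (length r2 * (pb (N (sz a)) + 4) + 1) + 2); [|simpl; lia].
      eapply runs_while_true; [reflexivity| |apply IH; rewrite <- app_assoc; exact E].
      eapply runs_seq; [apply runs_push|].
      eapply runs_seq.
      + eapply runs_le; [|apply (poly_mono _ Pb _ _ Hsz)].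
        specialize (Rb m). rewrite (ser_pair (x, r2)), (ser_pair r2) in Rb. exact Rb.
      + apply (runs_pop X1 (St [] (s2 :: _) [])). }
  destruct (Hi a) as [_ Ri]. pose proof (Hl a) as Sl.
  eapply runs_le.
  - eapply runs_seq; [apply Ri|]. rewrite ser_pair.
    eapply runs_seq; [apply runs_pop|]. cbn [pop set get g0 g1 g2 tl app].
    eapply runs_seq; [apply (L (l a) []); reflexivity|].
    eapply runs_seq; [apply runs_pop|]. cbn [pop set get g0 g1 g2 tl].
    apply Hs.
  - pose proof (sz_length (l a)).
    assert (ps (sz (a, fold_left (g a) (l a) (s0 a))) <= ps (N (sz a))).
    { apply poly_mono; auto. rewrite sz_pair. unfold N.
      specialize (Hq a (l a) [] (eq_sym (app_nil_r _))). lia. }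
    assert (length (l a) * (pb (N (sz a)) + 4) <= pl (sz a) * (pb (N (sz a)) + 4))
      by (apply Nat.mul_le_mono_r; lia).
    lia.
Qed.

(** The growth in one step depends on the parameter and the list element but not on the accumulator,
    so the total growth is at most the number of steps times a fixed bound. *)
Lemma FP_fold_add :
  (exists q, poly q /\ forall a s x, sz (g a s x) <= sz s + q (sz a + sz x)) ->
  FP (fun a => fold_left (g a) (l a) (s0 a)).
Proof.
  intros (q & Pq & Hq). apply FP_fold.
  destruct (FP_size l Fl) as (pl & Pl & Hl). destruct (FP_size s0 Fs) as (ps & Ps & Hs).
  exists (fun n => ps n + pl n * q (n + pl n)). split; [poly|].
  intros a r1 r2 E. pose proof (Hl a) as Sl. pose proof (Hs a) as Ss.
  rewrite E in Sl. pose proof (sz_app r1 r2). pose proof (sz_pos r2).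
  assert (B : forall r s, sz r <= pl (sz a) ->
    sz (fold_left (g a) r s) <= sz s + length r * q (sz a + pl (sz a))).
  { induction r as [|x r IH]; intros s Hr; simpl; [lia|].
    rewrite sz_cons in Hr. specialize (IH (g a s x) ltac:(lia)).
    specialize (Hq a s x).
    pose proof (poly_mono _ Pq (sz a + sz x) (sz a + pl (sz a)) ltac:(lia)). lia. }
  specialize (B r1 (s0 a) ltac:(lia)). pose proof (sz_length r1).
  assert (length r1 * q (sz a + pl (sz a)) <= pl (sz a) * q (sz a + pl (sz a)))
    by (apply Nat.mul_le_mono_r; lia).
  lia.
Qed.
End Fold.

Lemma enc_nat_list n : enc n = enc (repeat tt n).
Proof.
  induction n; simpl; auto.
  change (Node Leaf (enc n) = Node Leaf (enc (repeat tt n))). congruence.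
Qed.

Definition load : cmd :=
  let ld k := CPop X0 ;; push_list (ser (enc k)) ;; CPush X1 s2 in
  CPush X1 s1 ;;
  CWhile X0 (fun o => match o with Some _ => true | None => false end)
    (CIf X0 (is s1) (ld 1) (CIf X0 (is s2) (ld 2) (CIf X0 (is s3) (ld 3) (ld 4)))).

(** [X0] delivers the input from its last letter on, which is the order in which a list is built by
    cons. *)
Lemma runs_load (x : list sym) :
  runs load (St (rev x) [] []) (30 * length x + 2) (St [] (ser (enc (map toN x))) []).
Proof.
  unfold load. apply runs_le with (1 + (30 * length (rev x) + 1)); [|rewrite length_rev; lia].
  eapply runs_seq; [apply runs_push|]. unfold push. simpl set.
  assert (H : forall l y, runs (CWhile X0 (fun o => match o with Some _ => true | None => false end)
    (CIf X0 (is s1) (CPop X0 ;; push_list (ser (enc 1)) ;; CPush X1 s2)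
      (CIf X0 (is s2) (CPop X0 ;; push_list (ser (enc 2)) ;; CPush X1 s2)
        (CIf X0 (is s3) (CPop X0 ;; push_list (ser (enc 3)) ;; CPush X1 s2)
          (CPop X0 ;; push_list (ser (enc 4)) ;; CPush X1 s2)))))
    (St l (ser (enc (map toN y))) []) (30 * length l + 1) (St [] (ser (enc (map toN (rev l ++ y)))) [])).
  { induction l as [|a l IH]; intros y.
    - apply runs_while_false. reflexivity.
    - apply runs_le with (20 + (30 * length l + 1) + 2); [|simpl; lia].
      eapply runs_while_true; [reflexivity| |].
      + instantiate (1 := St l (ser (enc (map toN (a :: y)))) []).
        assert (PL : forall k, length (ser (enc k)) <= 10 ->
          runs (CPop X0 ;; push_list (ser (enc k)) ;; CPush X1 s2)
            (St (a :: l) (ser (enc (map toN y))) []) 12 (St l (ser (enc (k :: map toN y))) [])).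
        { intros k Hk. eapply runs_le.
          - eapply runs_seq; [apply runs_pop|]. cbn [pop set get g0 g1 g2 tl].
            eapply runs_seq; [apply runs_push_list|].
            apply (runs_push X1 s2 (St l (ser (enc k) ++ ser (enc (map toN y))) [])).
          - lia. }
        destruct a.
        * eapply runs_le; [eapply runs_if_true; [reflexivity|]; apply PL; simpl; lia|lia].
        * eapply runs_le; [eapply runs_if_false; [reflexivity|];
            eapply runs_if_true; [reflexivity|]; apply PL; simpl; lia|lia].
        * eapply runs_le; [do 2 (eapply runs_if_false; [reflexivity|]);
            eapply runs_if_true; [reflexivity|]; apply PL; simpl; lia|lia].
        * eapply runs_le; [do 3 (eapply runs_if_false; [reflexivity|]); apply PL; simpl; lia|lia].
      + simpl rev. rewrite <- app_assoc. apply IH. }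
  specialize (H (rev x) []). rewrite rev_involutive, app_nil_r in H. exact H.
Qed.

Lemma sz_map_toN (x : list sym) : sz (map toN x) <= 10 * length x + 1.
Proof.
  induction x; simpl map; [unfold sz; simpl; lia|]. rewrite sz_cons. simpl length.
  assert (sz (toN a) <= 9) by (destruct a; unfold sz; simpl; lia). lia.
Qed.

Theorem FP_decides (P : WPS -> Prop) (f : list nat -> bool) : FP f ->
  (forall A, wf_WPS A -> exists x, enc_WPS A = map toN x) ->
  (forall A, wf_WPS A -> P A <-> f (enc_WPS A) = true) -> poly_time_decidable P.
Proof.
  intros (c & p & Pp & Hp) Hx HP.
  set (t := fun n => 30 * n + 2 + p (10 * n + 1)).
  assert (Pt : poly (fun n => (t n + 1) * (2 * (n + t n + 1) + 5) + 3)) by (unfold t; poly).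
  destruct (poly_bound _ Pt) as [k Hk].
  (* For positive [n], [n + 2 <= 3 * n] gives [(n + 2) ^ k <= 3 ^ k * n ^ k]; the added [3 ^ k]
     covers the empty input. The test [is s2] recognises the tree of [true], which is a node. *)
  exists (decider (load ;; c) X1 (is s2)), (3 ^ k), k. split; [apply machine_ok|].
  intros A HA x' s'. subst x' s'. destruct (Hx A HA) as [x Ex]. specialize (HP A HA).
  rewrite Ex in *. rewrite length_map.
  destruct (Hp (map toN x)) as [_ R]. specialize (R []). rewrite !app_nil_r in R.
  assert (RR : runs (load ;; c) (St (rev x) [] []) (t (length x))
                 (St [] (ser (enc (f (map toN x)))) [])).
  { eapply runs_le; [eapply runs_seq; [apply runs_load|exact R]|].
    unfold t. pose proof (poly_mono _ Pp _ _ (sz_map_toN x)). lia. }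
  destruct RR as (t' & Ht' & E).
  assert (T : (t' + 1) * (2 * (length x + t' + 1) + 5) + 3 <= 3 ^ k * length x ^ k + 3 ^ k).
  { eapply Nat.le_trans; [|eapply Nat.le_trans; [apply (Hk (length x))|]].
    - apply Nat.add_le_mono_r, Nat.mul_le_mono; lia.
    - destruct (length x) as [|n].
      + pose proof (Nat.pow_le_mono_l 2 3 k). simpl. lia.
      + rewrite <- Nat.pow_mul_l.
        pose proof (Nat.pow_le_mono_l (S n + 2) (3 * S n) k). lia. }
  rewrite (decider_run _ _ _ _ _ _ E _ T).
  destruct (f (map toN x)); simpl top; simpl is; split; intros Q; auto.
  - exfalso. apply Q, HP. reflexivity.
  - exfalso. apply HP in Q. discriminate.
Qed.

(** * Closure properties of [FP] for booleans, lists, options and unary numbers *)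

Ltac fp_more := fail.
Ltac fp1 := cbv beta; first
  [ assumption
  | lazymatch goal with
    | |- FP fst => apply FP_fst0
    | |- FP snd => apply FP_snd0
    | |- FP (fun a => a) => apply FP_id
    | |- FP (fun _ => ?b) => apply FP_const
    | |- FP (fun a => (@?f a, @?g a)) => apply (FP_pair f g)
    | |- FP (fun a => fst (@?f a)) => apply (FP_fst f)
    | |- FP (fun a => snd (@?f a)) => apply (FP_snd f)
    | |- FP (fun a => @?f a :: @?g a) => apply (FP_cons f g)
    | |- FP (fun a => if @?b a then @?f a else @?g a) => apply (FP_if b f g)
    end
  | fp_more ].
Ltac fp := repeat fp1.

Definition is_nil {X} (l : list X) : bool := match l with [] => true | _ :: _ => false end.

Lemma FP_andb {A} `{Enc A} (f g : A -> bool) : FP f -> FP g -> FP (fun a => f a && g a).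
Proof. intros. apply (FP_if f g (fun _ => false)); fp. Qed.

Lemma FP_orb {A} `{Enc A} (f g : A -> bool) : FP f -> FP g -> FP (fun a => f a || g a).
Proof. intros. apply (FP_if f (fun _ => true) g); fp. Qed.

Lemma FP_negb {A} `{Enc A} (f : A -> bool) : FP f -> FP (fun a => negb (f a)).
Proof. intros. apply (FP_if f (fun _ => false) (fun _ => true)); fp. Qed.

Lemma FP_xorb {A} `{Enc A} (f g : A -> bool) : FP f -> FP g -> FP (fun a => xorb (f a) (g a)).
Proof.
  intros. apply FP_ext with (fun a => if f a then negb (g a) else g a).
  - intros a. destruct (f a), (g a); reflexivity.
  - apply FP_if; auto. apply FP_negb; auto.
Qed.

Lemma FP_tl {A X} `{Enc A} `{Enc X} (l : A -> list X) : FP l -> FP (fun a => tl (l a)).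
Proof. intros. apply (FP_list_case l (fun _ => []) (fun _ _ r => r)); fp. Qed.

Lemma FP_hd {A X} `{Enc A} `{Enc X} (d : X) (l : A -> list X) : FP l -> FP (fun a => hd d (l a)).
Proof. intros. apply (FP_list_case l (fun _ => d) (fun _ x _ => x)); fp. Qed.

Lemma FP_nil {A X} `{Enc A} `{Enc X} (l : A -> list X) : FP l ->
  FP (fun a => is_nil (l a)).
Proof. intros. apply (FP_list_case l (fun _ => true) (fun _ _ _ => false)); fp. Qed.

Definition ocase {X B} (o : option X) (b : B) (f : X -> B) : B :=
  match o with None => b | Some x => f x end.

Lemma FP_ocase {A X B} `{Enc A} `{Enc X} `{Enc B} (o : A -> option X) (f : A -> B) (g : A -> X -> B) :
  FP o -> FP f -> FP (fun p : A * X => g (fst p) (snd p)) ->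
  FP (fun a => ocase (o a) (f a) (g a)).
Proof.
  intros Ho Hf Hg.
  set (l := fun a => match o a with None => [] | Some x => [x] end).
  apply FP_ext with (fun a => match l a with [] => f a | x :: _ => g a x end).
  - intros a. unfold l. destruct (o a); reflexivity.
  - apply (FP_list_case l f (fun a x _ => g a x)); auto.
    + apply (FP_cast_of (fun o : option X => match o with None => [] | Some x => [x] end) o); auto.
      intros []; reflexivity.
    + refine (FP_comp (fun p : A * X => g (fst p) (snd p)) (fun p => (fst p, fst (snd p))) Hg _). fp.
Qed.

Lemma FP_Some {A X} `{Enc A} `{Enc X} (f : A -> X) : FP f -> FP (fun a => Some (f a)).
Proof.
  intros. apply (FP_cast_of (fun p : X * unit => Some (fst p)) (fun a => (f a, tt))).
  - intros [x []]. reflexivity.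
  - fp.
Qed.

Lemma FP_S {A} `{Enc A} (f : A -> nat) : FP f -> FP (fun a => S (f a)).
Proof.
  intros. apply (FP_cast_of (fun p : unit * nat => S (snd p)) (fun a => (tt, f a))).
  - intros [[] n]. reflexivity.
  - fp.
Qed.

Lemma FP_units {A} `{Enc A} (f : A -> nat) : FP f -> FP (fun a => repeat tt (f a)).
Proof.
  intros. apply (FP_cast_of (fun n => repeat tt n) f); auto. intros. symmetry. apply enc_nat_list.
Qed.

Lemma sz_bool (b : bool) : sz b <= 3.
Proof. destruct b; unfold sz; simpl; lia. Qed.

Lemma sz_S (n : nat) : sz (S n) = 2 + sz n.
Proof. reflexivity. Qed.

Lemma sz_tl {X} `{Enc X} (l : list X) : sz (tl l) <= sz l.
Proof. destruct l; simpl tl; [lia|]. rewrite sz_cons. lia. Qed.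

(** Units of one number are struck off against units of the other; the flag drops when the second
    runs out too early, and equality also requires that nothing of it is left. *)
Lemma FP_nat_eqb {A} `{Enc A} (f g : A -> nat) : FP f -> FP g -> FP (fun a => f a =? g a).
Proof.
  intros Hf Hg.
  set (step := fun (s : list unit * bool) (_ : unit) =>
    (tl (fst s), if is_nil (fst s) then false else snd s)).
  apply FP_ext with (fun a =>
    let s := fold_left step (repeat tt (f a)) (repeat tt (g a), true) in
    snd s && is_nil (fst s)).
  - intros a. generalize (f a), (g a). intros n m. simpl.
    assert (E : forall n m b, let s := fold_left step (repeat tt n) (repeat tt m, b) in
      snd s && is_nil (fst s) = b && (n =? m)).
    { clear. induction n as [|n IH]; intros m b; cbn zeta.
      - destruct m, b; reflexivity.
      - change (repeat tt (S n)) with (tt :: repeat tt n). cbn [fold_left]. destruct m.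
        + change (step (repeat tt 0, b) tt) with (repeat tt 0, false).
          rewrite (IH 0 false). destruct b; reflexivity.
        + change (step (repeat tt (S m), b) tt) with (repeat tt m, b). apply IH. }
    apply (E n m true).
  - assert (FS : FP (fun a => fold_left step (repeat tt (f a)) (repeat tt (g a), true))).
    { apply (FP_fold_add (fun a => repeat tt (f a)) (fun a => (repeat tt (g a), true)) (fun _ => step)).
      - apply FP_units; auto.
      - apply FP_pair; [apply FP_units; auto|apply FP_const].
      - unfold step. fp.
        + apply FP_tl. fp.
        + apply FP_nil. fp.
      - exists (fun _ => 3). split; [poly|]. intros a [r b] x. unfold step. cbn [fst snd].
        rewrite !sz_pair. pose proof (sz_tl r).
        match goal with |- context [sz (if ?c then false else b)] =>
          pose proof (sz_bool (if c then false else b)) end.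
        lia. }
    apply FP_andb; [fp|]. apply FP_nil. fp.
Qed.

Lemma fold_cons {X Y} (f : X -> Y) l acc :
  fold_left (fun acc x => f x :: acc) l acc = rev (map f l) ++ acc.
Proof.
  revert acc. induction l as [|x l IH]; intros acc; simpl; auto.
  rewrite IH, <- app_assoc. reflexivity.
Qed.

(** Folding with cons reverses the list; reversal, concatenation and [map] are all instances of this
    form. *)
Lemma FP_fold_map {A X Y} `{Enc A} `{Enc X} `{Enc Y} (f : A -> X -> Y)
    (l : A -> list X) (r : A -> list Y) :
  FP (fun p : A * X => f (fst p) (snd p)) -> FP l -> FP r ->
  FP (fun a => rev (map (f a) (l a)) ++ r a).
Proof.
  intros Hf Hl Hr.
  apply FP_ext with (fun a => fold_left (fun acc x => f a x :: acc) (l a) (r a)).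
  { intros a. apply fold_cons. }
  apply (FP_fold_add l r (fun a acc x => f a x :: acc)); auto.
  - apply FP_cons; [|fp].
    refine (FP_comp (fun p : A * X => f (fst p) (snd p))
      (fun p : (A * list Y) * X => (fst (fst p), snd p)) Hf _). fp.
  - destruct (FP_size _ Hf) as (q & Pq & Hq). exists (fun n => 1 + q (1 + n)). split; [poly|].
    intros a s x. rewrite sz_cons. specialize (Hq (a, x)). rewrite sz_pair in Hq. cbn [fst snd] in Hq.
    simpl. lia.
Qed.

Lemma FP_rev {A X} `{Enc A} `{Enc X} (l : A -> list X) : FP l -> FP (fun a => rev (l a)).
Proof.
  intros. apply FP_ext with (fun a => rev (map (fun x => x) (l a)) ++ []).
  - intros. rewrite map_id, app_nil_r. reflexivity.
  - apply (FP_fold_map (fun _ x => x)); fp.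
Qed.

Lemma FP_app {A X} `{Enc A} `{Enc X} (l r : A -> list X) : FP l -> FP r -> FP (fun a => l a ++ r a).
Proof.
  intros. apply FP_ext with (fun a => rev (map (fun x => x) (rev (l a))) ++ r a).
  - intros. rewrite map_id, rev_involutive. reflexivity.
  - apply (FP_fold_map (fun _ x => x)); fp. apply FP_rev; auto.
Qed.

Lemma FP_map {A X Y} `{Enc A} `{Enc X} `{Enc Y} (f : A -> X -> Y) (l : A -> list X) :
  FP (fun p : A * X => f (fst p) (snd p)) -> FP l -> FP (fun a => map (f a) (l a)).
Proof.
  intros. apply FP_ext with (fun a => rev (map (f a) (rev (l a))) ++ []).
  - intros. rewrite app_nil_r, map_rev, rev_involutive. reflexivity.
  - apply (FP_fold_map f); fp. apply FP_rev; auto.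
Qed.

Lemma FP_flat_map {A X Y} `{Enc A} `{Enc X} `{Enc Y} (f : A -> X -> list Y) (l : A -> list X) :
  FP (fun p : A * X => f (fst p) (snd p)) -> FP l -> FP (fun a => flat_map (f a) (l a)).
Proof.
  intros Hf Hl. apply FP_ext with (fun a => fold_left (fun acc x => acc ++ f a x) (l a) []).
  - intros a.
    assert (E : forall l acc,
      fold_left (fun acc x => acc ++ f a x) l acc = acc ++ flat_map (f a) l).
    { clear. induction l as [|x l IH]; intros acc; simpl; [rewrite app_nil_r; auto|].
      rewrite IH, app_assoc. reflexivity. }
    apply E.
  - apply (FP_fold_add l (fun _ => []) (fun a acc x => acc ++ f a x)); auto; [fp| |].
    + assert (Hf' : FP (fun p : (A * list Y) * X => f (fst (fst p)) (snd p))).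
      { refine (FP_comp (fun p : A * X => f (fst p) (snd p))
          (fun p : (A * list Y) * X => (fst (fst p), snd p)) Hf _). fp. }
      apply FP_app; fp.
    + destruct (FP_size _ Hf) as (q & Pq & Hq). exists (fun n => q (1 + n)). split; [poly|].
      intros a s x. specialize (Hq (a, x)). rewrite sz_pair in Hq. cbn [fst snd] in Hq.
      pose proof (sz_app s (f a x)). simpl. lia.
Qed.

Lemma FP_existsb {A X} `{Enc A} `{Enc X} (f : A -> X -> bool) (l : A -> list X) :
  FP (fun p : A * X => f (fst p) (snd p)) -> FP l -> FP (fun a => existsb (f a) (l a)).
Proof.
  intros Hf Hl.
  apply FP_ext with
    (fun a => fold_left (fun (b : bool) x => if b then true else f a x) (l a) false).
  - intros a.
    assert (E : forall l b,
      fold_left (fun (b : bool) x => if b then true else f a x) l b = b || existsb (f a) l).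
    { clear. induction l as [|x l IH]; intros b; simpl; [destruct b; auto|].
      rewrite IH. destruct b, (f a x); reflexivity. }
    apply E.
  - apply (FP_fold_add l (fun _ => false) (fun a (b : bool) x => if b then true else f a x)); auto;
      [fp| |].
    + apply FP_if; [fp|fp|].
      refine (FP_comp (fun p : A * X => f (fst p) (snd p))
        (fun p : (A * bool) * X => (fst (fst p), snd p)) Hf _). fp.
    + exists (fun _ => 3). split; [poly|]. intros a s x.
      pose proof (sz_bool (if s then true else f a x)). lia.
Qed.

Lemma FP_length {A X} `{Enc A} `{Enc X} (l : A -> list X) : FP l -> FP (fun a => length (l a)).
Proof.
  intros Hl. apply FP_ext with (fun a => fold_left (fun n _ => S n) (l a) 0).
  - intros a. rewrite <- (Nat.add_0_r (length (l a))). generalize 0.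
    induction (l a) as [|x r IH]; intros n; simpl; auto. rewrite IH. lia.
  - apply (FP_fold_add l (fun _ => 0) (fun _ n _ => S n)); auto; [fp| |].
    + apply FP_S. fp.
    + exists (fun _ => 2). split; [poly|]. intros a s x. rewrite sz_S. lia.
Qed.

(** The next entry of the reversed range is the length of what has been built. Its size grows with
    the accumulator, so the general [FP_fold] is used with a quadratic bound. *)
Lemma FP_seq {A} `{Enc A} (f : A -> nat) : FP f -> FP (fun a => seq 0 (f a)).
Proof.
  intros Hf.
  assert (E : forall n,
    fold_left (fun acc (_ : unit) => length acc :: acc) (repeat tt n) [] = rev (seq 0 n)).
  { induction n as [|n IH]; auto. rewrite seq_S, rev_app_distr. simpl rev at 1.
    replace (repeat tt (S n)) with (repeat tt n ++ [tt]) by (symmetry; apply repeat_cons).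
    rewrite fold_left_app, IH. simpl. rewrite length_rev, length_seq. reflexivity. }
  apply FP_ext with (fun a =>
    rev (fold_left (fun acc (_ : unit) => length acc :: acc) (repeat tt (f a)) [])).
  { intros a. rewrite E, rev_involutive. reflexivity. }
  apply FP_rev.
  apply (FP_fold (fun a => repeat tt (f a)) (fun _ => []) (fun _ acc (_ : unit) => length acc :: acc)).
  - apply FP_units; auto.
  - fp.
  - apply FP_cons; [apply FP_length; fp|fp].
  - destruct (FP_size f Hf) as (q & Pq & Hq).
    exists (fun n => 1 + q n * (2 * q n + 2)). split; [poly|].
    intros a r1 r2 E1.
    assert (Hr : r1 = repeat tt (length r1)).
    { clear. induction r1 as [|[] r IH]; simpl; congruence. }
    rewrite Hr, E.
    assert (Hlen : length r1 <= f a).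
    { apply (f_equal (@length unit)) in E1. rewrite repeat_length, length_app in E1. lia. }
    assert (Hsz : f a < sz (f a)).
    { generalize (f a). induction n as [|n IH]; [unfold sz; simpl; lia|rewrite sz_S; lia]. }
    specialize (Hq a).
    assert (B : forall k, sz (rev (seq 0 k)) <= 1 + k * (2 * k + 2)).
    { induction k as [|k IH]; [unfold sz; simpl; lia|].
      rewrite seq_S, rev_app_distr. change (rev [0 + k] ++ rev (seq 0 k)) with (k :: rev (seq 0 k)).
      rewrite sz_cons.
      assert (sz k <= 2 * k + 1).
      { clear. induction k as [|k IH]; [unfold sz; simpl; lia|rewrite sz_S; lia]. }
      lia. }
    specialize (B (length r1)).
    assert (length r1 * (2 * length r1 + 2) <= q (sz a) * (2 * q (sz a) + 2))
      by (apply Nat.mul_le_mono; lia).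
    lia.
Qed.

Lemma FP_comp2 {A X Y B} `{Enc A} `{Enc X} `{Enc Y} `{Enc B} (op : X -> Y -> B)
    (f : A -> X) (g : A -> Y) :
  FP (fun p : X * Y => op (fst p) (snd p)) -> FP f -> FP g -> FP (fun a => op (f a) (g a)).
Proof.
  intros Ho Hf Hg.
  exact (FP_comp (fun p : X * Y => op (fst p) (snd p)) (fun a => (f a, g a)) Ho (FP_pair f g Hf Hg)).
Qed.

Ltac fp_user := fail.
Ltac fp_more ::= lazymatch goal with
  | |- FP (fun a => @?f a && @?g a) => apply (FP_andb f g)
  | |- FP (fun a => @?f a || @?g a) => apply (FP_orb f g)
  | |- FP (fun a => negb (@?f a)) => apply (FP_negb f)
  | |- FP (fun a => xorb (@?f a) (@?g a)) => apply (FP_xorb f g)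
  | |- FP (fun a => @?f a =? @?g a) => apply (FP_nat_eqb f g)
  | |- FP (fun a => S (@?f a)) => apply (FP_S f)
  | |- FP (fun a => seq 0 (@?f a)) => apply (FP_seq f)
  | |- FP (fun a => Some (@?f a)) => apply (FP_Some f)
  | |- FP (fun a => @?f a ++ @?g a) => apply (FP_app f g)
  | |- FP (fun a => rev (@?f a)) => apply (FP_rev f)
  | |- FP (fun a => length (@?f a)) => apply (FP_length f)
  | |- FP (fun a => tl (@?f a)) => apply (FP_tl f)
  | |- FP (fun a => hd ?d (@?f a)) => apply (FP_hd d f)
  | |- FP (fun a => is_nil (@?f a)) => apply (FP_nil f)
  | |- FP (fun a => map (@?f a) (@?l a)) => apply (FP_map f l)
  | |- FP (fun a => flat_map (@?f a) (@?l a)) => apply (FP_flat_map f l)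
  | |- FP (fun a => existsb (@?f a) (@?l a)) => apply (FP_existsb f l)
  | |- FP (fun a => ocase (@?o a) (@?f a) (@?g a)) => apply (FP_ocase o f g)
  | _ => fp_user
  end.

(** * Maximal weights of derivations *)

(* [None] is minus infinity, [Some None] is plus infinity. *)
Definition ext (T : Type) := option (option T).

Definition ele {T} (le : T -> T -> bool) (a b : ext T) : bool :=
  match a, b with
  | None, _ => true
  | _, None => false
  | _, Some None => true
  | Some None, _ => false
  | Some (Some x), Some (Some y) => le x y
  end.

Definition eadd {T} (add : T -> T -> T) (a b : ext T) : ext T :=
  match a, b with
  | None, _ | _, None => None
  | Some (Some x), Some (Some y) => Some (Some (add x y))
  | _, _ => Some None
  end.

Definition emax {T} (le : T -> T -> bool) (a b : ext T) : ext T := if ele le a b then b else a.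

Notation zle := (ele Z.leb).
Notation Fin z := (Some (Some z)).

Lemma zle_refl a : zle a a = true.
Proof. destruct a as [[]|]; simpl; auto. apply Z.leb_refl. Qed.

Lemma zle_trans a b c : zle a b = true -> zle b c = true -> zle a c = true.
Proof.
  destruct a as [[]|], b as [[]|], c as [[]|]; simpl; auto; try discriminate.
  rewrite !Z.leb_le. lia.
Qed.

Lemma zle_antisym a b : zle a b = true -> zle b a = true -> a = b.
Proof.
  destruct a as [[]|], b as [[]|]; simpl; auto; try discriminate.
  rewrite !Z.leb_le. intros. do 2 f_equal. lia.
Qed.

Lemma zle_total a b : zle a b = false -> zle b a = true.
Proof.
  destruct a as [[]|], b as [[]|]; simpl; auto; try discriminate.
  rewrite Z.leb_gt, Z.leb_le. lia.
Qed.

Lemma ext_eq_dec (a b : ext Z) : {a = b} + {a <> b}.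
Proof. repeat decide equality. Qed.

(* Bound on the length of derivations of height [k] with at most two children and length 2 per step. *)
Fixpoint lbound (k : nat) : nat := match k with 0 => 0 | S k => 2 * lbound k + 2 end.

Lemma lbound_mono k : lbound k <= lbound (S k).
Proof. simpl. lia. Qed.

Lemma lbound_pow k : lbound k < 2 ^ (k + 1).
Proof.
  induction k as [|k IH]; [simpl; lia|]. cbn [lbound].
  replace (S k + 1) with (S (k + 1)) by lia. rewrite Nat.pow_succ_r'.
  assert (lbound k + 2 <= 2 ^ (k + 1)); [|lia].
  clear IH. induction k as [|k IH]; [simpl; lia|]. cbn [lbound].
  replace (S k + 1) with (S (k + 1)) by lia. rewrite Nat.pow_succ_r'. lia.
Qed.

Lemma lbound_le j k : j <= k -> lbound j <= lbound k.
Proof. induction 1; auto. pose proof (lbound_mono m). lia. Qed.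

Lemma pigeonhole {V} (V_dec : forall u v : V, {u = v} + {u <> v}) (vars : list V)
    (f : nat -> V) k : length vars <= k -> (forall j, j <= k -> In (f j) vars) ->
  exists i j, i < j <= k /\ f i = f j.
Proof.
  intros Hk Hf.
  assert (ND : ~ NoDup (map f (seq 0 (S k)))).
  { intros ND. apply NoDup_incl_length with (l' := vars) in ND.
    - rewrite length_map, length_seq in ND. lia.
    - intros y Hy. apply in_map_iff in Hy. destruct Hy as (j & <- & Hj). apply in_seq in Hj.
      apply Hf. lia. }
  clear Hk Hf.
  assert (G : forall l, ~ NoDup (map f (seq l (S k - l))) -> exists i j, i < j <= k /\ f i = f j).
  { intros l. remember (S k - l) as m eqn:Em. revert l Em.
    induction m as [|m IH]; intros l Em H; [exfalso; apply H; constructor|].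
    simpl in H. destruct (in_dec V_dec (f l) (map f (seq (S l) m))) as [Hi|Hi].
    - apply in_map_iff in Hi. destruct Hi as (j & E & Hj). apply in_seq in Hj.
      exists l, j. split; [lia|auto].
    - apply (IH (S l)); [lia|]. intros ND'. apply H. constructor; auto. }
  apply (G 0). exact ND.
Qed.

Section Kleene.
Variable V : Type.
Variable veq : V -> V -> bool.
Hypothesis veq_spec : forall u v, reflect (u = v) (veq u v).

Record prod := Prod { p_head : V; p_w : Z; p_len : nat; p_ch : list V }.

Variable prods : list prod.
(** The iteration optimises only the weight. The length is carried along because it becomes the
    length of a cycle, and its bounds justify the choice of [K]. *)
Inductive derives : V -> Z -> nat -> Prop :=
  | derives_intro p W l : In p prods -> derives_all (p_ch p) W l ->
      derives (p_head p) (p_w p + W) (p_len p + l)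
with derives_all : list V -> Z -> nat -> Prop :=
  | derives_all_nil : derives_all [] 0 0
  | derives_all_cons u ch W1 l1 W l : derives u W1 l1 -> derives_all ch W l ->
      derives_all (u :: ch) (W1 + W) (l1 + l).

Scheme derives_mut := Induction for derives Sort Prop
  with derives_all_mut := Induction for derives_all Sort Prop.

(** Splits the combined weight [a * w + b * l] of a derivation, so that the original weight of a
    pump can be recovered as a difference. *)
Lemma derives_lin (a b : Z) :
  (forall p, In p prods -> exists w, p_w p = a * w + b * Z.of_nat (p_len p))%Z ->
  forall v W l, derives v W l -> exists w, (W = a * w + b * Z.of_nat l)%Z.
Proof.
  intros H.
  apply (derives_mut (fun v W l _ => exists w, (W = a * w + b * Z.of_nat l)%Z)
    (fun ch W l _ => exists w, (W = a * w + b * Z.of_nat l)%Z)).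
  - intros p W l Hp _ [w ->]. destruct (H p Hp) as [w' E]. rewrite E. exists (w' + w)%Z. lia.
  - exists 0%Z. lia.
  - intros u ch W1 l1 W l _ [w1 ->] _ [w ->]. exists (w1 + w)%Z. lia.
Qed.

Hypothesis Hlen : forall p, In p prods ->
  p_len p <= 2 /\ length (p_ch p) <= 2 /\ (1 <= p_len p \/ length (p_ch p) = 2).

(** A production contributes length itself or has two children, and by induction each child has
    positive length. *)
Lemma derives_len v W l : derives v W l -> 1 <= l.
Proof.
  apply (derives_mut (fun v W l _ => 1 <= l) (fun ch W l _ => length ch <= l)); simpl; intros; try lia.
  destruct (Hlen p i) as (_ & _ & []); lia.
Qed.

Lemma derives_all_len ch W l : derives_all ch W l -> length ch <= l.
Proof. induction 1; simpl; [lia|]. apply derives_len in H. lia. Qed.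

Definition pval (x : V -> ext Z) (p : prod) : ext Z :=
  fold_left (fun acc u => eadd Z.add acc (x u)) (p_ch p) (Fin (p_w p)).

Definition vstep (x : V -> ext Z) (v : V) : ext Z :=
  fold_left (fun acc p => if veq (p_head p) v then emax Z.leb acc (pval x p) else acc) prods (x v).

Lemma emax_l a b : zle a (emax Z.leb a b) = true.
Proof. unfold emax. destruct (zle a b) eqn:E; auto. apply zle_refl. Qed.

Lemma emax_r a b : zle b (emax Z.leb a b) = true.
Proof. unfold emax. destruct (zle a b) eqn:E; [apply zle_refl|apply zle_total, E]. Qed.

Lemma vstep_fold x v ps acc :
  let r := fold_left (fun acc p => if veq (p_head p) v then emax Z.leb acc (pval x p) else acc) ps acc in
  zle acc r = true /\
  (forall p, In p ps -> p_head p = v -> zle (pval x p) r = true) /\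
  (r = acc \/ exists p, In p ps /\ p_head p = v /\ r = pval x p).
Proof.
  revert acc. induction ps as [|p ps IH]; intros acc; simpl.
  - split; [apply zle_refl|]. split; [easy|auto].
  - destruct (IH (if veq (p_head p) v then emax Z.leb acc (pval x p) else acc)) as (I1 & I2 & I3).
    set (r := fold_left _ ps _) in *. repeat split.
    + eapply zle_trans; [|exact I1]. destruct (veq (p_head p) v); [apply emax_l|apply zle_refl].
    + intros q [<-|Hq] E; [|auto]. eapply zle_trans; [|exact I1].
      destruct (veq_spec (p_head p) v); [apply emax_r|contradiction].
    + destruct I3 as [I3|(q & H1 & H2 & H3)]; [|right; exists q; auto].
      destruct (veq_spec (p_head p) v); [|left; auto].
      unfold emax in I3 at 1. destruct (zle acc (pval x p)); [right; exists p; auto|left; auto].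
Qed.

Lemma vstep_ge x v : zle (x v) (vstep x v) = true.
Proof. apply vstep_fold. Qed.

Lemma vstep_prod x p : In p prods -> zle (pval x p) (vstep x (p_head p)) = true.
Proof. intros H. apply vstep_fold; auto. Qed.

Lemma vstep_cases x v : vstep x v = x v \/ exists p, In p prods /\ p_head p = v /\ vstep x v = pval x p.
Proof. apply vstep_fold. Qed.

Lemma pval_ext x x' p : (forall u, In u (p_ch p) -> x u = x' u) -> pval x p = pval x' p.
Proof.
  unfold pval. generalize (Fin (p_w p)). induction (p_ch p) as [|u ch IH]; intros acc H; simpl; auto.
  rewrite (H u) by (left; auto). apply IH. intros. apply H. right. auto.
Qed.

Lemma fold_fin (x : V -> ext Z) ch acc z :
  fold_left (fun acc u => eadd Z.add acc (x u)) ch acc = Fin z ->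
  (exists c, acc = Fin c) /\ forall u, In u ch -> exists W : Z, x u = Fin W.
Proof.
  revert acc. induction ch as [|u ch IH]; intros acc H; simpl in *.
  - split; [eauto|easy].
  - destruct (IH _ H) as [[c Hc] I]. destruct acc as [[a|]|], (x u) as [[b|]|] eqn:E; try discriminate.
    split; [eauto|]. intros v [<-|Hv]; eauto.
Qed.

Lemma pval_fin x p z : pval x p = Fin z -> forall u, In u (p_ch p) -> exists W : Z, x u = Fin W.
Proof. intros H. eapply fold_fin. exact H. Qed.

(** A derivation tree of [v] with a hole at [u], represented by its effect on what is plugged in.
    Composing and iterating pumps then needs no syntax of trees. *)
Definition Ctx (v u : V) (g : Z) (h : nat) : Prop :=
  forall W l, derives u W l -> derives v (W + g) (l + h).

Lemma Ctx_refl v : Ctx v v 0 0.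
Proof. intros W l H. rewrite Z.add_0_r, Nat.add_0_r. exact H. Qed.

Lemma Ctx_trans v u t g h g' h' : Ctx v u g h -> Ctx u t g' h' -> Ctx v t (g' + g) (h' + h).
Proof. intros H1 H2 W l H. rewrite Z.add_assoc, Nat.add_assoc. auto. Qed.

Lemma Ctx_iter v g h : Ctx v v g h -> forall n, Ctx v v (Z.of_nat n * g) (n * h).
Proof.
  intros H n. induction n as [|n IH]; [apply Ctx_refl|].
  replace (Z.of_nat (S n) * g)%Z with (Z.of_nat n * g + g)%Z by lia.
  replace (S n * h) with (n * h + h) by lia. apply Ctx_trans with v; auto.
Qed.

Lemma derives_all_of_values (x : V -> ext Z) B ch c z :
  (forall u W, x u = Fin W -> exists l, l <= B /\ derives u W l) ->
  fold_left (fun acc u => eadd Z.add acc (x u)) ch (Fin c) = Fin z ->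
  exists l, l <= length ch * B /\ derives_all ch (z - c) l.
Proof.
  intros Hx. revert c. induction ch as [|u ch IH]; intros c H; simpl in *.
  - injection H as ->. exists 0. rewrite Z.sub_diag. split; [lia|constructor].
  - destruct (x u) as [[w|]|] eqn:E.
    + destruct (Hx _ _ E) as (l1 & H1 & D1). destruct (IH _ H) as (l & H2 & D2).
      exists (l1 + l). split; [lia|].
      replace (z - c)%Z with (w + (z - (c + w)))%Z by lia. constructor; auto.
    + apply fold_fin in H. destruct H as [[? ?] _]. discriminate.
    + apply fold_fin in H. destruct H as [[? ?] _]. discriminate.
Qed.

(** The siblings of the hole keep the derivations behind their values, which costs at most [B] each.
    The lower bound on [h] makes a context through a production with two children strictly longer
    than its hole. *)
Lemma derives_all_hole (x : V -> ext Z) B ch c z u :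
  (forall u W, x u = Fin W -> exists l, l <= B /\ derives u W l) ->
  fold_left (fun acc u => eadd Z.add acc (x u)) ch (Fin c) = Fin z -> In u ch ->
  exists h (Wu : Z), x u = Fin Wu /\ h <= (length ch - 1) * B /\ length ch - 1 <= h /\
    forall W l, derives u W l -> derives_all ch (z - c - Wu + W) (h + l).
Proof.
  intros Hx. revert c. induction ch as [|v ch IH]; intros c H Hu; [easy|].
  simpl in H. assert (Hv := proj2 (fold_fin _ (v :: ch) (Fin c) z H) v (or_introl eq_refl)).
  destruct Hv as [w Ev]. rewrite Ev in H. simpl in H.
  destruct Hu as [->|Hu].
  - destruct (derives_all_of_values x B ch _ _ Hx H) as (h & Hh & DD).
    exists h, w. split; auto. simpl. rewrite Nat.sub_0_r. split; [auto|]. split.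
    + eapply derives_all_len, DD.
    + intros W l HD. replace (z - c - w + W)%Z with (W + (z - (c + w)))%Z by lia.
      rewrite Nat.add_comm. constructor; auto.
  - destruct (IH _ H Hu) as (h & Wu & Eu & H1 & H2 & H3).
    destruct (Hx _ _ Ev) as (l1 & Hl1 & D1).
    exists (l1 + h), Wu. pose proof (derives_len _ _ _ D1).
    destruct ch as [|v' ch]; [easy|]. cbn [length Nat.sub] in *. rewrite Nat.sub_0_r in *.
    repeat split; auto; try lia.
    intros W l HD. replace (z - c - Wu + W)%Z with (w + (z - (c + w) - Wu + W))%Z by lia.
    rewrite <- Nat.add_assoc. constructor; auto.
Qed.

Lemma derives_all_hole_any ch u : (forall v, In v ch -> exists W l, derives v W l) -> In u ch ->
  exists g h, forall W l, derives u W l -> derives_all ch (g + W) (h + l).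
Proof.
  assert (All : forall ch, (forall v, In v ch -> exists W l, derives v W l) ->
    exists W l, derives_all ch W l).
  { clear ch u. induction ch as [|v ch IH]; intros H; [exists 0%Z, 0; constructor|].
    destruct (H v (or_introl eq_refl)) as (W1 & l1 & H1).
    destruct IH as (W & l & H2); [intros; apply H; right; auto|].
    do 2 eexists. constructor; eauto. }
  induction ch as [|v ch IH]; intros H Hu; [easy|]. destruct Hu as [->|Hu].
  - destruct (All ch) as (W & l & H2); [intros; apply H; right; auto|].
    exists W, l. intros W' l' HD. rewrite Z.add_comm, Nat.add_comm. constructor; auto.
  - destruct IH as (g & h & Hg); auto; [intros; apply H; right; auto|].
    destruct (H v (or_introl eq_refl)) as (W1 & l1 & H1).
    exists (W1 + g)%Z, (l1 + h). intros W' l' HD.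
    rewrite <- Z.add_assoc, <- Nat.add_assoc. constructor; auto.
Qed.

Variable vars : list V.
Variable N : nat.
Hypothesis Hvars : length vars <= N.
Hypothesis Hhead : forall p, In p prods -> In (p_head p) vars.

Section Sequence.
Variable x0 : V -> ext Z.

(** The start is a parameter because the chain argument is applied twice: to the iteration from
    minus infinity and to the one after infinite values have been set. *)
Definition viter (k : nat) : V -> ext Z := Nat.iter k vstep x0.

Lemma viter_mono j k v : j <= k -> zle (viter j v) (viter k v) = true.
Proof.
  induction 1; [apply zle_refl|]. eapply zle_trans; [eassumption|]. apply vstep_ge.
Qed.

Definition inc (k : nat) (v : V) : Prop := viter (S k) v <> viter k v.

Lemma inc_vars k v : inc k v -> In v vars.
Proof.
  unfold inc. simpl. intros H.
  destruct (vstep_cases (viter k) v) as [E|(p & Hp & <- & _)]; [contradiction|auto].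
Qed.

Definition link (k : nat) (v u : V) : Prop :=
  exists p, In p prods /\ p_head p = v /\ In u (p_ch p) /\ pval (viter (S k)) p = viter (S (S k)) v.

(** If no child had grown in the preceding round, the production that attains the new value would
    have had this value one round earlier already. *)
Lemma inc_child k v : inc (S k) v -> exists u, link k v u /\ inc k u.
Proof.
  intros H. destruct (vstep_cases (viter (S k)) v) as [E|(p & Hp & E1 & E2)].
  - exfalso. apply H. exact E.
  - assert (dec : (exists u, In u (p_ch p) /\ inc k u) \/
                  forall u, In u (p_ch p) -> viter (S k) u = viter k u).
    { clear. induction (p_ch p) as [|u ch IH]; [right; easy|].
      destruct (ext_eq_dec (viter (S k) u) (viter k u)) as [E|E].
      - destruct IH as [(w & H1 & H2)|IH]; [left; exists w; split; [right|]; auto|].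
        right. intros w [<-|Hw]; auto.
      - left. exists u. split; [left|]; auto. }
    destruct dec as [(u & Hu & Hi)|dec].
    + exists u. split; auto. exists p. auto.
    + exfalso. apply H. apply zle_antisym; [|apply (viter_mono (S k) (S (S k))); lia].
      change (viter (S (S k)) v) with (vstep (viter (S k)) v).
      rewrite E2, (pval_ext _ (viter k)) by exact dec. rewrite <- E1. apply vstep_prod, Hp.
Qed.

Lemma inc_chain k v : inc k v -> exists f : nat -> V, f k = v /\
  (forall j, j <= k -> inc j (f j)) /\ forall j, j < k -> link j (f (S j)) (f j).
Proof.
  revert v. induction k as [|k IH]; intros v H.
  - exists (fun _ => v). repeat split; auto; [|lia]. intros j Hj.
    replace j with 0 by lia. exact H.
  - destruct (inc_child k v H) as (u & Hl & Hu). destruct (IH u Hu) as (f & F1 & F2 & F3).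
    exists (fun j => if j =? S k then v else f j). rewrite Nat.eqb_refl. split; auto. split.
    + intros j Hj. destruct (Nat.eqb_spec j (S k)) as [->|]; auto. apply F2. lia.
    + intros j Hj. destruct (Nat.eqb_spec j (S k)); [lia|].
      destruct (Nat.eqb_spec (S j) (S k)) as [E|].
      * injection E as ->. rewrite F1. exact Hl.
      * apply F3. lia.
Qed.

Lemma inc_repeat k v : N <= k -> inc k v -> exists f i j, f k = v /\ i < j <= k /\ f i = f j /\
  (forall j, j <= k -> inc j (f j)) /\ forall j, j < k -> link j (f (S j)) (f j).
Proof.
  intros Hk H. destruct (inc_chain k v H) as (f & F1 & F2 & F3).
  assert (V_dec : forall u v : V, {u = v} + {u <> v}) by (intros u w; destruct (veq_spec u w); auto).
  destruct (pigeonhole V_dec vars f k) as (i & j & Hij & E); [lia|intros; eapply inc_vars; eauto|].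
  exists f, i, j. auto.
Qed.
End Sequence.

(** * Late growth and pumps *)

Definition xs : nat -> V -> ext Z := viter (fun _ => None).

Lemma xs_fin k v : xs k v <> Some None.
Proof.
  revert v. induction k as [|k IH]; intros v; [discriminate|].
  change (xs (S k) v) with (vstep (xs k) v).
  destruct (vstep_cases (xs k) v) as [->|(p & _ & _ & ->)]; [auto|].
  unfold pval. assert (H : Fin (p_w p) <> Some None) by discriminate. revert H.
  generalize (Fin (p_w p)). induction (p_ch p) as [|u ch IHc]; intros acc H; simpl; auto.
  apply IHc. specialize (IH u). destruct acc as [[]|], (xs k u) as [[]|]; simpl; congruence.
Qed.

Lemma xs_sound k v W : xs k v = Fin W -> exists l, l <= lbound k /\ derives v W l.
Proof.
  revert v W. induction k as [|k IH]; intros v W E; [discriminate|].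
  change (xs (S k) v) with (vstep (xs k) v) in E.
  destruct (vstep_cases (xs k) v) as [E1|(p & Hp & <- & E1)]; rewrite E1 in E.
  - destruct (IH v W E) as (l & H1 & H2). exists l. pose proof (lbound_mono k). split; [lia|auto].
  - destruct (derives_all_of_values (xs k) (lbound k) _ _ _ IH E) as (l & H1 & H2).
    destruct (Hlen p Hp) as (L1 & L2 & _).
    exists (p_len p + l). split.
    + simpl. assert (length (p_ch p) * lbound k <= 2 * lbound k) by (apply Nat.mul_le_mono_r; auto). lia.
    + replace W with (p_w p + (W - p_w p))%Z by lia. constructor; auto.
Qed.

Lemma inc_value k v : inc (fun _ => None) k v -> exists W, xs (S k) v = Fin W.
Proof.
  intros H. destruct (xs (S k) v) as [[W|]|] eqn:E; [eauto| |].
  - apply xs_fin in E. easy.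
  - exfalso. apply H. change (xs (S k) v = xs k v). rewrite E.
    assert (M := viter_mono (fun _ => None) k (S k) v ltac:(lia)).
    change (zle (xs k v) (xs (S k) v) = true) in M. rewrite E in M.
    destruct (xs k v) as [[]|]; simpl in M; congruence.
Qed.

Lemma link_ctx k v u W : link (fun _ => None) k v u -> xs (S (S k)) v = Fin W ->
  exists h Wu, xs (S k) u = Fin Wu /\ 1 <= h <= lbound (S k) + 2 /\ Ctx v u (W - Wu) h.
Proof.
  intros (p & Hp & <- & Hu & E) EW.
  change (pval (xs (S k)) p = xs (S (S k)) (p_head p)) in E. rewrite EW in E.
  destruct (derives_all_hole (xs (S k)) (lbound (S k)) _ _ _ u (xs_sound (S k)) E Hu)
    as (h & Wu & Eu & H1 & H2 & H3).
  destruct (Hlen p Hp) as (L1 & L2 & L3).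
  exists (p_len p + h), Wu. split; auto. split.
  - assert ((length (p_ch p) - 1) * lbound (S k) <= 1 * lbound (S k))
      by (apply Nat.mul_le_mono_r; lia). lia.
  - intros W' l' HD.
    replace (W' + (W - Wu))%Z with (p_w p + (W - p_w p - Wu + W'))%Z by lia.
    replace (l' + (p_len p + h)) with (p_len p + (h + l')) by lia.
    constructor; auto.
Qed.

(** The gains of the links telescope: the context between two members of a chain weighs the
    difference of their values. Every link has length at least 1, so a repetition gives a pump of
    positive length. *)
Lemma chain_ctx f i d :
  (forall j, j <= i + d -> inc (fun _ => None) j (f j)) ->
  (forall j, j < i + d -> link (fun _ => None) j (f (S j)) (f j)) ->
  exists W W' h, xs (S (i + d)) (f (i + d)) = Fin W /\ xs (S i) (f i) = Fin W' /\
    d <= h <= lbound (S (i + d)) /\ Ctx (f (i + d)) (f i) (W - W') h.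
Proof.
  induction d as [|d IH]; intros H1 H2.
  - rewrite Nat.add_0_r in *. destruct (inc_value i (f i)) as [W E]; [auto|].
    exists W, W, 0. repeat split; auto; try lia. rewrite Z.sub_diag. apply Ctx_refl.
  - destruct IH as (W1 & W' & h & E1 & E2 & Hh & C1); [intros; apply H1; lia|intros; apply H2; lia|].
    rewrite Nat.add_succ_r in *.
    destruct (inc_value (S (i + d)) (f (S (i + d)))) as [W E]; [auto|].
    destruct (link_ctx (i + d) (f (S (i + d))) (f (i + d)) W) as (h' & Wu & Eu & Hh' & C2); auto.
    rewrite E1 in Eu. injection Eu as <-.
    exists W, W', (h + h'). repeat split; auto; try lia.
    (* One more link adds at most [lbound (S k) + 2] to a length of at most [lbound (S k)], and the
       sum is [lbound (S (S k))]. *)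
    + cbn [lbound] in *. lia.
    + replace (W - W')%Z with ((W1 - W') + (W - W1))%Z by lia. eapply Ctx_trans; eauto.
Qed.

(** Only the length [h] of the pumped context is bounded: this is what [K] has to exceed. The
    derivation of [c] and the context around it may be of any size, since pumping often enough
    outweighs them. *)
Definition pump (v : V) : Prop := exists c g h W l g' h',
  (0 < g)%Z /\ 1 <= h <= lbound (S N) /\ derives c W l /\ Ctx c c g h /\ Ctx v c g' h'.

Lemma pump_derives v : pump v -> exists W l, derives v W l.
Proof.
  intros (c & g & h & W & l & g' & h' & _ & _ & H & _ & C). do 2 eexists. apply C, H.
Qed.

Lemma inc_pump v : inc (fun _ => None) N v -> pump v.
Proof.
  intros H. destruct (inc_repeat _ N v (le_n _) H) as (f & i & j & Fv & Hij & E & F1 & F2).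
  (* The chain from [j] down to [i] is the pump, the chain from [N] down to [j] the context around
     it. *)
  destruct (chain_ctx f i (j - i)) as (W & W' & h & E1 & E2 & Hh & C).
  { intros. apply F1. lia. } { intros. apply F2. lia. }
  replace (i + (j - i)) with j in * by lia.
  destruct (chain_ctx f j (N - j)) as (U & U' & h' & E3 & E4 & Hh' & C').
  { intros. apply F1. lia. } { intros. apply F2. lia. }
  replace (j + (N - j)) with N in * by lia. rewrite Fv in C'.
  rewrite E in C.
  destruct (xs_sound _ _ _ E2) as (l & _ & HD). rewrite E in HD.
  exists (f j), (W - W')%Z, h, W', l, (U - U')%Z, h'. repeat split; auto; try lia.
  (* [W'] is the value of the repeated variable at round [i + 1 <= j], and the variable grows
     strictly from round [j] to round [j + 1], where its value is [W]. *)
  - assert (M1 := viter_mono (fun _ => None) (S i) j (f j) ltac:(lia)).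
    assert (M2 := viter_mono (fun _ => None) j (S j) (f j) ltac:(lia)).
    assert (NE := F1 j ltac:(lia)). unfold inc in NE.
    change (viter (fun _ => None)) with xs in *. rewrite E in E2. rewrite E2 in M1. rewrite E1 in M2, NE.
    destruct (xs j (f j)) as [[y|]|]; simpl in M1, M2; try discriminate.
    apply Z.leb_le in M1, M2. assert (y <> W) by congruence. lia.
  - pose proof (lbound_le (S j) (S N)). lia.
Qed.

(* Variables that still grow in round [N + 1] can be pumped and are set to plus infinity. *)
Definition y0 (v : V) : ext Z := if zle (xs (S N) v) (xs N v) then xs N v else Some None.

Definition ys : nat -> V -> ext Z := viter y0.

Lemma xs_y0 v : zle (xs N v) (y0 v) = true.
Proof.
  unfold y0. destruct (zle (xs (S N) v) (xs N v)); [apply zle_refl|].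
  destruct (xs N v) as [[]|]; reflexivity.
Qed.

Lemma zle_omega a : zle (Some None) a = true -> a = Some None.
Proof. destruct a as [[]|]; simpl; congruence. Qed.

(** An unmarked variable did not grow in round [N + 1], so a production whose children have their
    values of round [N] cannot raise it. Any other production has an infinite child, and its value
    is not finite. *)
Lemma ys_cases k v : ys k v = xs N v \/ ys k v = Some None.
Proof.
  revert v. induction k as [|k IH]; intros v.
  - change (ys 0 v) with (y0 v). unfold y0. destruct (zle _ _); auto.
  - destruct (ys (S k) v) as [[z|]|] eqn:E; auto; left.
    + change (ys (S k) v) with (vstep (ys k) v) in E.
      destruct (vstep_cases (ys k) v) as [E1|(p & Hp & Hv & E1)].
      * rewrite E1 in E. destruct (IH v); congruence.
      * rewrite E1 in E.
        assert (M0 : zle (y0 v) (Fin z) = true).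
        { rewrite <- E, <- E1. apply (viter_mono y0 0 (S k)). lia. }
        assert (P : pval (ys k) p = pval (xs N) p).
        { apply pval_ext. intros u Hu. destruct (pval_fin _ _ _ E u Hu) as [w Ew].
          destruct (IH u); congruence. }
        rewrite P in E. assert (G := vstep_prod (xs N) p Hp). rewrite E, Hv in G.
        change (vstep (xs N) v) with (xs (S N) v) in G.
        unfold y0 in M0. destruct (zle (xs (S N) v) (xs N v)) eqn:Q.
        -- apply zle_antisym; [eapply zle_trans; eauto|exact M0].
        -- apply zle_omega in M0. discriminate.
    + assert (M : zle (xs N v) None = true).
      { rewrite <- E. eapply zle_trans; [apply xs_y0|]. apply (viter_mono y0 0 (S k)). lia. }
      destruct (xs N v) as [[]|]; simpl in M; congruence.
Qed.

(** A value changes at most once, namely to plus infinity. A change in round [N + 1] would give a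
    chain with a repeated variable, which would have changed in two different rounds. *)
Lemma ys_stable v : vstep (ys N) v = ys N v.
Proof.
  destruct (ext_eq_dec (vstep (ys N) v) (ys N v)) as [|NE]; auto. exfalso.
  destruct (inc_repeat y0 N v (le_n _) NE) as (f & i & j & _ & Hij & E & F1 & _).
  assert (I := F1 i ltac:(lia)). assert (J := F1 j ltac:(lia)). unfold inc in I, J.
  change (viter y0) with ys in *. rewrite E in I.
  assert (MI : zle (ys i (f j)) (ys (S i) (f j)) = true) by (apply viter_mono; lia).
  assert (MJ : zle (ys (S i) (f j)) (ys j (f j)) = true) by (apply viter_mono; lia).
  assert (MK : zle (ys j (f j)) (ys (S j) (f j)) = true) by (apply viter_mono; lia).
  assert (O : ys (S i) (f j) = Some None).
  { destruct (ys_cases (S i) (f j)) as [A|A]; auto. destruct (ys_cases i (f j)) as [B|B]; [congruence|].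
    rewrite B in MI. apply zle_omega in MI. auto. }
  rewrite O in MJ. apply zle_omega in MJ. rewrite MJ in MK. apply zle_omega in MK. congruence.
Qed.

Theorem kleene_fin v W : ys N v = Fin W -> exists l, l <= lbound N /\ derives v W l.
Proof.
  intros E. destruct (ys_cases N v) as [A|A]; [|congruence]. apply xs_sound. congruence.
Qed.

Lemma fold_none (x : V -> ext Z) ch : fold_left (fun acc u => eadd Z.add acc (x u)) ch None = None.
Proof. induction ch; simpl; auto. Qed.

Lemma fold_omega (x : V -> ext Z) ch c :
  fold_left (fun acc u => eadd Z.add acc (x u)) ch (Fin c) = Some None ->
  (exists u, In u ch /\ x u = Some None).
Proof.
  revert c. induction ch as [|u ch IH]; intros c H; simpl in *; [discriminate|].
  destruct (x u) as [[w|]|] eqn:E.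
  - destruct (IH _ H) as (v & Hv & Ev). eauto.
  - eauto.
  - rewrite fold_none in H. discriminate.
Qed.

Lemma fold_some (x : V -> ext Z) ch acc :
  fold_left (fun acc u => eadd Z.add acc (x u)) ch acc <> None ->
  forall u, In u ch -> x u <> None.
Proof.
  revert acc. induction ch as [|v ch IH]; intros acc H u Hu; simpl in *; [easy|].
  destruct Hu as [<-|Hu]; [|eapply IH; eauto].
  intros E. rewrite E in H. apply H.
  replace (eadd Z.add acc None) with (@None (option Z)) by (destruct acc as [[]|]; reflexivity).
  apply fold_none.
Qed.

Theorem kleene_omega v : ys N v = Some None -> pump v.
Proof.
  (* The induction is on the round in which infinity arrives; the [N] of the marking and of [pump]
     stays fixed. *)
  generalize N at 1. intros k. revert v. induction k as [|k IH]; intros v E.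
  - apply inc_pump. intros Q. change (xs (S N) v = xs N v) in Q.
    change (ys 0 v) with (y0 v) in E. unfold y0 in E. rewrite Q, zle_refl in E.
    apply xs_fin in E. exact E.
  - change (ys (S k) v) with (vstep (ys k) v) in E.
    destruct (vstep_cases (ys k) v) as [E1|(p & Hp & <- & E1)]; rewrite E1 in E; [auto|].
    destruct (fold_omega _ _ _ E) as (u & Hu & Eu).
    destruct (IH u Eu) as (c & g & h & W & l & g' & h' & P1 & P2 & P3 & P4 & P5).
    destruct (derives_all_hole_any (p_ch p) u) as (a & b & Hab); auto.
    (* Minus infinity absorbs plus infinity in [eadd], so every child of a production of infinite
       value derives something. *)
    { intros t Ht. assert (NN : ys k t <> None).
      { eapply fold_some; [|exact Ht]. unfold pval in E. rewrite E. discriminate. }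
      destruct (ys_cases k t) as [A|A].
      - destruct (ys k t) as [[z|]|]; [|exfalso; symmetry in A; eapply xs_fin; eauto|congruence].
        destruct (xs_sound N t z (eq_sym A)) as (l1 & _ & H1). eauto.
      - apply pump_derives, IH, A. }
    exists c, g, h, W, l, (g' + (p_w p + a))%Z, (h' + (p_len p + b)). repeat split; auto; try apply P2.
    apply Ctx_trans with u; auto. intros W' l' HD.
    replace (W' + (p_w p + a))%Z with (p_w p + (a + W'))%Z by lia.
    replace (l' + (p_len p + b)) with (p_len p + (b + l')) by lia. constructor; auto.
Qed.

(** By [ys_stable] the final values are closed under all productions, so induction on the derivation
    works for any height. *)
Theorem kleene_complete v W l : derives v W l -> zle (Fin W) (ys N v) = true.
Proof.
  apply (derives_mut (fun v W l _ => zle (Fin W) (ys N v) = true)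
    (fun ch W l _ => forall c acc, zle (Fin c) acc = true ->
      zle (Fin (c + W)%Z) (fold_left (fun acc u => eadd Z.add acc (ys N u)) ch acc) = true)).
  - intros p W' l' Hp _ IH. rewrite <- ys_stable. eapply zle_trans; [|apply vstep_prod, Hp].
    apply IH, zle_refl.
  - intros c acc H. rewrite Z.add_0_r. exact H.
  - intros u ch W1 l1 W' l' _ IH1 _ IH2 c acc H. simpl. rewrite Z.add_assoc. apply IH2.
    destruct acc as [[a|]|], (ys N u) as [[b|]|]; simpl in *; auto; try discriminate.
    apply Z.leb_le in H, IH1. apply Z.leb_le. lia.
Qed.

Theorem kleene_correct v t : zle (Fin t) (ys N v) = true <-> exists W l, (t <= W)%Z /\ derives v W l.
Proof.
  split.
  - intros H. destruct (ys N v) as [[z|]|] eqn:E; [| |discriminate].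
    + apply Z.leb_le in H. destruct (kleene_fin v z E) as (l & _ & HD). eauto.
    + destruct (kleene_omega v E) as (c & g & h & W & l & g' & h' & P1 & _ & P3 & P4 & P5).
      (* Every pumping gains at least 1, so this many make up for the context [g']. *)
      pose (n := Z.to_nat (t - W - g')).
      exists (W + Z.of_nat n * g + g')%Z, (l + n * h + h'). split.
      * assert (Z.of_nat n >= t - W - g')%Z by lia. nia.
      * apply P5, Ctx_iter; auto.
  - intros (W & l & Ht & HD). eapply zle_trans; [|eapply kleene_complete; eauto].
    apply Z.leb_le. exact Ht.
Qed.

End Kleene.

(** * Walks of the pushdown system and the grammar of summaries *)

Definition cstep (A : WPS) (c : config) (e : edge) (c' : config) : Prop :=
  In e (edges A) /\ e_src e = snd c /\ e_top e = Top (fst c) /\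
  c' = (apply_com (e_com e) (fst c), e_dst e).

(** [P] holds at every configuration of the walk, both ends included; it expresses lower and upper
    bounds on the height. *)
Inductive walk (A : WPS) (P : config -> Prop) : config -> list edge -> config -> Prop :=
  | walk_nil c : P c -> walk A P c [] c
  | walk_cons c e c1 es c2 : P c -> cstep A c e c1 -> walk A P c1 es c2 -> walk A P c (e :: es) c2.

Fixpoint wsum (es : list edge) : Z :=
  match es with [] => 0%Z | e :: es => (e_w e + wsum es)%Z end.

Lemma wsum_app es fs : wsum (es ++ fs) = (wsum es + wsum fs)%Z.
Proof. induction es; simpl; lia. Qed.

Lemma walk_app A P c es c1 fs c2 : walk A P c es c1 -> walk A P c1 fs c2 -> walk A P c (es ++ fs) c2.
Proof. induction 1; intros; simpl; auto. econstructor; eauto. Qed.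

Lemma walk_app_inv A P c es fs c2 : walk A P c (es ++ fs) c2 ->
  exists c1, walk A P c es c1 /\ walk A P c1 fs c2.
Proof.
  revert c. induction es as [|e es IH]; intros c H; simpl in *.
  - exists c. split; auto. inversion H; subst; constructor; auto.
  - inversion H as [|? ? c1 ? ? HP Hs Hw]; subst. destruct (IH _ Hw) as (c3 & W1 & W2).
    exists c3. split; auto. econstructor; eauto.
Qed.

Lemma walk_weaken A (P Q : config -> Prop) c es c' :
  (forall c, P c -> Q c) -> walk A P c es c' -> walk A Q c es c'.
Proof. intros H. induction 1; econstructor; eauto. Qed.

Lemma walk_one A (P : config -> Prop) c e c' : P c -> P c' -> cstep A c e c' -> walk A P c [e] c'.
Proof. intros. econstructor; eauto. constructor; auto. Qed.

Lemma walk_first A P c es c' : walk A P c es c' -> P c.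
Proof. destruct 1; auto. Qed.

Lemma walk_last A P c es c' : walk A P c es c' -> P c'.
Proof. induction 1; auto. Qed.

Definition any (c : config) : Prop := True.
Definition above (h : nat) (c : config) : Prop := h <= length (fst c).

Definition reach (A : WPS) (c : config) : Prop := exists es, walk A any (init_config A) es c.

Definition cyc (A : WPS) (w : Z) (l : nat) : Prop :=
  exists c es, reach A c /\ walk A any c es c /\ wsum es = w /\ length es = l /\ 0 < l.

Lemma walk_lowest A c es c' : walk A any c es c' -> exists m es1 es2, es = es1 ++ es2 /\
  walk A (above (length (fst m))) c es1 m /\ walk A (above (length (fst m))) m es2 c'.
Proof.
  induction 1 as [c _|c e c1 es c2 _ Hs Hw (m & es1 & es2 & -> & H1 & H2)].
  - exists c, [], []. repeat split; constructor; unfold above; lia.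
  - destruct (le_lt_dec (length (fst m)) (length (fst c))) as [Hl|Hl].
    + exists m, (e :: es1), es2. repeat split; auto. econstructor; eauto.
    + exists c, [], (e :: es1 ++ es2). repeat split.
      * constructor. unfold above. lia.
      * econstructor; [unfold above; lia|exact Hs|].
        apply walk_weaken with (above (length (fst m))); [unfold above; intros; lia|].
        eapply walk_app; eauto.
Qed.

Lemma cyc_lowest A w l : cyc A w l -> exists m es, reach A m /\
  walk A (above (length (fst m))) m es m /\ wsum es = w /\ length es = l /\ 0 < l.
Proof.
  intros (c & es & (es0 & Hr) & Hc & Hw & Hl & Hp).
  destruct (walk_lowest _ _ _ _ Hc) as (m & es1 & es2 & -> & H1 & H2).
  exists m, (es2 ++ es1). split; [|split; [eapply walk_app; eauto|]].
  - exists (es0 ++ es1). eapply walk_app; eauto. eapply walk_weaken; [|exact H1]. easy.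
  - rewrite wsum_app in *. rewrite length_app in *. repeat split; auto; lia.
Qed.

Definition var := (nat * nat * nat)%type.

Section Grammar.
Variable A : WPS.
Hypothesis HA : wf_WPS A.
Variables a b : Z.

(** The choice [a = 1], [b = 0] gives the plain weight for the existence problems, [a = K], [b = 1]
    the scaled weight for the supremum. *)
Definition We (e : edge) : Z := (a * e_w e + b)%Z.

Definition wt (es : list edge) : Z := (a * wsum es + b * Z.of_nat (length es))%Z.

(* The variable [(q, z, q')] stands for the nonempty walks from [q] to [q'] that start and end with
   the same stack, with top [z], and never touch what is below; [(q, z, nQ A)] stands for the
   reachability of a configuration with state [q] and top [z]. *)
Inductive gprod : prod var -> Prop :=
  | g_skip e : In e (edges A) -> e_com e = Skip ->
      gprod (Prod _ (e_src e, e_top e, e_dst e) (We e) 1 [])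
  | g_pushpop e f : In e (edges A) -> In f (edges A) -> e_com e = Push (e_top f) ->
      e_com f = Pop -> e_dst e = e_src f ->
      gprod (Prod _ (e_src e, e_top e, e_dst f) (We e + We f)%Z 2 [])
  | g_nested e f : In e (edges A) -> In f (edges A) -> e_com e = Push (e_top f) ->
      e_com f = Pop ->
      gprod (Prod _ (e_src e, e_top e, e_dst f) (We e + We f)%Z 2 [(e_dst e, e_top f, e_src f)])
  | g_cat q z m q' : q < nQ A -> z < nG A -> m < nQ A -> q' < nQ A ->
      gprod (Prod _ (q, z, q') 0 0 [(q, z, m); (m, z, q')])
  | g_init : gprod (Prod _ (q0 A, bot, nQ A) b 1 [])
  | g_rpush e y : In e (edges A) -> e_com e = Push y ->
      gprod (Prod _ (e_dst e, y, nQ A) (We e) 1 [(e_src e, e_top e, nQ A)])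
  | g_rstep q z q' : q < nQ A -> z < nG A -> q' < nQ A ->
      gprod (Prod _ (q', z, nQ A) 0 0 [(q, z, nQ A); (q, z, q')]).

Variable prods : list (prod var).
Hypothesis Hprods : forall p, In p prods <-> gprod p.

Notation derives := (derives var prods).
Notation derives_all := (derives_all var prods).

Lemma edge_range e : In e (edges A) -> e_src e < nQ A /\ e_dst e < nQ A /\ e_top e < nG A.
Proof. intros H. destruct HA as (_ & _ & _ & Hw). destruct (Hw e H) as (? & ? & ? & _). auto. Qed.

Lemma push_range e y : In e (edges A) -> e_com e = Push y -> 0 < y < nG A.
Proof. intros H HE. destruct HA as (_ & _ & _ & Hw). apply (Hw e H). exact HE. Qed.

Lemma gprod_len p : gprod p ->
  p_len _ p <= 2 /\ length (p_ch _ p) <= 2 /\ (1 <= p_len _ p \/ length (p_ch _ p) = 2).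
Proof. destruct 1; simpl; lia. Qed.

(** The initial production has the constant [b] to match its length 1. *)
Lemma gprod_lin p : gprod p -> exists w, p_w _ p = (a * w + b * Z.of_nat (p_len _ p))%Z.
Proof.
  destruct 1; simpl; unfold We.
  - exists (e_w e). lia.
  - exists (e_w e + e_w f)%Z. lia.
  - exists (e_w e + e_w f)%Z. lia.
  - exists 0%Z. lia.
  - exists 0%Z. lia.
  - exists (e_w e). lia.
  - exists 0%Z. lia.
Qed.

Definition in_range (v : var) : Prop := fst (fst v) < nQ A /\ snd (fst v) < nG A /\ snd v <= nQ A.

Lemma gprod_range p : gprod p -> in_range (p_head _ p).
Proof.
  destruct HA as (H0 & H1 & _).
  destruct 1; unfold in_range; simpl;
  repeat match goal with
  | H : In ?e (edges A) |- _ => apply edge_range in H as ?; revert H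
  end; intros; unfold bot; try lia.
  pose proof (push_range e y H H2). lia.
Qed.

Lemma derives_range v W l : derives v W l -> in_range v.
Proof. destruct 1. apply gprod_range, Hprods. auto. Qed.

(** Quantifying over all [s], with [W] and [l] fixed, expresses that a summary never uses the stack
    below its top symbol. *)
Definition sem (v : var) (W : Z) (l : nat) : Prop :=
  let '(q, z, q') := v in
  if q' =? nQ A then exists s, reach A (z :: s, q)
  else forall s, exists es, walk A any (z :: s, q) es (z :: s, q') /\ length es = l /\ wt es = W.

Fixpoint seml (ch : list var) (W : Z) (l : nat) : Prop :=
  match ch with
  | [] => W = 0%Z /\ l = 0
  | v :: ch => exists W1 l1 W2 l2, sem v W1 l1 /\ seml ch W2 l2 /\ W = (W1 + W2)%Z /\ l = l1 + l2
  end.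

Lemma wt_app es fs : wt (es ++ fs) = (wt es + wt fs)%Z.
Proof. unfold wt. rewrite wsum_app, length_app. lia. Qed.

Lemma wt_one e : wt [e] = We e.
Proof. unfold wt, We. simpl. lia. Qed.

Lemma state_neq q : q < nQ A -> q =? nQ A = false.
Proof. intros. apply Nat.eqb_neq. lia. Qed.

Lemma reach_app c es c' : reach A c -> walk A any c es c' -> reach A c'.
Proof. intros [es0 H0] H. exists (es0 ++ es). eapply walk_app; eauto. Qed.

Lemma derives_sound v W l : derives v W l -> sem v W l.
Proof.
  apply (derives_mut var prods (fun v W l _ => sem v W l) (fun ch W l _ => seml ch W l)).
  - intros p W' l' Hp _. apply Hprods in Hp. destruct Hp;
      simpl p_head; simpl p_ch; simpl p_w; simpl p_len.
    + intros [-> ->]. destruct (edge_range e) as (R1 & R2 & R3); auto.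
      unfold sem. rewrite state_neq by assumption. intros s. exists [e]. split; [|split; [reflexivity|]].
      * apply walk_one; try exact I. repeat split; auto. rewrite H0. reflexivity.
      * rewrite wt_one. lia.
    + intros [-> ->]. destruct (edge_range f) as (R1 & R2 & R3); auto.
      unfold sem. rewrite state_neq by assumption. intros s. exists [e; f].
      split; [|split; [reflexivity|]].
      * econstructor; [exact I| |apply walk_one; try exact I].
        -- repeat split; auto.
        -- rewrite H1. repeat split; auto. simpl. rewrite H2. reflexivity.
      * change [e; f] with ([e] ++ [f]). rewrite wt_app, !wt_one. lia.
    + intros (W1 & l1 & W2 & l2 & S1 & [-> ->] & -> & ->).
      destruct (edge_range f) as (R1 & R2 & R3); auto.
      unfold sem in *. rewrite state_neq in * by assumption. intros s.
      destruct (S1 (e_top e :: s)) as (es & Hw & Hl & Ht).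
      exists ([e] ++ es ++ [f]). split; [|split].
      * eapply walk_app; [apply walk_one; try exact I; repeat split; reflexivity || auto|].
        simpl. rewrite H1. eapply walk_app; [exact Hw|].
        apply walk_one; try exact I. repeat split; auto. simpl. rewrite H2. reflexivity.
      * rewrite !length_app. simpl. lia.
      * rewrite !wt_app, !wt_one. lia.
    + intros (W1 & l1 & ? & ? & S1 & (W2 & l2 & ? & ? & S2 & [-> ->] & -> & ->) & -> & ->).
      unfold sem in *. rewrite !state_neq in * by assumption. intros s.
      destruct (S1 s) as (es1 & Hw1 & Hl1 & Ht1). destruct (S2 s) as (es2 & Hw2 & Hl2 & Ht2).
      exists (es1 ++ es2). split; [eapply walk_app; eauto|]. rewrite length_app, wt_app. split; lia.
    + intros _. unfold sem. rewrite Nat.eqb_refl. exists [], []. constructor. exact I.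
    + intros (W1 & l1 & ? & ? & S1 & _). unfold sem in *. rewrite Nat.eqb_refl in *.
      destruct S1 as [s Hs]. exists (e_top e :: s). eapply reach_app; [exact Hs|].
      apply walk_one; try exact I. repeat split; auto. rewrite H0. reflexivity.
    + intros (W1 & l1 & ? & ? & S1 & (W2 & l2 & ? & ? & S2 & _) & _ & _).
      unfold sem in *. rewrite Nat.eqb_refl in *. rewrite state_neq in S2 by assumption.
      destruct S1 as [s Hs]. destruct (S2 s) as (es & Hw & _). exists s. eapply reach_app; eauto.
  - simpl. auto.
  - intros u ch W1 l1 W' l' _ H1 _ H2. simpl. exists W1, l1, W', l'. auto.
Qed.

(** * Completeness of the grammar of summaries *)

Definition summary (q z q' : nat) (W : Z) (l : nat) : Prop := derives (q, z, q') W l /\ q' < nQ A.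

Lemma derives_prod (h : var) (c : Z) n ch W l W' l' : gprod (Prod _ h c n ch) -> derives_all ch W l ->
  W' = (c + W)%Z -> l' = n + l -> derives h W' l'.
Proof. intros Hp Hd -> ->. apply Hprods in Hp. exact (derives_intro _ _ _ _ _ Hp Hd). Qed.

Lemma derives_all_one v W l : derives v W l -> derives_all [v] W l.
Proof.
  intros H. rewrite <- (Z.add_0_r W), <- (Nat.add_0_r l). constructor; auto. constructor.
Qed.

Lemma derives_all_two u v W1 l1 W2 l2 : derives u W1 l1 -> derives v W2 l2 ->
  derives_all [u; v] (W1 + W2) (l1 + l2).
Proof. intros. constructor; auto. apply derives_all_one. auto. Qed.

Lemma summary_cat q z m q' W1 l1 W2 l2 :
  summary q z m W1 l1 -> summary m z q' W2 l2 -> summary q z q' (W1 + W2) (l1 + l2).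
Proof.
  intros [D1 R1] [D2 R2]. split; auto. destruct (derives_range _ _ _ D1) as (R3 & R4 & _).
  eapply derives_prod; [apply (g_cat q z m q'); auto|eapply derives_all_two; eauto|lia|lia].
Qed.

Lemma summary_skip e : In e (edges A) -> e_com e = Skip ->
  summary (e_src e) (e_top e) (e_dst e) (We e) 1.
Proof.
  intros H HE. destruct (edge_range e H) as (_ & Hd & _). split; auto.
  eapply derives_prod; [apply g_skip; eauto|constructor|lia|lia].
Qed.

Definition summary0 (q z q' : nat) (W : Z) (l : nat) : Prop :=
  (q = q' /\ W = 0%Z /\ l = 0) \/ summary q z q' W l.

Lemma summary_nested e f W l : In e (edges A) -> In f (edges A) -> e_com e = Push (e_top f) ->
  e_com f = Pop -> summary0 (e_dst e) (e_top f) (e_src f) W l ->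
  summary (e_src e) (e_top e) (e_dst f) (We e + W + We f) (l + 2).
Proof.
  intros He Hf Ce Cf [(Eq & -> & ->)|[HD _]]; destruct (edge_range f Hf) as (_ & Hd & _); split; auto.
  - eapply derives_prod; [apply (g_pushpop e f); auto|constructor|lia|lia].
  - eapply derives_prod; [apply (g_nested e f); auto|apply derives_all_one; exact HD|lia|lia].
Qed.

Lemma summary_summary0 q z m q' W1 l1 W2 l2 :
  summary q z m W1 l1 -> summary0 m z q' W2 l2 -> summary q z q' (W1 + W2) (l1 + l2).
Proof.
  intros H [(<- & -> & ->)|H']; [|eapply summary_cat; eauto].
  rewrite Z.add_0_r, Nat.add_0_r. exact H.
Qed.

Lemma summary0_summary q z m q' W1 l1 W2 l2 :
  summary0 q z m W1 l1 -> summary m z q' W2 l2 -> summary q z q' (W1 + W2) (l1 + l2).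
Proof. intros [(<- & -> & ->)|H'] H; [exact H|]. eapply summary_cat; eauto. Qed.

(* How a walk from state [q] with stack word [u] above the symbol [z] gets back to [z] in state [q']:
   the symbols of [u] are popped one after the other, each after a summary at its level. *)
Inductive unwind (z : nat) : list nat -> nat -> nat -> Z -> nat -> Prop :=
  | unwind_nil q q' W l : summary0 q z q' W l -> unwind z [] q q' W l
  | unwind_cons u q f q' W1 l1 W l :
      summary0 q (e_top f) (e_src f) W1 l1 -> In f (edges A) -> e_com f = Pop ->
      unwind z u (e_dst f) q' W l ->
      unwind z (e_top f :: u) q q' (W1 + We f + W) (l1 + 1 + l).

Lemma summary_unwind z u q p q' W1 l1 W l : summary q (Top (u ++ [z])) p W1 l1 -> unwind z u p q' W l ->
  unwind z u q q' (W1 + W) (l1 + l).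
Proof.
  intros HT HU. destruct HU as [p q' W l H|u p f q' W2 l2 W l H Hf Cf HU]; simpl in HT.
  - constructor. right. eapply summary_summary0; eauto.
  - rewrite !Z.add_assoc, !Nat.add_assoc. apply unwind_cons; auto. right. eapply summary_summary0; eauto.
Qed.

Lemma Top_app u z s : Top (u ++ z :: s) = Top (u ++ [z]).
Proof. destruct u; reflexivity. Qed.

(** The walk is parsed from its first edge. A skip extends the first summary and a pop starts a new
    level. After a push, the induction hypothesis for the higher stack exhibits the matching pop,
    and the two edges enclose a nested summary. *)
Lemma walk_unwind z s c es c' : walk A (above (S (length s))) c es c' ->
  forall u q q', c = (u ++ z :: s, q) -> c' = (z :: s, q') -> unwind z u q q' (wt es) (length es).
Proof.
  induction 1 as [c Hc|c e c1 es c2 Hc (He & Es & Et & E1) Hw IH]; intros u q q' -> Ec'.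
  - injection Ec' as E1 E2. subst q'.
    assert (u = []) as ->.
    { destruct u as [|y u]; auto. apply (f_equal (@length nat)) in E1.
      simpl in E1. rewrite length_app in E1. simpl in E1. lia. }
    constructor. left. unfold wt. simpl. repeat split. lia.
  - simpl fst in *. simpl snd in *. subst q. rewrite Top_app in Et.
    change (e :: es) with ([e] ++ es). rewrite wt_app, wt_one, length_app.
    destruct (e_com e) as [| |y] eqn:Ce; simpl in E1.
    + eapply summary_unwind; [|eapply IH; eauto]. rewrite <- Et. apply summary_skip; auto.
    + destruct u as [|y u].
      (* Popping [z] itself would leave the region of height at least [S (length s)]. *)
      * exfalso. apply walk_first in Hw. subst c1. unfold above in Hw. simpl in Hw. lia.
      * simpl in E1, Et. subst y.
        replace (We e + wt es)%Z with (0 + We e + wt es)%Z by lia.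
        change (length [e] + length es) with (0 + 1 + length es).
        apply unwind_cons; auto. left. auto.
    + specialize (IH (y :: u) (e_dst e) q' E1 Ec'). inversion IH; subst.
      replace (We e + (W1 + We f + W))%Z with (We e + W1 + We f + W)%Z by lia.
      replace (length [e] + (l1 + 1 + l)) with (l1 + 2 + l) by (simpl; lia).
      eapply summary_unwind; [|eassumption]. rewrite <- Et. apply summary_nested; auto.
Qed.

Definition top_reachable (q z : nat) : Prop := exists W l, derives (q, z, nQ A) W l.

Lemma top_reachable_summary q z q' W l :
  top_reachable q z -> summary q z q' W l -> top_reachable q' z.
Proof.
  intros (W1 & l1 & H1) [H2 R2]. destruct (derives_range _ _ _ H2) as (R3 & R4 & _).
  do 2 eexists.
  eapply derives_prod; [apply (g_rstep q z q'); auto|eapply derives_all_two; eauto|reflexivity..].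
Qed.

(** Records how a reachable stack was built: every symbol above the bottom comes from a push out of
    an earlier configuration, followed by a possibly empty summary at its own level. When the symbol
    is popped, this history provides the nested summary for the level below. *)
Inductive inv : list nat -> nat -> Prop :=
  | inv_bot q : top_reachable q bot -> inv [bot] q
  | inv_push y t s e q : inv (t :: s) (e_src e) -> In e (edges A) -> e_top e = t ->
      e_com e = Push y -> (exists W l, summary0 (e_dst e) y q W l) -> inv (y :: t :: s) q.

Lemma inv_top_reachable z s q : inv (z :: s) q -> top_reachable q z.
Proof.
  intros H. remember (z :: s) as st eqn:Es. revert z s Es.
  induction H as [q H|y t s e q H IH He Et Ce (W & l & HE)]; intros z s' Es.
  - injection Es as <- <-. exact H.
  - injection Es as <- <-. destruct (IH t s eq_refl) as (W1 & l1 & H1).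
    assert (HR : top_reachable (e_dst e) y).
    { do 2 eexists.
      eapply derives_prod;
        [eapply g_rpush; eauto|rewrite Et; apply derives_all_one; exact H1|reflexivity..]. }
    destruct HE as [(<- & _)|HT]; auto. eapply top_reachable_summary; eauto.
Qed.

Lemma inv_summary t s p q W l : inv (t :: s) p -> summary p t q W l -> inv (t :: s) q.
Proof.
  intros H HT. inversion H as [p' HR|y t' s' e' p' HI He Et Ce (W1 & l1 & HE)]; subst.
  - constructor. eapply top_reachable_summary; eauto.
  - eapply inv_push; eauto.
    do 2 eexists. right. eapply summary0_summary; eauto.
Qed.

Lemma inv_step s q e s' q' : inv s q -> cstep A (s, q) e (s', q') -> inv s' q'.
Proof.
  intros H (He & Es & Et & E1). simpl in Es, Et, E1. injection E1 as -> ->. subst q.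
  destruct s as [|t s]; [inversion H|]. simpl in Et. subst t.
  destruct (e_com e) as [| |y] eqn:Ce; simpl.
  - eapply inv_summary; [exact H|]. apply summary_skip; auto.
  - inversion H as [q HR|y t s' e' q HI He' Et' Ce' (W & l & HE)]; subst.
    + exfalso. destruct HA as (_ & _ & _ & Hw). destruct (Hw e He) as (_ & _ & _ & _ & Hb).
      apply Hb; auto.
    + eapply inv_summary; [exact HI|]. eapply summary_nested; eauto.
  - eapply inv_push; eauto. exists 0%Z, 0. left. auto.
Qed.

Lemma reach_inv s q : reach A (s, q) -> inv s q.
Proof.
  intros [es H].
  assert (H0 : inv (fst (init_config A)) (snd (init_config A))).
  { constructor. do 2 eexists. eapply derives_prod; [apply g_init|constructor|reflexivity|reflexivity]. }
  change (inv (fst (s, q)) (snd (s, q))). revert H H0. generalize (init_config A), (s, q).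
  induction 1 as [c _|c e c1 es c2 _ Hs Hw IH]; intros H0; auto.
  apply IH. destruct c, c1. eapply inv_step; eauto.
Qed.

Theorem cyc_derives w l : cyc A w l ->
  exists q z, top_reachable q z /\ summary q z q (a * w + b * Z.of_nat l) l.
Proof.
  intros H. apply cyc_lowest in H. destruct H as ([s q] & es & Hr & Hw & <- & <- & Hl).
  pose proof (reach_inv s q Hr) as HI. destruct s as [|z s]; [inversion HI|].
  exists q, z. split; [eapply inv_top_reachable; eauto|].
  assert (HU := walk_unwind z s _ _ _ Hw [] q q eq_refl eq_refl).
  inversion HU; subst. destruct H as [(_ & _ & E0)|HT]; [lia|exact HT].
Qed.

Theorem derives_cyc q z W l : top_reachable q z -> summary q z q W l ->
  exists w, cyc A w l /\ W = (a * w + b * Z.of_nat l)%Z.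
Proof.
  intros (W1 & l1 & HR) [HD Hq]. apply derives_sound in HR. unfold sem in HR. rewrite Nat.eqb_refl in HR.
  destruct HR as [s Hs].
  assert (Hl : 1 <= l).
  { eapply derives_len; [|exact HD]. intros p Hp. apply gprod_len, Hprods, Hp. }
  apply derives_sound in HD. unfold sem in HD. rewrite state_neq in HD by assumption.
  destruct (HD s) as (es & Hw & Hel & Ht). subst l.
  exists (wsum es). split; [|symmetry; exact Ht].
  exists (z :: s, q), es. repeat split; auto.
Qed.

(** * Reading cycles off the computed values *)

Variable vars : list var.
Variable N : nat.
Hypothesis Hvars : length vars <= N.
Hypothesis Hrange : forall v, in_range v -> In v vars.
Variable veq : var -> var -> bool.
Hypothesis veq_spec : forall u v, reflect (u = v) (veq u v).

Notation ys := (ys var veq prods N).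

Definition test (t : Z) : Prop := exists q z, q < nQ A /\ z < nG A /\
  ys N (q, z, nQ A) <> None /\ zle (Fin t) (ys N (q, z, q)) = true.

Lemma prods_head p : In p prods -> In (p_head _ p) vars.
Proof. intros. apply Hrange, gprod_range, Hprods. auto. Qed.

Lemma prods_len p : In p prods ->
  p_len _ p <= 2 /\ length (p_ch _ p) <= 2 /\ (1 <= p_len _ p \/ length (p_ch _ p) = 2).
Proof. intros. apply gprod_len, Hprods. auto. Qed.

Lemma reach_value q z : ys N (q, z, nQ A) <> None <-> top_reachable q z.
Proof.
  pose proof (kleene_fin var veq veq_spec prods prods_len vars N Hvars) as KF.
  pose proof (kleene_omega var veq veq_spec prods prods_len vars N Hvars prods_head) as KO.
  split.
  - intros H. destruct (ys N (q, z, nQ A)) as [[W|]|] eqn:EE; [| |congruence].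
    + destruct (KF _ _ EE) as (l & _ & HD). exists W, l. exact HD.
    + apply pump_derives with (N := N). apply KO. exact EE.
  - intros (W & l & HD) EE.
    apply (kleene_complete var veq veq_spec prods vars N Hvars prods_head) in HD.
    rewrite EE in HD. discriminate.
Qed.

Theorem test_cyc t : test t <-> exists w l, cyc A w l /\ (t <= a * w + b * Z.of_nat l)%Z.
Proof.
  pose proof (kleene_correct var veq veq_spec prods prods_len vars N Hvars prods_head) as KC.
  split.
  - intros (q & z & Hq & Hz & HR & HT). apply reach_value in HR. apply KC in HT.
    destruct HT as (W & l & Ht & HD).
    destruct (derives_cyc q z W l HR (conj HD Hq)) as (w & Hc & ->). eauto.
  - intros (w & l & Hc & Ht). destruct (cyc_derives w l Hc) as (q & z & HR & [HD Hq]).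
    destruct (derives_range _ _ _ HD) as (_ & Hz & _). simpl in Hz.
    exists q, z. repeat split; auto.
    + apply reach_value, HR.
    + apply KC. eauto.
Qed.

(* With [a = K] and [b = 1], a pump of positive value [K * w + l] must have [w >= 0], since its
   length [l] is less than [K]. *)
Theorem test_all_cyc K : a = Z.of_nat K -> b = 1%Z -> lbound (S N) < K -> test 0 ->
  forall K' : Z, (0 <= K')%Z -> exists w l, cyc A w l /\ (0 <= K' * w + Z.of_nat l)%Z.
Proof.
  intros Ea Eb HK (q & z & Hq & Hz & HR & HT) K' HK'. apply reach_value in HR.
  pose proof (derives_lin var prods a b (fun p Hp => gprod_lin p (proj1 (Hprods p) Hp))) as DL.
  destruct (ys N (q, z, q)) as [[W|]|] eqn:EE; [| |discriminate].
  - apply Z.leb_le in HT.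
    destruct (kleene_fin var veq veq_spec prods prods_len vars N Hvars _ _ EE) as (l & Hl & HD).
    destruct (derives_cyc q z W l HR (conj HD Hq)) as (w & Hc & HW).
    exists w, l. split; auto. pose proof (lbound_mono N).
    (* [K * w + l >= 0] together with [l < K] forces [w > -1]. *)
    rewrite Ea, Eb in HW. assert (0 <= w)%Z by nia. nia.
  - destruct (kleene_omega var veq veq_spec prods prods_len vars N Hvars prods_head _ EE)
      as (c & g & h & W & l & g' & h' & Hg & Hh & HD & HC & HC').
    destruct (DL _ _ _ HD) as [w1 E1]. destruct (DL _ _ _ (HC _ _ HD)) as [w2 E2].
    assert (Hd : (g = Z.of_nat K * (w2 - w1) + Z.of_nat h)%Z) by (rewrite Ea, Eb in E1, E2; lia).
    assert (Hw : (0 <= w2 - w1)%Z) by nia.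
    destruct (DL _ _ _ (HC' _ _ HD)) as [w0 E0].
    (* The pump has weight at least 0 and length at least 1, so this many repetitions add enough
       length to compensate [K' * w0]. *)
    pose (n := Z.to_nat (K' * Z.abs w0)).
    assert (HDn := HC' _ _ (Ctx_iter _ _ _ _ _ HC n _ _ HD)).
    destruct (derives_cyc q z _ _ HR (conj HDn Hq)) as (w & Hc & HW).
    exists w, (l + n * h + h'). split; auto.
    assert (Ew : (w = w0 + Z.of_nat n * (w2 - w1))%Z).
    (* The cycle has exactly the length of the pumped derivation, so the lengths cancel and division
       by [K] recovers its weight. *)
    { apply (Z.mul_reg_l _ _ (Z.of_nat K)); [lia|].
      rewrite Ea, Eb in HW, E0. rewrite Hd in HW. lia. }
    assert (Hn : Z.of_nat n = (K' * Z.abs w0)%Z) by (unfold n; nia).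
    assert (Hnw : (0 <= K' * (Z.of_nat n * (w2 - w1)))%Z).
    { apply Z.mul_nonneg_nonneg; auto. apply Z.mul_nonneg_nonneg; lia. }
    assert (n <= n * h) by nia.
    rewrite Ew. assert (K' * - w0 <= K' * Z.abs w0)%Z by (apply Z.mul_le_mono_nonneg_l; lia). lia.
Qed.

End Grammar.

(** * Averages of stack bounded paths *)

Lemma Rbar_le_eps_l (x : R) (y : Rbar) :
  (forall eps, (0 < eps)%R -> Rbar_le (Finite (x - eps)) y) -> Rbar_le (Finite x) y.
Proof.
  intros H. destruct y as [y| |]; simpl in *; auto.
  - apply Rnot_lt_le. intros Hl. specialize (H ((x - y) / 2)%R ltac:(lra)). lra.
  - apply (H 1%R). lra.
Qed.

Lemma Rbar_le_eps_r (x : Rbar) (y : R) :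
  (forall eps, (0 < eps)%R -> Rbar_le x (Finite (y + eps))) -> Rbar_le x (Finite y).
Proof.
  intros H. destruct x as [x| |]; simpl in *; auto.
  - apply Rnot_lt_le. intros Hl. specialize (H ((x - y) / 2)%R ltac:(lra)). lra.
  - apply (H 1%R). lra.
Qed.

Lemma small_quotient (x eps : R) : (0 < eps)%R ->
  exists n, forall i, n <= i -> (0 < INR i)%R /\ (x / INR i <= eps)%R.
Proof.
  intros He. destruct (INR_unbounded (Rabs x / eps)) as [n Hn].
  exists (S n). intros i Hi.
  assert (Hi' : (INR n < INR i)%R) by (apply lt_INR; lia).
  pose proof (pos_INR n). split; [lra|].
  assert (Hx : (Rabs x < eps * INR i)%R).
  { apply Rmult_lt_reg_r with (/ eps)%R; [apply Rinv_0_lt_compat; lra|].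
    replace (eps * INR i * / eps)%R with (INR i) by (field; lra). unfold Rdiv in Hn. lra. }
  pose proof (Rle_abs x).
  apply Rmult_le_reg_r with (INR i); [lra|].
  replace (x / INR i * INR i)%R with x by (field; lra). lra.
Qed.

(** After division by [a * i] the constant [C] vanishes in the limit. *)
Lemma LimSupAvg_le e (a b C : Z) : (0 < a)%Z ->
  (forall i, a * wprefix e i + b * Z.of_nat i <= C)%Z ->
  Rbar_le (LimSupAvg e) (Finite (- IZR b / IZR a)).
Proof.
  intros Ha H. apply Rbar_le_eps_r. intros eps He.
  rewrite <- LimSup_seq_const. apply LimSup_le.
  assert (Ha' : (0 < IZR a)%R) by (apply IZR_lt; auto).
  destruct (small_quotient (IZR C / IZR a) eps He) as [n Hn].
  exists n. intros i Hi. destruct (Hn i Hi) as [Hp Hq].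
  specialize (H i). apply IZR_le in H. rewrite plus_IZR, !mult_IZR, <- INR_IZR_INZ in H.
  unfold avg. apply Rle_trans with (IZR C / IZR a / INR i - IZR b / IZR a)%R; [|lra].
  apply Rmult_le_reg_r with (IZR a * INR i)%R; [apply Rmult_lt_0_compat; auto|].
  replace (IZR (wprefix e i) / INR i * (IZR a * INR i))%R with (IZR a * IZR (wprefix e i))%R
    by (field; lra).
  replace ((IZR C / IZR a / INR i - IZR b / IZR a) * (IZR a * INR i))%R with
    (IZR C - IZR b * INR i)%R by (field; lra). lra.
Qed.

Lemma LimInfAvg_ge e (w l C : Z) : (0 < l)%Z ->
  (forall i, w * Z.of_nat i <= l * wprefix e i + C)%Z ->
  Rbar_le (Finite (IZR w / IZR l)) (LimInfAvg e).
Proof.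
  intros Hl H. apply Rbar_le_eps_l. intros eps He.
  rewrite <- LimInf_seq_const. apply LimInf_le.
  assert (Hl' : (0 < IZR l)%R) by (apply IZR_lt; auto).
  destruct (small_quotient (IZR C / IZR l) eps He) as [n Hn].
  exists n. intros i Hi. destruct (Hn i Hi) as [Hp Hq].
  specialize (H i). apply IZR_le in H. rewrite plus_IZR, !mult_IZR, <- INR_IZR_INZ in H.
  unfold avg. apply Rle_trans with (IZR w / IZR l - IZR C / IZR l / INR i)%R; [lra|].
  apply Rmult_le_reg_r with (IZR l * INR i)%R; [apply Rmult_lt_0_compat; auto|].
  replace (IZR (wprefix e i) / INR i * (IZR l * INR i))%R with (IZR l * IZR (wprefix e i))%R
    by (field; lra).
  replace ((IZR w / IZR l - IZR C / IZR l / INR i) * (IZR l * INR i))%R with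
    (IZR w * INR i - IZR C)%R by (field; lra). lra.
Qed.

Lemma LimInfAvg_le_Avg k e : Rbar_le (LimInfAvg e) (Avg k e).
Proof. destruct k; [apply Rbar_le_refl|apply LimSup_LimInf_seq_le]. Qed.

Lemma Avg_le_LimSupAvg k e : Rbar_le (Avg k e) (LimSupAvg e).
Proof. destruct k; [apply LimSup_LimInf_seq_le|apply Rbar_le_refl]. Qed.

(** * Lasso paths from cycles *)

Definition below (n : nat) (c : config) : Prop := length (fst c) <= n.

Lemma walk_bounded A c es c' : walk A any c es c' -> exists n, walk A (below n) c es c'.
Proof.
  induction 1 as [c _|c e c1 es c2 _ Hs Hw [n IH]].
  - exists (length (fst c)). constructor. unfold below. lia.
  - exists (n + length (fst c)). econstructor; [unfold below; lia|exact Hs|].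
    eapply walk_weaken; [|exact IH]. unfold below. intros. lia.
Qed.

Definition wabs (A : WPS) : Z := fold_right (fun e s => (Z.abs (e_w e) + s)%Z) 0%Z (edges A).

Lemma wabs_edge A e : In e (edges A) -> (Z.abs (e_w e) <= wabs A)%Z.
Proof.
  unfold wabs. assert (P : forall l, (0 <= fold_right (fun e s => (Z.abs (e_w e) + s)%Z) 0%Z l)%Z)
    by (induction l; simpl; lia).
  induction (edges A) as [|f l IH]; simpl; [easy|]. intros [->|H].
  - specialize (P l). lia.
  - apply IH in H. lia.
Qed.

Lemma wsum_bound A P c es c' : walk A P c es c' ->
  (Z.abs (wsum es) <= Z.of_nat (length es) * wabs A)%Z.
Proof.
  induction 1 as [|c e c1 es c2 _ Hs Hw IH]; simpl wsum; simpl length; [lia|].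
  destruct Hs as [He _]. apply wabs_edge in He. lia.
Qed.

Section Lasso.
Variable A : WPS.
Variables (c0 : config) (es0 es : list edge) (n : nat).
Hypothesis H0 : walk A (below n) (init_config A) es0 c0.
Hypothesis H1 : walk A (below n) c0 es c0.
Hypothesis Hes : es <> [].

(* The edges of the current round that are still to be taken. *)
Fixpoint todo (i : nat) : list edge :=
  match i with
  | 0 => es0 ++ es
  | S i => match tl (todo i) with [] => es | r => r end
  end.

Definition lasso_edge (i : nat) : edge := hd (mkEdge 0 0 0 Skip 0) (todo i).

Fixpoint lasso_conf (i : nat) : config :=
  match i with
  | 0 => init_config A
  | S i => (apply_com (e_com (lasso_edge i)) (fst (lasso_conf i)), e_dst (lasso_edge i))
  end.

Lemma lasso_inv i : todo i <> [] /\ walk A (below n) (lasso_conf i) (todo i) c0.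
Proof.
  induction i as [|i [IH1 IH2]].
  - simpl. split; [|eapply walk_app; eauto]. intros E. apply app_eq_nil in E. tauto.
  - simpl. unfold lasso_edge. destruct (todo i) as [|e r]; [congruence|]. simpl.
    inversion IH2 as [|? ? c1 ? ? _ (_ & _ & _ & E) Hw]; subst.
    destruct r; [|split; [discriminate|exact Hw]].
    split; auto. inversion Hw; subst. exact H1.
Qed.

Lemma lasso_path : is_path A lasso_conf lasso_edge.
Proof.
  split; [reflexivity|]. intros i. destruct (lasso_inv i) as [I1 I2].
  unfold lasso_edge at 1 2 3. destruct (todo i) as [|e r]; [congruence|]. simpl hd.
  inversion I2 as [|? ? c1 ? ? _ (S1 & S2 & S3 & _) _]; subst. auto.
Qed.

Lemma lasso_bounded : stack_bounded lasso_conf.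
Proof. exists n. intros i. destruct (lasso_inv i) as [_ I]. apply walk_first in I. exact I. Qed.

Lemma lasso_length i : length (todo i) <= length (es0 ++ es).
Proof.
  induction i as [|i IH]; simpl; auto. destruct (todo i) as [|e [|f r]]; simpl in *;
    rewrite ?length_app in *; lia.
Qed.

Lemma lasso_weight i :
  (Z.of_nat (length es) * (wprefix lasso_edge i + wsum (todo i)) -
     wsum es * (Z.of_nat i + Z.of_nat (length (todo i))) =
   Z.of_nat (length es) * wsum (es0 ++ es) - wsum es * Z.of_nat (length (es0 ++ es)))%Z.
Proof.
  induction i as [|i IH]; [simpl; lia|]. rewrite <- IH.
  cbn [wprefix todo]. unfold lasso_edge at 2. destruct (lasso_inv i) as [I _].
  destruct (todo i) as [|e r]; [congruence|]. simpl hd. simpl tl.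
  destruct r as [|f r]; cbn [wsum length]; lia.
Qed.

Lemma lasso_avg : Rbar_le (Finite (IZR (wsum es) / IZR (Z.of_nat (length es)))) (LimInfAvg lasso_edge).
Proof.
  assert (Hl : (0 < Z.of_nat (length es))%Z) by (destruct es; [congruence|simpl; lia]).
  set (L := Z.of_nat (length (es0 ++ es))).
  apply LimInfAvg_ge with (C := (Z.of_nat (length es) * (L * wabs A) + Z.abs (wsum es) * L +
    Z.abs (Z.of_nat (length es) * wsum (es0 ++ es) - wsum es * L))%Z); auto.
  intros i. pose proof (lasso_weight i) as E. destruct (lasso_inv i) as [_ I].
  apply wsum_bound in I. pose proof (lasso_length i) as Hi. fold L in E.
  assert (B : (Z.abs (wsum (todo i)) <= L * wabs A)%Z).
  { eapply Z.le_trans; [exact I|]. apply Z.mul_le_mono_nonneg_r; [|unfold L; lia].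
    unfold wabs. induction (edges A); simpl; lia. }
  assert (B1 : (Z.of_nat (length es) * wsum (todo i) <= Z.of_nat (length es) * (L * wabs A))%Z)
    by (apply Z.mul_le_mono_nonneg_l; lia).
  assert (B2 : (- (wsum es * Z.of_nat (length (todo i))) <= Z.abs (wsum es) * L)%Z).
  { assert (Z.of_nat (length (todo i)) <= L)%Z by (unfold L; lia). nia. }
  lia.
Qed.
End Lasso.

Theorem cyc_path A w l : cyc A w l -> exists c e, is_path A c e /\ stack_bounded c /\
  Rbar_le (Finite (IZR w / IZR (Z.of_nat l))) (LimInfAvg e).
Proof.
  intros (c0 & es & [es0 Hr] & Hc & <- & <- & Hl).
  destruct (walk_bounded _ _ _ _ Hr) as [n1 B1]. destruct (walk_bounded _ _ _ _ Hc) as [n2 B2].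
  assert (B1' : walk A (below (n1 + n2)) (init_config A) es0 c0)
    by (eapply walk_weaken; [|exact B1]; unfold below; intros; lia).
  assert (B2' : walk A (below (n1 + n2)) c0 es c0)
    by (eapply walk_weaken; [|exact B2]; unfold below; intros; lia).
  assert (Hes : es <> []) by (intros ->; simpl in Hl; lia).
  exists (lasso_conf A es0 es), (lasso_edge es0 es). split; [|split].
  - eapply lasso_path; eauto.
  - eapply lasso_bounded; eauto.
  - eapply lasso_avg; eauto.
Qed.

(** * Upper bounds for paths of bounded height *)

Fixpoint words (g n : nat) : list (list nat) :=
  match n with
  | 0 => [[]]
  | S n => [] :: flat_map (fun w => map (fun x => x :: w) (seq 0 g)) (words g n)
  end.

Lemma words_complete g n w : length w <= n -> (forall x, In x w -> x < g) -> In w (words g n).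
Proof.
  revert w. induction n as [|n IH]; intros [|x w] Hl Hw; simpl in *; auto; [lia|].
  right. apply in_flat_map. exists w. split; [apply IH; auto; lia|].
  apply in_map_iff. exists x. split; auto. apply in_seq. specialize (Hw x). lia.
Qed.

Definition confs (A : WPS) (n : nat) : list config := list_prod (words (nG A) n) (seq 0 (nQ A)).

Definition conf_ok (A : WPS) (c : config) : Prop :=
  (forall x, In x (fst c) -> x < nG A) /\ snd c < nQ A.

Lemma cstep_ok A c e c' : wf_WPS A -> conf_ok A c -> cstep A c e c' -> conf_ok A c'.
Proof.
  intros HA [H1 H2] (He & _ & _ & ->). destruct HA as (_ & _ & _ & Hw).
  destruct (Hw e He) as (_ & Hd & _ & Hp & _). split; simpl; auto.
  destruct (e_com e) as [| |y]; simpl; auto.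
  - intros x Hx. apply H1. destruct (fst c); simpl in *; auto.
  - intros x [<-|Hx]; auto. apply Hp. auto.
Qed.

(** A walk is determined by its start and its edges, which makes its configurations a function of
    the index, as the pigeonhole principle needs. *)
Definition after (c : config) (es : list edge) : config :=
  fold_left (fun c e => (apply_com (e_com e) (fst c), e_dst e)) es c.

Lemma walk_after A P c es c' : walk A P c es c' -> c' = after c es.
Proof. induction 1 as [|c e c1 es c2 _ (_ & _ & _ & ->) _ IH]; auto. Qed.

Section Bounded.
Variable A : WPS.
Variable n : nat.

Definition good (c : config) : Prop := below n c /\ conf_ok A c.

Lemma good_conf c : good c -> In c (confs A n).
Proof.
  intros [H1 [H2 H3]]. destruct c as [s q]. apply in_prod.
  - apply words_complete; auto.
  - apply in_seq. simpl in H3. lia.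
Qed.

Let M := length (confs A n).

(** Only the first [M + 1] configurations are compared, so the cycle cut out has at most [M]
    edges. *)
Lemma walk_repeat c es c' : walk A good c es c' -> M <= length es ->
  exists es1 es2 es3 x, es = es1 ++ es2 ++ es3 /\ 0 < length es2 <= M /\
    walk A good c es1 x /\ walk A good x es2 x /\ walk A good x es3 c'.
Proof.
  intros H HM.
  assert (D : forall x y : config, {x = y} + {x <> y}) by (repeat decide equality).
  assert (S0 : forall i, exists x, walk A good c (firstn i es) x /\ walk A good x (skipn i es) c').
  { intros i. apply walk_app_inv. rewrite firstn_skipn. exact H. }
  destruct (pigeonhole D (confs A n) (fun i => after c (firstn i es)) M) as (i & j & Hij & E).
  - apply le_n.
  - intros i _. destruct (S0 i) as (x & Hx & _). rewrite <- (walk_after _ _ _ _ _ Hx).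
    apply good_conf. eapply walk_last; eauto.
  - destruct (S0 j) as (x & Hx & Hx').
    assert (Ej : firstn j es = firstn i es ++ skipn i (firstn j es)).
    { rewrite <- (firstn_skipn i (firstn j es)) at 1. rewrite firstn_firstn.
      replace (Nat.min i j) with i by lia. reflexivity. }
    assert (Hx2 := Hx). rewrite Ej in Hx2. apply walk_app_inv in Hx2. destruct Hx2 as (y & Hy1 & Hy2).
    assert (Exy : y = x).
    { rewrite (walk_after _ _ _ _ _ Hy1), (walk_after _ _ _ _ _ Hx). exact E. }
    subst y. exists (firstn i es), (skipn i (firstn j es)), (skipn j es), x.
    repeat split; auto.
    + rewrite app_assoc, <- Ej, firstn_skipn. reflexivity.
    + rewrite length_skipn, length_firstn. lia.
    + rewrite length_skipn, length_firstn. lia.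
Qed.

Variables a b : Z.
Hypothesis Hcyc : forall w l, cyc A w l -> l <= M -> (a * w + b * Z.of_nat l <= 0)%Z.

(* Removing cycles does not decrease the value, so short walks give the bound for all walks. *)
Lemma walk_bound c es c' : reach A c -> walk A good c es c' ->
  (wt a b es <= Z.of_nat M * (Z.abs a * wabs A + Z.abs b))%Z.
Proof.
  remember (length es) as m eqn:Em. revert es Em c'.
  induction m as [m IH] using lt_wf_ind. intros es Em c' Hr Hw.
  destruct (le_lt_dec M (length es)) as [HM|HM].
  - destruct (walk_repeat _ _ _ Hw HM) as (es1 & es2 & es3 & x & -> & Hl & H1 & H2 & H3).
    assert (I : (wt a b (es1 ++ es3) <= Z.of_nat M * (Z.abs a * wabs A + Z.abs b))%Z).
    { eapply (IH (length (es1 ++ es3))); auto.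
      - rewrite Em, !length_app. lia.
      - eapply walk_app; eauto. }
    assert (C : (wt a b es2 <= 0)%Z).
    { apply Hcyc; [|lia]. exists x, es2. repeat split; try lia.
      - destruct Hr as [es0 H0]. exists (es0 ++ es1). eapply walk_app; eauto.
        eapply walk_weaken; [|exact H1]. easy.
      - eapply walk_weaken; [|exact H2]. easy. }
    unfold wt in *. rewrite !wsum_app, !length_app in *. lia.
  - pose proof (wsum_bound _ _ _ _ _ Hw) as B. unfold wt.
    assert (P : (0 <= wabs A)%Z) by (unfold wabs; induction (edges A); simpl; lia).
    set (k := Z.of_nat (length es)) in *. assert (Hk : (0 <= k <= Z.of_nat M)%Z) by lia.
    assert (Q1 : (a * wsum es <= Z.abs a * (k * wabs A))%Z).
    { apply Z.le_trans with (Z.abs a * Z.abs (wsum es))%Z; [rewrite <- Z.abs_mul; lia|].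
      apply Z.mul_le_mono_nonneg_l; lia. }
    assert (Q2 : (b * k <= Z.abs b * k)%Z) by (apply Z.mul_le_mono_nonneg_r; lia).
    assert (Q3 : (k * (Z.abs a * wabs A + Z.abs b) <= Z.of_nat M * (Z.abs a * wabs A + Z.abs b))%Z).
    { apply Z.mul_le_mono_nonneg_r; [|lia]. pose proof (Z.mul_nonneg_nonneg (Z.abs a) (wabs A)). lia. }
    lia.
Qed.

Lemma path_prefix c e : wf_WPS A -> is_path A c e -> (forall i, length (fst (c i)) <= n) ->
  forall i, walk A good (c 0) (map e (seq 0 i)) (c i) /\ wsum (map e (seq 0 i)) = wprefix e i.
Proof.
  intros HA [P0 P1] Hb.
  assert (OK : forall i, conf_ok A (c i)).
  { induction i as [|i IH].
    - rewrite P0. destruct HA as (G0 & G1 & _). split; simpl; auto.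
      intros x [<-|[]]. exact G0.
    - destruct (P1 i) as (Q1 & Q2 & Q3 & Q4). eapply cstep_ok; eauto. repeat split; eauto. }
  induction i as [|i [I1 I2]].
  - split; [|reflexivity]. constructor. split; auto. apply Hb.
  - rewrite seq_S, map_app. split.
    + eapply walk_app; [exact I1|]. apply walk_one; [split; auto; apply Hb|split; auto; apply Hb|].
      destruct (P1 i) as (Q1 & Q2 & Q3 & Q4). repeat split; auto.
    + rewrite wsum_app, I2. simpl. lia.
Qed.

Lemma path_LimSupAvg c e : wf_WPS A -> (0 < a)%Z -> is_path A c e ->
  (forall i, length (fst (c i)) <= n) ->
  Rbar_le (LimSupAvg e) (Finite (- IZR b / IZR a)).
Proof.
  intros HA Ha Hp Hb. eapply LimSupAvg_le; [exact Ha|]. intros i.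
  destruct (path_prefix c e HA Hp Hb i) as [Hw Hs].
  assert (B := walk_bound (c 0) (map e (seq 0 i)) (c i)).
  unfold wt in B. rewrite Hs, length_map, length_seq in B. apply B; auto.
  destruct Hp as [-> _]. exists []. constructor. exact I.
Qed.
End Bounded.

(** * The three problems in terms of cycles *)

Lemma IZR_div_nonneg (w : Z) (l : nat) : (0 <= w)%Z -> 0 < l -> (0 <= IZR w / IZR (Z.of_nat l))%R.
Proof.
  intros Hw Hl. apply Rmult_le_pos; [apply IZR_le; auto|].
  apply Rlt_le, Rinv_0_lt_compat, IZR_lt. lia.
Qed.

Lemma cyc_pos A w l : cyc A w l -> 0 < l.
Proof. intros (c & es & _ & _ & _ & _ & H). exact H. Qed.

Theorem exists_path_ge A k : wf_WPS A ->
  exists_path_problem k Ge A <-> exists w l, cyc A w l /\ (0 <= w)%Z.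
Proof.
  intros HA. split.
  - intros (c & e & Hp & [n Hn] & Hge). apply NNPP. intros NC.
    set (M := length (confs A n)).
    (* A cycle with weight at most -1 and at most [M] edges satisfies [(M + 1) * w + l <= 0]; this
       gives the strictly negative bound that a nonstrict comparison with 0 requires. *)
    assert (B : Rbar_le (LimSupAvg e) (Finite (- IZR 1 / IZR (Z.of_nat M + 1)))).
    { apply path_LimSupAvg with (A := A) (n := n) (c := c); auto; [|lia].
      intros w l Hc Hl. fold M in Hl.
      assert (w < 0)%Z by (apply Z.nle_gt; intros Hw; apply NC; eauto). nia. }
    assert (P : (0 < IZR (Z.of_nat M + 1))%R) by (apply IZR_lt; lia).
    unfold cmp0 in Hge.
    assert (Q := Rbar_le_trans _ _ _ Hge (Rbar_le_trans _ _ _ (Avg_le_LimSupAvg k e) B)).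
    simpl in Q. apply Rinv_0_lt_compat in P. unfold Rdiv in Q. lra.
  - intros (w & l & Hc & Hw). pose proof (cyc_pos _ _ _ Hc) as Hl.
    destruct (cyc_path _ _ _ Hc) as (c & e & Hp & Hb & Ha).
    exists c, e. split; auto. split; auto. unfold cmp0.
    eapply Rbar_le_trans; [|eapply Rbar_le_trans; [exact Ha|apply LimInfAvg_le_Avg]].
    simpl. apply IZR_div_nonneg; auto.
Qed.

Theorem exists_path_gt A k : wf_WPS A ->
  exists_path_problem k Gt A <-> exists w l, cyc A w l /\ (1 <= w)%Z.
Proof.
  intros HA. split.
  - intros (c & e & Hp & [n Hn] & Hgt). apply NNPP. intros NC.
    assert (B : Rbar_le (LimSupAvg e) (Finite (- IZR 0 / IZR 1))).
    { apply path_LimSupAvg with (A := A) (n := n) (c := c); auto; [|lia].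
      intros w l Hc Hl.
      assert (w < 1)%Z by (apply Z.nle_gt; intros Hw; apply NC; eauto). lia. }
    unfold cmp0 in Hgt.
    assert (Q := Rbar_lt_le_trans _ _ _ Hgt (Rbar_le_trans _ _ _ (Avg_le_LimSupAvg k e) B)).
    simpl in Q. lra.
  - intros (w & l & Hc & Hw). pose proof (cyc_pos _ _ _ Hc) as Hl.
    destruct (cyc_path _ _ _ Hc) as (c & e & Hp & Hb & Ha).
    exists c, e. split; auto. split; auto. unfold cmp0.
    eapply Rbar_lt_le_trans; [|eapply Rbar_le_trans; [exact Ha|apply LimInfAvg_le_Avg]].
    simpl. apply Rmult_lt_0_compat; [apply IZR_lt; lia|apply Rinv_0_lt_compat, IZR_lt; lia].
Qed.

(** [0 <= K * w + l] says that the mean [w / l] is at least [-1 / K]. The cycle may depend on [K],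
    since the supremum need not be attained. *)
Theorem sup_problem_cyc A k : wf_WPS A ->
  sup_problem k A <->
  forall K : Z, (0 < K)%Z -> exists w l, cyc A w l /\ (0 <= K * w + Z.of_nat l)%Z.
Proof.
  intros HA. unfold sup_problem.
  set (S := fun x => exists c e, is_path A c e /\ stack_bounded c /\ x = Avg k e).
  assert (HS : Rbar_is_lub S (Rbar_lub S)) by (exact (proj2_sig (Rbar_ex_lub S))).
  destruct HS as [HU HL]. split.
  - intros H K HK. apply NNPP. intros NC.
    assert (B : Rbar_le (Rbar_lub S) (Finite (- IZR 1 / IZR K))).
    { apply HL. intros x (c & e & Hp & [n Hn] & ->).
      eapply Rbar_le_trans; [apply Avg_le_LimSupAvg|].
      apply path_LimSupAvg with (A := A) (n := n) (c := c); auto.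
      intros w l Hc _. apply Z.nlt_ge. intros Hw. apply NC. exists w, l. split; auto. lia. }
    assert (P : (0 < IZR K)%R) by (apply IZR_lt; lia).
    assert (Q := Rbar_le_trans _ _ _ H B). simpl in Q.
    apply Rinv_0_lt_compat in P. unfold Rdiv in Q. lra.
  - intros H. apply Rbar_le_eps_l. intros eps He.
    destruct (INR_unbounded (/ eps)) as [m Hm].
    assert (Hm0 : (0 < INR m)%R) by (pose proof (Rinv_0_lt_compat eps He); lra).
    destruct (H (Z.of_nat m)) as (w & l & Hc & Hw).
    { apply lt_IZR. rewrite <- INR_IZR_INZ. exact Hm0. }
    pose proof (cyc_pos _ _ _ Hc) as Hl.
    destruct (cyc_path _ _ _ Hc) as (c & e & Hp & Hb & Ha).
    eapply Rbar_le_trans; [|apply HU; exists c, e; eauto].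
    eapply Rbar_le_trans; [|eapply Rbar_le_trans; [exact Ha|apply LimInfAvg_le_Avg]].
    simpl. assert (Hl' : (0 < IZR (Z.of_nat l))%R) by (apply IZR_lt; lia).
    apply IZR_le in Hw. rewrite plus_IZR, mult_IZR, <- (INR_IZR_INZ m) in Hw.
    set (L := IZR (Z.of_nat l)) in *. set (w' := IZR w) in *.
    apply Rmult_le_reg_r with (INR m * L)%R; [apply Rmult_lt_0_compat; auto|].
    replace (w' / L * (INR m * L))%R with (INR m * w')%R by (field; lra).
    assert (1 < INR m * eps)%R.
    { apply Rmult_lt_reg_r with (/ eps)%R; [apply Rinv_0_lt_compat; auto|].
      replace (INR m * eps * / eps)%R with (INR m) by (field; lra). lra. }
    assert (L <= INR m * eps * L)%R.
    { rewrite <- (Rmult_1_l L) at 1. apply Rmult_le_compat_r; lra. }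
    lra.
Qed.

(** * Binary numbers *)

(* Least significant bit first. *)
Fixpoint bval (l : list bool) : Z :=
  match l with [] => 0%Z | b :: l => (Z.b2z b + 2 * bval l)%Z end.

Lemma bval_nonneg l : (0 <= bval l)%Z.
Proof. induction l as [|[] l IH]; cbn [bval Z.b2z]; lia. Qed.

Lemma bval_hd_tl l : bval l = (Z.b2z (hd false l) + 2 * bval (tl l))%Z.
Proof. destruct l; reflexivity. Qed.

Definition maj (b c d : bool) : bool := (b && c) || (d && (b || c)).

Definition add_step (s : (list bool * bool) * list bool) (b : bool) : (list bool * bool) * list bool :=
  ((tl (fst (fst s)), maj b (hd false (fst (fst s))) (snd (fst s))),
   xorb (xorb b (hd false (fst (fst s)))) (snd (fst s)) :: snd s).

Definition carry_step (s : bool * list bool) (b : bool) : bool * list bool :=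
  (b && fst s, xorb b (fst s) :: snd s).

Definition badd0 (l r : list bool) : (list bool * bool) * list bool :=
  fold_left add_step l ((r, false), []).

(** The first fold runs along [l] and consumes [r] beside it; the second carries through what is
    left of a longer [r]. The bits produced are collected in reverse. *)
Definition badd (l r : list bool) : list bool :=
  let s := fold_left carry_step (fst (fst (badd0 l r))) (snd (fst (badd0 l r)), snd (badd0 l r)) in
  rev (fst s :: snd s).

(* The value of [rev acc] followed by bits of value [x]. *)
Definition rval (acc : list bool) (x : Z) : Z := fold_left (fun v b => (Z.b2z b + 2 * v)%Z) acc x.

Lemma rval_cons b acc x : rval (b :: acc) x = rval acc (Z.b2z b + 2 * x).
Proof. reflexivity. Qed.

Lemma bval_rval acc : bval (rev acc) = rval acc 0.
Proof.
  assert (E : forall acc l, bval (rev acc ++ l) = rval acc (bval l)).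
  { clear acc. induction acc as [|b acc IH]; intros l; simpl; auto.
    rewrite <- app_assoc. apply IH. }
  rewrite <- (app_nil_r (rev acc)). apply E.
Qed.

Lemma add_step_val l : forall r c acc,
  let s := fold_left add_step l ((r, c), acc) in
  rval (snd s) (Z.b2z (snd (fst s)) + bval (fst (fst s))) = rval acc (Z.b2z c + bval l + bval r).
Proof.
  induction l as [|b l IH]; intros r c acc.
  - simpl. f_equal. lia.
  - cbn [fold_left]. unfold add_step at 2. cbn [fst snd]. rewrite IH, rval_cons.
    f_equal. rewrite (bval_hd_tl r). cbn [bval]. unfold maj.
    destruct b, c, (hd false r); cbn [Z.b2z andb orb xorb]; lia.
Qed.

Lemma carry_step_val l : forall c acc,
  let s := fold_left carry_step l (c, acc) in
  rval (snd s) (Z.b2z (fst s)) = rval acc (Z.b2z c + bval l).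
Proof.
  induction l as [|b l IH]; intros c acc.
  - simpl. f_equal. lia.
  - cbn [fold_left]. unfold carry_step at 2. cbn [fst snd]. rewrite IH, rval_cons.
    f_equal. cbn [bval]. destruct b, c; cbn [Z.b2z andb orb xorb]; lia.
Qed.

Lemma bval_badd l r : bval (badd l r) = (bval l + bval r)%Z.
Proof.
  unfold badd. rewrite bval_rval.
  pose proof (add_step_val l r false []) as H1.
  pose proof (carry_step_val (fst (fst (badd0 l r))) (snd (fst (badd0 l r))) (snd (badd0 l r))) as H2.
  cbn zeta in H1, H2. fold (badd0 l r) in H1.
  set (s := fold_left carry_step _ _) in *.
  rewrite rval_cons, Z.mul_0_r, Z.add_0_r, H2, H1. simpl. lia.
Qed.

Lemma length_badd l r : length (badd l r) = S (max (length l) (length r)).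
Proof.
  assert (E1 : forall l r c acc, let s := fold_left add_step l ((r, c), acc) in
    length (snd s) = length acc + length l /\ length (fst (fst s)) = length r - length l).
  { clear. induction l as [|b l IH]; intros r c acc; cbn [fold_left]; [simpl; lia|].
    unfold add_step at 2 4. cbn [fst snd].
    match goal with |- context [fold_left add_step l ((?x, ?y), ?z)] =>
      destruct (IH x y z) as [I1 I2] end.
    rewrite I1, I2, length_tl. simpl. lia. }
  assert (E2 : forall l c acc, let s := fold_left carry_step l (c, acc) in
    length (snd s) = length acc + length l).
  { clear. induction l as [|b l IH]; intros c acc; cbn [fold_left]; [simpl; lia|].
    unfold carry_step at 2. cbn [fst snd].
    match goal with |- context [fold_left carry_step l (?y, ?z)] => specialize (IH y z) end.
    cbn zeta in IH. rewrite IH. simpl. lia. }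
  unfold badd. rewrite length_rev. cbn [length].
  destruct (E1 l r false []) as [I1 I2]. fold (badd0 l r) in I1, I2.
  specialize (E2 (fst (fst (badd0 l r))) (snd (fst (badd0 l r))) (snd (badd0 l r))).
  cbn zeta in E2. rewrite E2, I1, I2. simpl. lia.
Qed.

Lemma FP_maj {A} `{Enc A} (f g h : A -> bool) : FP f -> FP g -> FP h ->
  FP (fun a => maj (f a) (g a) (h a)).
Proof. intros. unfold maj. fp. Qed.

Lemma FP_badd0 : FP (fun p : list bool * list bool => badd0 (fst p) (snd p)).
Proof.
  unfold badd0.
  apply (FP_fold_add (fun p : list bool * list bool => fst p) (fun p => ((snd p, false), []))
    (fun _ => add_step)); fp.
  - unfold add_step. fp. apply FP_maj; fp.
  - exists (fun _ => 10). split; [poly|]. intros _ [[r c] acc] b. unfold add_step. cbn [fst snd].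
    rewrite !sz_pair, sz_cons. pose proof (sz_tl r).
    pose proof (sz_bool (maj b (hd false r) c)).
    pose proof (sz_bool (xorb (xorb b (hd false r)) c)). pose proof (sz_pos c). lia.
Qed.

Lemma FP_badd1 : FP (fun p : list bool * list bool => badd (fst p) (snd p)).
Proof.
  pose proof FP_badd0 as F0.
  assert (F1 : FP (fun s : list bool * list bool =>
    fold_left carry_step (fst (fst (badd0 (fst s) (snd s))))
      (snd (fst (badd0 (fst s) (snd s))), snd (badd0 (fst s) (snd s))))).
  { apply (FP_fold_add (fun s => fst (fst (badd0 (fst s) (snd s))))
      (fun s => (snd (fst (badd0 (fst s) (snd s))), snd (badd0 (fst s) (snd s))))
      (fun _ => carry_step)); fp.
    - unfold carry_step. fp.
    - exists (fun _ => 10). split; [poly|]. intros _ [c acc] b. unfold carry_step. cbn [fst snd].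
      rewrite !sz_pair, sz_cons. pose proof (sz_bool (b && c)). pose proof (sz_bool (xorb b c)).
      pose proof (sz_pos c). lia. }
  unfold badd. cbn zeta. fp.
Qed.

(** With the least significant bit first, the last difference decides, so each difference overwrites
    the verdict on the lower bits. A bit set in the rest of a longer right operand overrides it, as
    [ble] checks. *)
Definition cmp_step (s : list bool * bool) (b : bool) : list bool * bool :=
  (tl (fst s), if xorb b (hd false (fst s)) then hd false (fst s) else snd s).

Definition ble (l r : list bool) : bool :=
  existsb (fun b => b) (fst (fold_left cmp_step l (r, true))) || snd (fold_left cmp_step l (r, true)).

Lemma cmp_step_spec l : forall r c,
  let s := fold_left cmp_step l (r, c) in
  existsb (fun b => b) (fst s) || snd s = true <->
  (bval l < bval r \/ bval l = bval r /\ c = true)%Z.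
Proof.
  induction l as [|b l IH]; intros r c.
  - cbn [fold_left fst snd bval]. assert (E : existsb (fun b => b) r = true <-> (0 < bval r)%Z).
    { induction r as [|[] r IH]; cbn [bval Z.b2z existsb orb]; [split; [discriminate|lia]| |].
      - pose proof (bval_nonneg r). split; auto. lia.
      - rewrite IH. lia. }
    rewrite orb_true_iff, E. pose proof (bval_nonneg r).
    destruct c; intuition (try lia; try discriminate).
  - cbn [fold_left]. unfold cmp_step at 2. cbn [fst snd].
    match goal with |- context [fold_left cmp_step l (?x, ?y)] => specialize (IH x y) end.
    cbn zeta in *. rewrite IH, (bval_hd_tl r). cbn [bval].
    destruct b, (hd false r), c; cbn [Z.b2z xorb]; intuition (try lia; try discriminate).
Qed.

Lemma ble_spec l r : ble l r = (bval l <=? bval r)%Z.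
Proof.
  apply eq_true_iff_eq. unfold ble. rewrite (cmp_step_spec l r true), Z.leb_le. intuition lia.
Qed.

Lemma FP_ble1 : FP (fun p : list bool * list bool => ble (fst p) (snd p)).
Proof.
  assert (F1 : FP (fun p : list bool * list bool => fold_left cmp_step (fst p) (snd p, true))).
  { apply (FP_fold_add (fun p : list bool * list bool => fst p) (fun p => (snd p, true))
      (fun _ => cmp_step)); fp.
    - unfold cmp_step. fp.
    - exists (fun _ => 10). split; [poly|]. intros _ [r c] b. unfold cmp_step. cbn [fst snd].
      rewrite !sz_pair. pose proof (sz_tl r).
      pose proof (sz_bool (if xorb b (hd false r) then hd false r else c)). pose proof (sz_pos c). lia. }
  unfold ble. fp.
Qed.

(* The pair [(p, n)] stands for the integer [p - n]. *)
Notation num := (list bool * list bool)%type.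

Definition nval (x : num) : Z := (bval (fst x) - bval (snd x))%Z.
Definition nadd (x y : num) : num := (badd (fst x) (fst y), badd (snd x) (snd y)).
(** Subtraction is avoided by comparing the cross sums. *)
Definition nle (x y : num) : bool := ble (badd (fst x) (snd y)) (badd (fst y) (snd x)).

Lemma nval_nadd x y : nval (nadd x y) = (nval x + nval y)%Z.
Proof. unfold nval, nadd. simpl. rewrite !bval_badd. lia. Qed.

Lemma nle_spec x y : nle x y = (nval x <=? nval y)%Z.
Proof.
  unfold nle, nval. rewrite ble_spec, !bval_badd. apply eq_true_iff_eq. rewrite !Z.leb_le. lia.
Qed.

Definition emap (x : ext num) : ext Z := option_map (option_map nval) x.

Lemma emap_le x y : ele nle x y = zle (emap x) (emap y).
Proof. destruct x as [[]|], y as [[]|]; simpl; auto. apply nle_spec. Qed.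

Lemma emap_add x y : emap (eadd nadd x y) = eadd Z.add (emap x) (emap y).
Proof. destruct x as [[]|], y as [[]|]; simpl; auto. rewrite nval_nadd. reflexivity. Qed.

Lemma emap_max x y : emap (emax nle x y) = emax Z.leb (emap x) (emap y).
Proof. unfold emax. rewrite emap_le. destruct (zle (emap x) (emap y)); auto. Qed.

#[export] Instance Enc_ext T `{Enc T} : Enc (ext T) := Enc_option (option T).

Lemma FP_nadd1 : FP (fun p : num * num => nadd (fst p) (snd p)).
Proof.
  unfold nadd. apply FP_pair.
  - apply (FP_comp2 badd (fun p : num * num => fst (fst p)) (fun p => fst (snd p)) FP_badd1); fp.
  - apply (FP_comp2 badd (fun p : num * num => snd (fst p)) (fun p => snd (snd p)) FP_badd1); fp.
Qed.

Lemma FP_nle1 : FP (fun p : num * num => nle (fst p) (snd p)).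
Proof.
  unfold nle. apply (FP_comp2 ble (fun p : num * num => badd (fst (fst p)) (snd (snd p)))
    (fun p => badd (fst (snd p)) (snd (fst p))) FP_ble1).
  - apply (FP_comp2 badd (fun p : num * num => fst (fst p)) (fun p => snd (snd p)) FP_badd1); fp.
  - apply (FP_comp2 badd (fun p : num * num => fst (snd p)) (fun p => snd (fst p)) FP_badd1); fp.
Qed.

Lemma FP_eadd {A} `{Enc A} (f g : A -> ext num) : FP f -> FP g ->
  FP (fun a => eadd nadd (f a) (g a)).
Proof.
  apply (FP_comp2 (eadd nadd)).
  apply FP_ext with (fun p : ext num * ext num =>
    ocase (fst p) None (fun x => ocase (snd p) None (fun y =>
      ocase x (Some None) (fun x' => ocase y (Some None) (fun y' => Some (Some (nadd x' y'))))))).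
  - intros [[[]|] [[]|]]; reflexivity.
  - fp. apply (FP_comp2 nadd _ _ FP_nadd1); fp.
Qed.

Lemma FP_ele {A} `{Enc A} (f g : A -> ext num) : FP f -> FP g ->
  FP (fun a => ele nle (f a) (g a)).
Proof.
  apply (FP_comp2 (ele nle)).
  apply FP_ext with (fun p : ext num * ext num =>
    ocase (fst p) true (fun x => ocase (snd p) false (fun y =>
      ocase y true (fun y' => ocase x false (fun x' => nle x' y'))))).
  - intros [[[]|] [[]|]]; reflexivity.
  - fp. apply (FP_comp2 nle _ _ FP_nle1); fp.
Qed.

Ltac fp_user ::= lazymatch goal with
  | |- FP (fun a => eadd nadd (@?f a) (@?g a)) => apply (FP_eadd f g)
  | |- FP (fun a => ele nle (@?f a) (@?g a)) => apply (FP_ele f g)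
  end.

Lemma FP_emax {A} `{Enc A} (f g : A -> ext num) : FP f -> FP g ->
  FP (fun a => emax nle (f a) (g a)).
Proof. intros. unfold emax. fp. Qed.

(** Growth is measured in bits: a sum has at most one bit more than its longer operand, so repeated
    addition does not double the length. *)
Definition nbits (x : num) : nat := max (length (fst x)) (length (snd x)).
Definition ebits (x : ext num) : nat := match x with Some (Some n) => nbits n | _ => 0 end.

Lemma nbits_nadd x y : nbits (nadd x y) <= S (max (nbits x) (nbits y)).
Proof. unfold nbits, nadd. simpl. rewrite !length_badd. lia. Qed.

Lemma ebits_eadd x y : ebits (eadd nadd x y) <= S (max (ebits x) (ebits y)).
Proof. destruct x as [[]|], y as [[]|]; simpl; try lia. apply nbits_nadd. Qed.

Lemma ebits_emax x y : ebits (emax nle x y) <= max (ebits x) (ebits y).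
Proof. unfold emax. destruct (ele nle x y); lia. Qed.

Lemma sz_bits (l : list bool) : sz l <= 4 * length l + 1.
Proof.
  induction l as [|b l IH]; [unfold sz; simpl; lia|]. rewrite sz_cons. pose proof (sz_bool b).
  simpl. lia.
Qed.

Lemma sz_num (x : num) : sz x <= 8 * nbits x + 3.
Proof.
  destruct x as [p n]. rewrite sz_pair. pose proof (sz_bits p). pose proof (sz_bits n).
  unfold nbits. simpl. lia.
Qed.

Lemma sz_Fin (x : num) : sz (Some (Some x) : ext num) = sz x + 4.
Proof. unfold sz. simpl. lia. Qed.

Lemma sz_ext (x : ext num) : sz x <= 8 * ebits x + 7.
Proof.
  destruct x as [[x|]|].
  - rewrite sz_Fin. pose proof (sz_num x). cbn [ebits]. lia.
  - unfold sz; simpl; lia.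
  - unfold sz; simpl; lia.
Qed.

Lemma nbits_sz (x : num) : nbits x <= sz x.
Proof.
  destruct x as [p n]. rewrite sz_pair. pose proof (sz_length p). pose proof (sz_length n).
  unfold nbits. simpl. lia.
Qed.

Lemma ebits_sz (x : ext num) : ebits x <= sz x.
Proof.
  destruct x as [[x|]|]; cbn [ebits]; try lia.
  rewrite sz_Fin. pose proof (nbits_sz x). lia.
Qed.

(** * Value iteration on tables *)

#[export] Instance Enc_var : Enc var := Enc_prod _ _.

Definition veqb (u v : var) : bool :=
  (fst (fst u) =? fst (fst v)) && (snd (fst u) =? snd (fst v)) && (snd u =? snd v).

Lemma veqb_spec u v : reflect (u = v) (veqb u v).
Proof.
  destruct u as [[q z] q'], v as [[p y] p']. unfold veqb. cbn [fst snd].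
  destruct (Nat.eqb_spec q p), (Nat.eqb_spec z y), (Nat.eqb_spec q' p'); constructor; congruence.
Qed.

(* A production with its head, constant, length and children. *)
Notation aprod := ((var * num) * (nat * list var))%type.
Notation table := (list (var * ext num)).

Definition toP (p : aprod) : prod var :=
  Prod var (fst (fst p)) (nval (snd (fst p))) (fst (snd p)) (snd (snd p)).

Definition lookup (x : table) (u : var) : ext num :=
  fold_left (fun acc kv => if veqb (fst kv) u then snd kv else acc) x None.

Definition apval (x : table) (p : aprod) : ext num :=
  fold_left (fun acc u => eadd nadd acc (lookup x u)) (snd (snd p)) (Some (Some (snd (fst p)))).

Definition avalue (ps : list aprod) (x : table) (kv : var * ext num) : ext num :=
  fold_left (fun acc p => if veqb (fst (fst p)) (fst kv) then emax nle acc (apval x p) else acc)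
    ps (snd kv).

Definition astep (ps : list aprod) (x : table) : table := map (fun kv => (fst kv, avalue ps x kv)) x.

(** The list of variables serves as a unary counter of the rounds. *)
Definition aiter (ps : list aprod) (vs : list var) (x : table) : table :=
  fold_left (fun x _ => astep ps x) vs x.

Definition tab (x : table) (v : var) : ext Z := emap (lookup x v).

Lemma lookup_indep (x : table) v acc acc' : In v (map fst x) ->
  fold_left (fun acc kv => if veqb (fst kv) v then snd kv else acc) x acc =
  fold_left (fun acc kv => if veqb (fst kv) v then snd kv else acc) x acc'.
Proof.
  revert acc acc'. induction x as [|[u e] x IH]; intros acc acc' H; [easy|].
  simpl in *. destruct (veqb_spec u v) as [|NE]; [reflexivity|]. apply IH. destruct H; congruence.
Qed.

Lemma lookup_notin (x : table) v : ~ In v (map fst x) -> lookup x v = None.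
Proof.
  unfold lookup. induction x as [|[u e] x IH]; intros H; auto. simpl in *.
  destruct (veqb_spec u v) as [->|NE]; [tauto|]. apply IH. tauto.
Qed.

Lemma lookup_map (x : table) (h : var -> ext num -> ext num) v : In v (map fst x) ->
  lookup (map (fun kv => (fst kv, h (fst kv) (snd kv))) x) v = h v (lookup x v).
Proof.
  intros H. unfold lookup.
  rewrite (lookup_indep _ v None (h v None)) by (rewrite map_map; exact H).
  clear H. generalize (None : ext num). induction x as [|[u e] x IH]; intros acc; auto. simpl.
  destruct (veqb_spec u v) as [->|NE]; apply IH.
Qed.

Lemma emap_apval x p : emap (apval x p) = pval var (tab x) (toP p).
Proof.
  unfold apval, pval, toP. simpl p_ch. simpl p_w.
  change (Fin (nval (snd (fst p)))) with (emap (Some (Some (snd (fst p))))).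
  generalize (Some (Some (snd (fst p)))). induction (snd (snd p)) as [|u ch IH]; intros acc; auto.
  simpl. rewrite IH, emap_add. reflexivity.
Qed.

(** A variable without an entry stays at minus infinity on both sides, because it is the head of no
    production. *)
Lemma tab_astep ps x v : (forall p, In p ps -> In (fst (fst p)) (map fst x)) ->
  tab (astep ps x) v = vstep var veqb (map toP ps) (tab x) v.
Proof.
  intros Hh. unfold tab at 1, vstep.
  destruct (in_dec (fun u w => reflect_dec _ _ (veqb_spec u w)) v (map fst x)) as [Hv|Hv].
  - unfold astep.
    rewrite (map_ext _ (fun kv => (fst kv, avalue ps x (fst kv, snd kv))))
      by (intros [u e]; reflexivity).
    rewrite (lookup_map x (fun u e => avalue ps x (u, e)) v Hv). unfold avalue. cbn [fst snd].
    unfold tab. generalize (lookup x v). clear Hh. induction ps as [|p ps IH]; intros acc; auto. simpl.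
    rewrite IH. f_equal. destruct (veqb (fst (fst p)) v); auto.
    rewrite emap_max, emap_apval. reflexivity.
  - rewrite lookup_notin by (unfold astep; rewrite map_map; exact Hv).
    unfold tab. rewrite lookup_notin by exact Hv. simpl.
    assert (E : forall l, incl l ps -> fold_left (fun acc p => if veqb (p_head var p) v
      then emax Z.leb acc (pval var (tab x) p) else acc) (map toP l) None = None).
    { induction l as [|p l IH]; intros Hl; auto. cbn [map fold_left].
      destruct (veqb_spec (p_head var (toP p)) v) as [E|].
      - exfalso. rewrite <- E in Hv. apply Hv, Hh, Hl. left. auto.
      - apply IH. intros q Hq. apply Hl. right. auto. }
    symmetry. apply E, incl_refl.
Qed.

Lemma keys_astep ps x : map fst (astep ps x) = map fst x.
Proof. unfold astep. rewrite map_map. reflexivity. Qed.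

Lemma keys_aiter ps vs x : map fst (aiter ps vs x) = map fst x.
Proof.
  unfold aiter. revert x. induction vs as [|v vs IH]; intros x; auto. simpl.
  rewrite IH. apply keys_astep.
Qed.

Lemma vstep_ext veq ps x x' v : (forall v, x v = x' v) -> vstep var veq ps x v = vstep var veq ps x' v.
Proof.
  intros E. unfold vstep. rewrite (E v). generalize (x' v). induction ps as [|p ps IH]; intros acc; auto.
  simpl. rewrite (pval_ext var x x' p) by auto. apply IH.
Qed.

Lemma viter_ext veq ps x x' n v : (forall v, x v = x' v) ->
  viter var veq ps x n v = viter var veq ps x' n v.
Proof.
  intros E. revert v. induction n as [|n IH]; intros v; [apply E|]. simpl. apply vstep_ext, IH.
Qed.

Lemma viter_S veq ps x n v : viter var veq ps x (S n) v = viter var veq ps (vstep var veq ps x) n v.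
Proof.
  revert v. induction n as [|n IH]; intros v; auto. simpl. apply vstep_ext. intros. apply IH.
Qed.

Lemma tab_aiter ps vs x v : (forall p, In p ps -> In (fst (fst p)) (map fst x)) ->
  tab (aiter ps vs x) v = viter var veqb (map toP ps) (tab x) (length vs) v.
Proof.
  revert x. induction vs as [|u vs IH]; intros x Hh; auto. simpl length.
  rewrite viter_S. change (aiter ps (u :: vs) x) with (aiter ps vs (astep ps x)).
  rewrite IH by (rewrite keys_astep; exact Hh). apply viter_ext. intros w. apply tab_astep, Hh.
Qed.

Definition table0 (vs : list var) : table := map (fun v => (v, None)) vs.

Definition mark_growing (x x' : table) : table :=
  map (fun kv => (fst kv,
    if ele nle (snd kv) (lookup x (fst kv)) then lookup x (fst kv) else Some None)) x'.

Definition solve (ps : list aprod) (vs : list var) : table :=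
  aiter ps vs (mark_growing (aiter ps vs (table0 vs)) (astep ps (aiter ps vs (table0 vs)))).

Lemma keys_table0 vs : map fst (table0 vs) = vs.
Proof. unfold table0. rewrite map_map. apply map_id. Qed.

Lemma tab_table0 vs v : tab (table0 vs) v = None.
Proof.
  unfold tab. assert (E : lookup (table0 vs) v = None); [|rewrite E; reflexivity].
  unfold lookup, table0. induction vs as [|u vs IH]; auto. simpl.
  destruct (veqb u v); exact IH.
Qed.

Theorem tab_solve ps vs v : (forall p, In p ps -> In (fst (fst p)) vs) ->
  tab (solve ps vs) v = ys var veqb (map toP ps) (length vs) (length vs) v.
Proof.
  intros Hh. unfold solve. set (x := aiter ps vs (table0 vs)).
  assert (Kx : map fst x = vs) by (unfold x; rewrite keys_aiter; apply keys_table0).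
  assert (Tx : forall v, tab x v = xs var veqb (map toP ps) (length vs) v).
  { intros u. unfold x. rewrite tab_aiter by (rewrite keys_table0; exact Hh).
    apply viter_ext. intros. apply tab_table0. }
  assert (Tx' : forall v, tab (astep ps x) v = xs var veqb (map toP ps) (S (length vs)) v).
  { intros u. rewrite tab_astep by (rewrite Kx; exact Hh). apply vstep_ext, Tx. }
  rewrite tab_aiter.
  - apply viter_ext. intros u. unfold y0.
    rewrite <- Tx, <- Tx'. unfold mark_growing.
    destruct (in_dec (fun u w => reflect_dec _ _ (veqb_spec u w)) u (map fst (astep ps x))) as [Hu|Hu].
    + unfold tab.
      rewrite (lookup_map _ (fun u e => if ele nle e (lookup x u) then lookup x u else Some None) u Hu).
      rewrite <- emap_le. destruct (ele nle (lookup (astep ps x) u) (lookup x u)); reflexivity.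
    + unfold tab. rewrite lookup_notin by (rewrite map_map; exact Hu).
      rewrite (lookup_notin (astep ps x)) by exact Hu.
      rewrite lookup_notin by (rewrite <- (keys_astep ps); exact Hu). reflexivity.
  - unfold mark_growing. rewrite map_map. simpl.
    change (map (fun x => fst x)) with (map (@fst var (ext num))).
    rewrite keys_astep, Kx. exact Hh.
Qed.

Lemma FP_veqb {A} `{Enc A} (f g : A -> var) : FP f -> FP g -> FP (fun a => veqb (f a) (g a)).
Proof. intros. unfold veqb. fp. Qed.

Lemma FP_lookup {A} `{Enc A} (x : A -> table) (u : A -> var) : FP x -> FP u ->
  FP (fun a => lookup (x a) (u a)).
Proof.
  apply (FP_comp2 lookup). unfold lookup.
  apply (FP_fold_add (fun p : table * var => fst p) (fun _ => None : ext num)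
    (fun p acc kv => if veqb (fst kv) (snd p) then snd kv else acc)); fp.
  - apply FP_veqb; fp.
  - exists (fun n => n). split; [poly|]. intros p s [k e]. cbn [fst snd]. rewrite sz_pair.
    destruct (veqb k (snd p)); lia.
Qed.

Definition bounded (B : nat) (x : table) : Prop := forall kv, In kv x -> ebits (snd kv) <= B.

Lemma ebits_lookup B x u : bounded B x -> ebits (lookup x u) <= B.
Proof.
  intros H. unfold lookup. assert (H0 : ebits (None : ext num) <= B) by (simpl; lia). revert H0.
  generalize (None : ext num). induction x as [|kv x IH]; intros acc H0; auto. simpl.
  apply IH; [intros k Hk; apply H; right; auto|].
  destruct (veqb (fst kv) u); auto. apply H. left. auto.
Qed.

Lemma ebits_fold_eadd B x ch acc : bounded B x -> ebits acc <= B ->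
  ebits (fold_left (fun acc u => eadd nadd acc (lookup x u)) ch acc) <= B + length ch.
Proof.
  intros Hx. assert (G : forall ch B' acc, B <= B' -> ebits acc <= B' ->
    ebits (fold_left (fun acc u => eadd nadd acc (lookup x u)) ch acc) <= B' + length ch).
  { clear ch acc. induction ch as [|u ch IH]; intros B' acc HB H; simpl; [lia|].
    specialize (IH (S B') (eadd nadd acc (lookup x u)) ltac:(lia)).
    pose proof (ebits_eadd acc (lookup x u)). pose proof (ebits_lookup B x u Hx). lia. }
  intros H. apply G; auto.
Qed.

Lemma FP_apval {A} `{Enc A} (x : A -> table) (p : A -> aprod) : FP x -> FP p ->
  FP (fun a => apval (x a) (p a)).
Proof.
  apply (FP_comp2 apval). clear x p. unfold apval.
  apply (FP_fold (fun a : table * aprod => snd (snd (snd a)))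
    (fun a => Some (Some (snd (fst (snd a)))) : ext num)
    (fun a acc u => eadd nadd acc (lookup (fst a) u))); fp.
  - apply (FP_lookup (fun p : table * aprod * ext num * var => fst (fst (fst p))) snd); fp.
  - exists (fun n => 8 * (n + n) + 7). split; [poly|].
    intros [x [[h w] [l ch]]] r1 r2 E. cbn [fst snd] in *.
    eapply Nat.le_trans; [apply sz_ext|].
    rewrite !sz_pair. rewrite E. pose proof (sz_app r1 r2). pose proof (sz_length r1).
    pose proof (sz_pos r2).
    pose proof (ebits_fold_eadd (sz x + sz w) x r1 (Some (Some w))) as HB.
    assert (HB' : ebits (fold_left (fun acc u => eadd nadd acc (lookup x u)) r1 (Some (Some w)))
      <= sz x + sz w + length r1).
    { apply HB.
      - intros kv Hkv. apply sz_in in Hkv. destruct kv as [k e]. rewrite sz_pair in Hkv.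
        pose proof (ebits_sz e). cbn [snd]. lia.
      - cbn [ebits]. pose proof (nbits_sz w). lia. }
    lia.
Qed.

Lemma FP_avalue {A} `{Enc A} (ps : A -> list aprod) (x : A -> table) (kv : A -> var * ext num) :
  FP ps -> FP x -> FP kv -> FP (fun a => avalue (ps a) (x a) (kv a)).
Proof.
  intros Hp Hx Hk.
  refine (FP_comp (fun t : list aprod * (table * (var * ext num)) =>
    avalue (fst t) (fst (snd t)) (snd (snd t))) (fun a => (ps a, (x a, kv a))) _ _); [|fp].
  unfold avalue. clear A H ps x kv Hp Hx Hk.
  assert (FV : FP (fun t : table * aprod => apval (fst t) (snd t))) by (apply FP_apval; fp).
  apply (FP_fold_add (fun t : list aprod * (table * (var * ext num)) => fst t)
    (fun t => snd (snd (snd t)))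
    (fun t acc p => if veqb (fst (fst p)) (fst (snd (snd t)))
      then emax nle acc (apval (fst (snd t)) p) else acc)); fp.
  - apply FP_veqb; fp.
  - apply FP_emax; [fp|]. apply FP_apval; fp.
  - destruct (FP_size _ FV) as (q & Pq & Hq). exists (fun n => q (1 + n)). split; [poly|].
    intros [ps [x [k e]]] s p. cbn [fst snd]. rewrite !sz_pair.
    specialize (Hq (x, p)). rewrite sz_pair in Hq. cbn [fst snd] in Hq.
    assert (M : q (S (sz x + sz p)) <= q (1 + (S (sz ps + S (sz x + S (sz k + sz e))) + sz p)))
      by (apply poly_mono; auto; lia).
    destruct (veqb (fst (fst p)) k); [|lia]. unfold emax. destruct (ele nle s (apval x p)); lia.
Qed.

Lemma FP_astep {A} `{Enc A} (ps : A -> list aprod) (x : A -> table) :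
  FP ps -> FP x -> FP (fun a => astep (ps a) (x a)).
Proof. apply (FP_comp2 astep). unfold astep. fp. apply FP_avalue; fp. Qed.

(** A production costs at most one bit per child, and the maximum over productions costs none. *)
Lemma bounded_astep B m ps x :
  (forall p, In p ps -> nbits (snd (fst p)) <= B /\ length (snd (snd p)) <= m) ->
  bounded B x -> bounded (B + m) (astep ps x).
Proof.
  intros Hp Hx kv Hkv. unfold astep in Hkv. apply in_map_iff in Hkv.
  destruct Hkv as ([k e] & <- & Hk). cbn [fst snd]. unfold avalue. cbn [fst snd].
  assert (H0 : ebits e <= B + m) by (specialize (Hx _ Hk); cbn [snd] in Hx; lia).
  revert e Hk H0. induction ps as [|p ps IH]; intros e Hk H0; auto. simpl.
  assert (HP : ebits (apval x p) <= B + m).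
  { destruct (Hp p (or_introl eq_refl)) as [P1 P2]. unfold apval.
    pose proof (ebits_fold_eadd B x (snd (snd p)) (Some (Some (snd (fst p)))) Hx P1). lia. }
  assert (G : forall acc, ebits acc <= B + m -> ebits (fold_left (fun acc p =>
    if veqb (fst (fst p)) k then emax nle acc (apval x p) else acc) ps acc) <= B + m).
  { clear IH HP.
    assert (Hp' : forall p, In p ps -> nbits (snd (fst p)) <= B /\ length (snd (snd p)) <= m)
      by (intros; apply Hp; right; auto).
    clear Hp. induction ps as [|r ps IH]; intros acc Ha; auto. simpl. apply IH.
    - intros. apply Hp'. right. auto.
    - destruct (veqb (fst (fst r)) k); auto. destruct (Hp' r (or_introl eq_refl)) as [P1 P2].
      pose proof (ebits_fold_eadd B x (snd (snd r)) (Some (Some (snd (fst r)))) Hx P1).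
      pose proof (ebits_emax acc (apval x r)). unfold apval in *. lia. }
  apply G. destruct (veqb (fst (fst p)) k); auto. pose proof (ebits_emax e (apval x p)). lia.
Qed.

Lemma bounded_aiter m ps vs : forall B x,
  (forall p, In p ps -> nbits (snd (fst p)) <= B /\ length (snd (snd p)) <= m) ->
  bounded B x -> bounded (B + length vs * m) (aiter ps vs x).
Proof.
  induction vs as [|v vs IH]; intros B x Hp Hx.
  - simpl. rewrite Nat.add_0_r. exact Hx.
  - change (aiter ps (v :: vs) x) with (aiter ps vs (astep ps x)).
    replace (B + length (v :: vs) * m) with (B + m + length vs * m) by (simpl; lia).
    apply IH; [intros p P; destruct (Hp p P); lia|]. apply bounded_astep; auto.
Qed.

Lemma sz_table B x : bounded B x -> sz x <= sz (map fst x) + length x * (8 * B + 8).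
Proof.
  induction x as [|[k e] x IH]; intros H; [unfold sz; simpl; lia|].
  cbn [map fst length]. rewrite !sz_cons, sz_pair.
  specialize (IH ltac:(intros kv Hk; apply H; right; auto)).
  specialize (H (k, e) (or_introl eq_refl)). cbn [snd] in H. pose proof (sz_ext e). lia.
Qed.

Lemma sz_map_fst (x : table) : sz (map fst x) <= sz x.
Proof.
  induction x as [|[k e] x IH]; [unfold sz; simpl; lia|]. cbn [map fst].
  rewrite !sz_cons, sz_pair. lia.
Qed.

(* Each round adds a bounded number of bits to the entries, so the tables stay small. *)
Lemma FP_aiter {A} `{Enc A} (ps : A -> list aprod) (vs : A -> list var) (x : A -> table) :
  FP ps -> FP vs -> FP x -> FP (fun a => aiter (ps a) (vs a) (x a)).
Proof.
  intros Hp Hv Hx. unfold aiter.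
  apply (FP_fold vs x (fun a t _ => astep (ps a) t)); auto.
  - apply FP_astep; fp.
    apply (FP_comp ps (fun p : A * table * var => fst (fst p))); auto. fp.
  - destruct (FP_size _ Hp) as (qp & Pp & Sp). destruct (FP_size _ Hv) as (qv & Pv & Sv).
    destruct (FP_size _ Hx) as (qx & Px & Sx).
    exists (fun n => qx n + qx n * (8 * (qp n + qx n + qv n * qp n) + 8)). split; [poly|].
    intros a r1 r2 E. specialize (Sp a). specialize (Sv a). specialize (Sx a).
    change (fold_left (fun t _ => astep (ps a) t) r1 (x a)) with (aiter (ps a) r1 (x a)).
    assert (HB : bounded (sz (ps a) + sz (x a) + length r1 * sz (ps a)) (aiter (ps a) r1 (x a))).
    { apply bounded_aiter.
      - intros [[h w] [l ch]] Hi. apply sz_in in Hi. rewrite !sz_pair in Hi. cbn [fst snd].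
        pose proof (nbits_sz w). pose proof (sz_length ch). lia.
      - intros [k e] Hi. apply sz_in in Hi. rewrite sz_pair in Hi. cbn [snd].
        pose proof (ebits_sz e). lia. }
    apply sz_table in HB. rewrite keys_aiter in HB.
    assert (HL : length (aiter (ps a) r1 (x a)) = length (x a)).
    { rewrite <- (length_map fst), keys_aiter, length_map. reflexivity. }
    rewrite HL in HB. pose proof (sz_map_fst (x a)). pose proof (sz_length (x a)).
    rewrite E in Sv. pose proof (sz_app r1 r2). pose proof (sz_length r1). pose proof (sz_pos r2).
    assert (M1 : length r1 * sz (ps a) <= qv (sz a) * qp (sz a)) by (apply Nat.mul_le_mono; lia).
    assert (M2 : length (x a) * (8 * (sz (ps a) + sz (x a) + length r1 * sz (ps a)) + 8) <=
      qx (sz a) * (8 * (qp (sz a) + qx (sz a) + qv (sz a) * qp (sz a)) + 8))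
      by (apply Nat.mul_le_mono; lia).
    lia.
Qed.

Lemma FP_solve {A} `{Enc A} (ps : A -> list aprod) (vs : A -> list var) :
  FP ps -> FP vs -> FP (fun a => solve (ps a) (vs a)).
Proof.
  intros Hp Hv.
  assert (Hx : FP (fun a => aiter (ps a) (vs a) (table0 (vs a)))).
  { apply FP_aiter; auto. unfold table0. fp. }
  unfold solve. apply FP_aiter; auto.
  apply (FP_comp2 mark_growing (fun a => aiter (ps a) (vs a) (table0 (vs a)))
    (fun a => astep (ps a) (aiter (ps a) (vs a) (table0 (vs a))))); auto.
  - unfold mark_growing. fp; apply FP_lookup; fp.
  - apply FP_astep; auto.
Qed.

(** * The decision procedure *)

(* Source, top and destination; kind of command (0 skip, 1 pop, 2 push) and pushed symbol; weight. *)
Notation aedge := (((nat * nat) * nat) * ((nat * nat) * num))%type.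
(* Numbers of states and symbols, initial state; edges. *)
Notation psys := (((nat * nat) * nat) * list aedge)%type.

Notation a_src e := (fst (fst (fst e))).
Notation a_top e := (snd (fst (fst e))).
Notation a_dst e := (snd (fst e)).
Notation a_kind e := (fst (fst (snd e))).
Notation a_sym e := (snd (fst (snd e))).
Notation a_w e := (snd (snd e)).
Notation p_nQ P := (fst (fst (fst P))).
Notation p_nG P := (snd (fst (fst P))).
Notation p_q0 P := (snd (fst P)).
Notation p_edges P := (snd P).

Definition mk (h : var) (w : num) (l : nat) (ch : list var) : aprod := ((h, w), (l, ch)).

Definition skip_prods (P : psys) : list aprod :=
  flat_map (fun e => if a_kind e =? 0 then [mk (a_src e, a_top e, a_dst e) (a_w e) 1 []] else [])
    (p_edges P).

Definition nested_prods (P : psys) : list aprod :=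
  flat_map (fun e => flat_map (fun f =>
    if (a_kind e =? 2) && (a_kind f =? 1) && (a_sym e =? a_top f) then
      mk (a_src e, a_top e, a_dst f) (nadd (a_w e) (a_w f)) 2 [(a_dst e, a_top f, a_src f)] ::
      if a_dst e =? a_src f
      then [mk (a_src e, a_top e, a_dst f) (nadd (a_w e) (a_w f)) 2 []] else []
    else []) (p_edges P)) (p_edges P).

Definition cat_prods (P : psys) : list aprod :=
  flat_map (fun q => flat_map (fun z => flat_map (fun m => map (fun q' =>
    mk (q, z, q') ([], []) 0 [(q, z, m); (m, z, q')])
    (seq 0 (p_nQ P))) (seq 0 (p_nQ P))) (seq 0 (p_nG P))) (seq 0 (p_nQ P)).

Definition rpush_prods (P : psys) : list aprod :=
  flat_map (fun e => if a_kind e =? 2 then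
    [mk (a_dst e, a_sym e, p_nQ P) (a_w e) 1 [(a_src e, a_top e, p_nQ P)]] else []) (p_edges P).

Definition rstep_prods (P : psys) : list aprod :=
  flat_map (fun q => flat_map (fun z => map (fun q' =>
    mk (q', z, p_nQ P) ([], []) 0 [(q, z, p_nQ P); (q, z, q')])
    (seq 0 (p_nQ P))) (seq 0 (p_nG P))) (seq 0 (p_nQ P)).

(** [c] represents the constant [b] of the initial production. *)
Definition all_prods (c : num) (P : psys) : list aprod :=
  mk (p_q0 P, 0, p_nQ P) c 1 [] ::
  skip_prods P ++ nested_prods P ++ cat_prods P ++ rpush_prods P ++ rstep_prods P.

Definition all_vars (P : psys) : list var :=
  flat_map (fun q => flat_map (fun z => map (fun q' => (q, z, q')) (seq 0 (S (p_nQ P))))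
    (seq 0 (p_nG P))) (seq 0 (p_nQ P)).

Definition decide (c t : num) (P : psys) : bool :=
  existsb (fun q => existsb (fun z =>
    ocase (lookup (solve (all_prods c P) (all_vars P)) (q, z, p_nQ P)) false
      (fun _ => ele nle (Some (Some t)) (lookup (solve (all_prods c P) (all_vars P)) (q, z, q))))
    (seq 0 (p_nG P))) (seq 0 (p_nQ P)).

(* Replaces every weight [w] by [2 ^ (N + 2) * w + 1], where [N] is the number of variables. *)
Definition scale (P : psys) : psys :=
  (fst P, map (fun e => (fst e, (fst (snd e),
    (true :: false :: map (fun _ => false) (all_vars P) ++ fst (a_w e),
     false :: false :: map (fun _ => false) (all_vars P) ++ snd (a_w e))))) (p_edges P)).

Lemma FP_all_vars : FP all_vars.
Proof. unfold all_vars. fp. Qed.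

Lemma FP_all_prods c : FP (all_prods c).
Proof.
  unfold all_prods, skip_prods, nested_prods, cat_prods, rpush_prods, rstep_prods, mk.
  fp.
  all: apply (FP_comp2 nadd _ _ FP_nadd1); fp.
Qed.

Lemma FP_decide c t : FP (decide c t).
Proof.
  assert (S0 : FP (fun P => solve (all_prods c P) (all_vars P)))
    by (apply FP_solve; [apply FP_all_prods|apply FP_all_vars]).
  set (s := fun P => solve (all_prods c P) (all_vars P)) in *.
  apply FP_ext with (fun P =>
    (fun p : psys * table => existsb (fun q => existsb (fun z =>
      ocase (lookup (snd p) (q, z, p_nQ (fst p))) false
        (fun _ => ele nle (Some (Some t)) (lookup (snd p) (q, z, q))))
      (seq 0 (p_nG (fst p)))) (seq 0 (p_nQ (fst p)))) (P, s P)); [reflexivity|].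
  apply (FP_comp (fun p : psys * table => existsb (fun q => existsb (fun z =>
      ocase (lookup (snd p) (q, z, p_nQ (fst p))) false
        (fun _ => ele nle (Some (Some t)) (lookup (snd p) (q, z, q))))
      (seq 0 (p_nG (fst p)))) (seq 0 (p_nQ (fst p)))) (fun P => (P, s P))); [|fp].
  clear. fp; apply FP_lookup; fp.
Qed.

Lemma FP_scale : FP scale.
Proof.
  assert (V : FP (fun P => map (fun _ : var => false) (all_vars P))).
  { pose proof FP_all_vars. fp. }
  set (pad := fun P => map (fun _ : var => false) (all_vars P)) in *.
  apply FP_ext with (fun P => (fun p : psys * list bool =>
    (fst (fst p), map (fun e : aedge => (fst e, (fst (snd e),
      (true :: false :: snd p ++ fst (a_w e), false :: false :: snd p ++ snd (a_w e)))))
      (p_edges (fst p)))) (P, pad P)); [reflexivity|].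
  apply (FP_comp (fun p : psys * list bool =>
    (fst (fst p), map (fun e : aedge => (fst e, (fst (snd e),
      (true :: false :: snd p ++ fst (a_w e), false :: false :: snd p ++ snd (a_w e)))))
      (p_edges (fst p)))) (fun P => (P, pad P))); [|fp].
  clear. fp.
Qed.

(** * Correctness of the decision procedure *)

Definition kind (c : com) : nat := match c with Skip => 0 | Pop => 1 | Push _ => 2 end.
Definition csym (c : com) : nat := match c with Push z => z | _ => 0 end.

Definition edge_of (W : edge -> num) (e : edge) : aedge :=
  (((e_src e, e_top e), e_dst e), ((kind (e_com e), csym (e_com e)), W e)).

Definition psys_of (A : WPS) (W : edge -> num) : psys :=
  (((nQ A, nG A), q0 A), map (edge_of W) (edges A)).

Section Correct.
Variable A : WPS.
Hypothesis HA : wf_WPS A.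
Variables a b : Z.
Variable W : edge -> num.
Variable c : num.
Hypothesis HW : forall e, nval (W e) = (a * e_w e + b)%Z.
Hypothesis Hc : nval c = b.

Let P := psys_of A W.

Lemma in_skip p : In p (skip_prods P) <-> exists e, In e (edges A) /\ e_com e = Skip /\
  p = mk (e_src e, e_top e, e_dst e) (W e) 1 [].
Proof.
  unfold skip_prods, P, psys_of. cbn [snd]. rewrite in_flat_map. split.
  - intros (x & Hx & Hp). apply in_map_iff in Hx. destruct Hx as (e & <- & He). simpl in Hp.
    exists e. destruct (e_com e); simpl in Hp; intuition.
  - intros (e & He & Ce & ->). exists (edge_of W e). split; [apply in_map, He|].
    unfold edge_of. rewrite Ce. simpl. auto.
Qed.

Lemma in_nested p : In p (nested_prods P) <-> exists e f, In e (edges A) /\ In f (edges A) /\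
  e_com e = Push (e_top f) /\ e_com f = Pop /\
  (p = mk (e_src e, e_top e, e_dst f) (nadd (W e) (W f)) 2 [(e_dst e, e_top f, e_src f)] \/
   e_dst e = e_src f /\ p = mk (e_src e, e_top e, e_dst f) (nadd (W e) (W f)) 2 []).
Proof.
  unfold nested_prods, P, psys_of. cbn [snd]. rewrite in_flat_map. split.
  - intros (x & Hx & Hp). apply in_map_iff in Hx. destruct Hx as (e & <- & He).
    apply in_flat_map in Hp. destruct Hp as (y & Hy & Hp).
    apply in_map_iff in Hy. destruct Hy as (f & <- & Hf). unfold edge_of in Hp. cbn [fst snd] in Hp.
    exists e, f. destruct (e_com e) as [| |z]; destruct (e_com f);
      cbn [kind csym Nat.eqb andb] in Hp; try contradiction.
    destruct (Nat.eqb_spec z (e_top f)) as [Ez|]; [|contradiction]. subst z.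
    destruct (Nat.eqb_spec (e_dst e) (e_src f)); simpl in Hp; intuition.
  - intros (e & f & He & Hf & Ce & Cf & Hp). exists (edge_of W e). split; [apply in_map, He|].
    apply in_flat_map. exists (edge_of W f). split; [apply in_map, Hf|].
    unfold edge_of. cbn [fst snd]. rewrite Ce, Cf. simpl. rewrite Nat.eqb_refl.
    destruct Hp as [->|[-> ->]]; [left; auto|right]. rewrite Nat.eqb_refl. left. auto.
Qed.

Lemma in_cat p : In p (cat_prods P) <-> exists q z m q', q < nQ A /\ z < nG A /\ m < nQ A /\ q' < nQ A /\
  p = mk (q, z, q') ([], []) 0 [(q, z, m); (m, z, q')].
Proof.
  unfold cat_prods, P, psys_of. cbn [fst snd]. rewrite in_flat_map. split.
  - intros (q & Hq & Hp). apply in_flat_map in Hp. destruct Hp as (z & Hz & Hp).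
    apply in_flat_map in Hp. destruct Hp as (m & Hm & Hp).
    apply in_map_iff in Hp. destruct Hp as (q' & <- & Hq').
    apply in_seq in Hq, Hz, Hm, Hq'. exists q, z, m, q'. repeat split; auto; lia.
  - intros (q & z & m & q' & Hq & Hz & Hm & Hq' & ->).
    exists q. split; [apply in_seq; lia|]. apply in_flat_map.
    exists z. split; [apply in_seq; lia|]. apply in_flat_map.
    exists m. split; [apply in_seq; lia|]. apply in_map_iff.
    exists q'. split; [auto|apply in_seq; lia].
Qed.

Lemma in_rpush p : In p (rpush_prods P) <-> exists e y, In e (edges A) /\ e_com e = Push y /\
  p = mk (e_dst e, y, nQ A) (W e) 1 [(e_src e, e_top e, nQ A)].
Proof.
  unfold rpush_prods, P, psys_of. cbn [fst snd]. rewrite in_flat_map. split.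
  - intros (x & Hx & Hp). apply in_map_iff in Hx. destruct Hx as (e & <- & He).
    unfold edge_of in Hp. cbn [fst snd] in Hp.
    exists e. destruct (e_com e) as [| |y]; simpl in Hp; try easy. exists y. intuition.
  - intros (e & y & He & Ce & ->). exists (edge_of W e). split; [apply in_map, He|].
    unfold edge_of. rewrite Ce. simpl. auto.
Qed.

Lemma in_rstep p : In p (rstep_prods P) <-> exists q z q', q < nQ A /\ z < nG A /\ q' < nQ A /\
  p = mk (q', z, nQ A) ([], []) 0 [(q, z, nQ A); (q, z, q')].
Proof.
  unfold rstep_prods, P, psys_of. cbn [fst snd]. rewrite in_flat_map. split.
  - intros (q & Hq & Hp). apply in_flat_map in Hp. destruct Hp as (z & Hz & Hp).
    apply in_map_iff in Hp. destruct Hp as (q' & <- & Hq').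
    apply in_seq in Hq, Hz, Hq'. exists q, z, q'. repeat split; auto; lia.
  - intros (q & z & q' & Hq & Hz & Hq' & ->).
    exists q. split; [apply in_seq; lia|]. apply in_flat_map.
    exists z. split; [apply in_seq; lia|]. apply in_map_iff.
    exists q'. split; [auto|apply in_seq; lia].
Qed.

Lemma all_prods_gprod p : In p (map toP (all_prods c P)) <-> gprod A a b p.
Proof.
  rewrite in_map_iff. unfold all_prods. split.
  - intros (x & <- & Hx). destruct Hx as [<-|Hx].
    { unfold toP. simpl. rewrite Hc. apply g_init. }
    rewrite !in_app_iff, in_skip, in_nested, in_cat, in_rpush, in_rstep in Hx.
    destruct Hx as [(e & He & Ce & ->)|[(e & f & He & Hf & Ce & Cf & Hx)|
      [(q & z & m & q' & H1 & H2 & H3 & H4 & ->)|[(e & y & He & Ce & ->)|(q & z & q' & H1 & H2 & H3 & ->)]]]];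
      unfold toP, mk; cbn [fst snd].
    + rewrite HW. apply g_skip; auto.
    + destruct Hx as [->|[E ->]]; unfold mk; cbn [fst snd]; rewrite nval_nadd, !HW.
      * apply g_nested; auto.
      * apply g_pushpop; auto.
    + apply g_cat; auto.
    + rewrite HW. apply g_rpush; auto.
    + apply g_rstep; auto.
  - intros Hp.
    destruct Hp as [e He Ce|e f He Hf Ce Cf E|e f He Hf Ce Cf|
      q z m q' H1 H2 H3 H4| |e y He Ce|q z q' H1 H2 H3].
    + exists (mk (e_src e, e_top e, e_dst e) (W e) 1 []). split.
      * unfold toP, mk, We. cbn [fst snd]. rewrite HW. reflexivity.
      * right. rewrite !in_app_iff, in_skip. left. eauto.
    + exists (mk (e_src e, e_top e, e_dst f) (nadd (W e) (W f)) 2 []). split.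
      * unfold toP, mk, We. cbn [fst snd]. rewrite nval_nadd, !HW. reflexivity.
      * right. rewrite !in_app_iff, in_nested. right. left. exists e, f. auto 10.
    + exists (mk (e_src e, e_top e, e_dst f) (nadd (W e) (W f)) 2 [(e_dst e, e_top f, e_src f)]). split.
      * unfold toP, mk, We. cbn [fst snd]. rewrite nval_nadd, !HW. reflexivity.
      * right. rewrite !in_app_iff, in_nested. right. left. exists e, f. auto 10.
    + exists (mk (q, z, q') ([], []) 0 [(q, z, m); (m, z, q')]). split; [reflexivity|].
      right. rewrite !in_app_iff, in_cat. right. right. left. exists q, z, m, q'. auto.
    + exists (mk (q0 A, 0, nQ A) c 1 []). split; [|left; reflexivity].
      unfold toP, mk. cbn [fst snd]. rewrite Hc. reflexivity.
    + exists (mk (e_dst e, y, nQ A) (W e) 1 [(e_src e, e_top e, nQ A)]). split.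
      * unfold toP, mk, We. cbn [fst snd]. rewrite HW. reflexivity.
      * right. rewrite !in_app_iff, in_rpush. do 3 right. left. eauto.
    + exists (mk (q', z, nQ A) ([], []) 0 [(q, z, nQ A); (q, z, q')]). split; [reflexivity|].
      right. rewrite !in_app_iff, in_rstep. do 4 right. exists q, z, q'. auto.
Qed.

Lemma in_all_vars v : in_range A v -> In v (all_vars P).
Proof.
  destruct v as [[q z] q']. unfold in_range, all_vars, P, psys_of. cbn [fst snd].
  intros (Hq & Hz & Hq'). apply in_flat_map. exists q. split; [apply in_seq; lia|].
  apply in_flat_map. exists z. split; [apply in_seq; lia|].
  apply in_map_iff. exists q'. split; [auto|apply in_seq; lia].
Qed.

Let N := length (all_vars P).

Lemma decide_test t :
  decide c t P = true <-> test A (map toP (all_prods c P)) N veqb (nval t).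
Proof.
  assert (S : forall v, emap (lookup (solve (all_prods c P) (all_vars P)) v) =
    ys var veqb (map toP (all_prods c P)) N N v).
  { intros v. apply tab_solve. intros p Hp.
    apply in_all_vars. apply (gprod_range A HA a b (toP p)). apply all_prods_gprod, in_map, Hp. }
  unfold decide, test. rewrite existsb_exists. split.
  - intros (q & Hq & H). apply existsb_exists in H. destruct H as (z & Hz & H).
    apply in_seq in Hq, Hz. unfold P, psys_of in Hq, Hz. cbn [fst snd] in Hq, Hz.
    exists q, z. split; [lia|]. split; [lia|]. rewrite <- !S.
    unfold ocase in H. change (p_nQ P) with (nQ A) in H.
    destruct (lookup _ (q, z, nQ A)); [|discriminate]. split; [discriminate|].
    rewrite emap_le in H. exact H.
  - intros (q & z & Hq & Hz & H1 & H2). rewrite <- S in H1, H2.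
    exists q. split; [apply in_seq; unfold P, psys_of; cbn [fst snd]; lia|].
    apply existsb_exists. exists z. split; [apply in_seq; unfold P, psys_of; cbn [fst snd]; lia|].
    unfold ocase. change (p_nQ P) with (nQ A).
    destruct (lookup _ (q, z, nQ A)); [|exfalso; apply H1; reflexivity].
    rewrite emap_le. exact H2.
Qed.

Lemma decide_cyc t : decide c t P = true <->
  exists w l, cyc A w l /\ (nval t <= a * w + b * Z.of_nat l)%Z.
Proof.
  rewrite decide_test.
  exact (test_cyc A HA a b _ all_prods_gprod (all_vars P) N (le_n _) in_all_vars
    veqb veqb_spec (nval t)).
Qed.

Lemma decide_all_cyc K : a = Z.of_nat K -> b = 1%Z -> lbound (S N) < K ->
  decide c ([], []) P = true <->
  forall K' : Z, (0 < K')%Z -> exists w l, cyc A w l /\ (0 <= K' * w + Z.of_nat l)%Z.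
Proof.
  intros Ea Eb HK. split.
  - intros H K' HK'. apply decide_test in H.
    apply (test_all_cyc A HA a b _ all_prods_gprod (all_vars P) N (le_n _) in_all_vars
      veqb veqb_spec K); auto.
    lia.
  - intros H. apply decide_cyc. destruct (H (Z.of_nat K)) as (w & l & Hcyc & Hw); [lia|].
    exists w, l. split; auto. rewrite Ea, Eb. unfold nval. simpl bval. lia.
Qed.
End Correct.

Lemma bval_pad {X} (l : list X) r :
  bval (map (fun _ => false) l ++ r) = (2 ^ Z.of_nat (length l) * bval r)%Z.
Proof.
  induction l as [|x l IH]; [simpl; destruct (bval r); reflexivity|].
  cbn [map app bval length Z.b2z]. rewrite IH, Nat2Z.inj_succ, Z.pow_succ_r by lia. ring.
Qed.

Definition scaleW (A : WPS) (W : edge -> num) (e : edge) : num :=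
  (true :: false :: map (fun _ => false) (all_vars (psys_of A W)) ++ fst (W e),
   false :: false :: map (fun _ => false) (all_vars (psys_of A W)) ++ snd (W e)).

Lemma scale_psys A W : scale (psys_of A W) = psys_of A (scaleW A W).
Proof. unfold scale, psys_of. cbn [fst snd]. rewrite map_map. reflexivity. Qed.

(** Low zero bits multiply both parts by a power of two; the lowest bit of the positive part, free
    after the shift, holds the added 1. *)
Lemma scaleW_val A W e :
  nval (scaleW A W e) = (2 ^ Z.of_nat (length (all_vars (psys_of A W)) + 2) * nval (W e) + 1)%Z.
Proof.
  unfold nval, scaleW. cbn [fst snd bval Z.b2z]. rewrite !bval_pad, Nat2Z.inj_add, Z.pow_add_r by lia.
  change (2 ^ Z.of_nat 2)%Z with 4%Z. ring.
Qed.

(** * Reading the input *)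

Definition split_step (s : list nat * list (list nat)) (x : nat) : list nat * list (list nat) :=
  if x =? 3 then ([], fst s :: snd s) else (x :: fst s, snd s).

Definition split3 (l : list nat) : list nat * list (list nat) :=
  fold_left split_step (rev l) ([], []).

(* The pieces between the separators 3; the piece after the last separator is included. *)
Definition tokens (l : list nat) : list (list nat) := fst (split3 l) :: snd (split3 l).

Definition tok_bits (t : list nat) : list bool := map (fun x => x =? 2) (rev (tl t)).

(** The first letter is the sign, with 4 for negative. The letters 1 and 2 are the bits 0 and 1,
    most significant first, hence the reversal in [tok_bits]. *)
Definition tok_num (t : list nat) : num :=
  if hd 0 t =? 4 then ([], tok_bits t) else (tok_bits t, []).

Notation tl3 l := (tl (tl (tl l))).

(** The letter 4 that opens an edge sticks to the token of its source and is dropped by [tl]; a push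
    has one token more than the other commands. The step is idle once only the empty token after the
    last separator is left, so the tokens themselves can serve as fuel. *)
Definition parse_step (s : list (list nat) * list aedge) (_ : list nat) : list (list nat) * list aedge :=
  if is_nil (tl (fst s)) then s else
  if length (hd [] (tl3 (fst s))) =? 2 then
    (tl3 (tl3 (fst s)),
     snd s ++ [(((length (tl (hd [] (fst s))), length (hd [] (tl (fst s)))),
       length (hd [] (tl (tl (fst s))))),
       ((2, length (hd [] (tl (tl3 (fst s))))), tok_num (hd [] (tl (tl (tl3 (fst s)))))))])
  else
    (tl (tl (tl3 (fst s))),
     snd s ++ [(((length (tl (hd [] (fst s))), length (hd [] (tl (fst s)))),
       length (hd [] (tl (tl (fst s))))),
       ((length (hd [] (tl3 (fst s))), 0), tok_num (hd [] (tl (tl3 (fst s))))))]).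

Definition parse_edges (ts : list (list nat)) : list aedge := snd (fold_left parse_step ts (ts, [])).

Definition parse_tokens (ts : list (list nat)) : psys :=
  (((length (hd [] ts), length (hd [] (tl ts))), length (hd [] (tl (tl ts)))), parse_edges (tl3 ts)).

Definition parse (l : list nat) : psys := parse_tokens (tokens l).

Lemma FP_tokens : FP tokens.
Proof.
  assert (S0 : FP split3).
  { unfold split3.
    apply (FP_fold_add (fun l => rev l) (fun _ => ([], [])) (fun _ => split_step)); fp.
    - unfold split_step. fp.
    - exists (fun n => n + 3). split; [poly|]. intros a [cur ts] x. unfold split_step. cbn [fst snd].
      destruct (x =? 3); rewrite !sz_pair, sz_cons; unfold sz; simpl; lia. }
  unfold tokens. fp.
Qed.

Lemma FP_tok_num {A} `{Enc A} (t : A -> list nat) : FP t -> FP (fun a => tok_num (t a)).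
Proof.
  apply (FP_comp tok_num). unfold tok_num, tok_bits. fp.
Qed.

Lemma sz_length_nat {X} `{Enc X} (l : list X) : sz (length l) <= sz l.
Proof.
  induction l as [|x l IH]; [unfold sz; simpl; lia|]. simpl length.
  rewrite sz_S, sz_cons. pose proof (sz_pos x). lia.
Qed.

Lemma sz_hd_tl {X} `{Enc X} (l : list (list X)) : sz (hd [] l) + sz (tl l) <= sz l + 1.
Proof. destruct l as [|x l]; [unfold sz; simpl; lia|]. cbn [hd tl]. rewrite sz_cons. lia. Qed.

Lemma sz_tok_num t : sz (tok_num t) <= 2 * sz t + 2.
Proof.
  assert (B : sz (tok_bits t) <= 2 * sz t).
  { unfold tok_bits. eapply Nat.le_trans; [apply sz_bits|].
    rewrite length_map, length_rev. pose proof (sz_length_nat (tl t)). pose proof (sz_tl t).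
    assert (E : forall n, sz n = 2 * n + 1).
    { clear. induction n as [|n IH]; [reflexivity|]. rewrite sz_S. lia. }
    rewrite E in H. lia. }
  unfold tok_num. destruct (hd 0 t =? 4); rewrite sz_pair; unfold sz in *; simpl in *; lia.
Qed.

Lemma sz_var q z q' : sz (q, z, q') = S (S (sz q + sz z) + sz q').
Proof. reflexivity. Qed.

Lemma FP_parse_edges : FP parse_edges.
Proof.
  unfold parse_edges. apply FP_snd.
  apply (FP_fold (fun ts => ts) (fun ts => (ts, [])) (fun _ => parse_step)); fp.
  - unfold parse_step. fp; apply FP_tok_num; fp.
  (* Tokens moved to the output at most double in size up to a constant, by [sz_tok_num]; with
     weight 2 on the remaining tokens, a step adds only a constant. *)
  - assert (St : forall s x, 2 * sz (fst (parse_step s x)) + sz (snd (parse_step s x)) <=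
      2 * sz (fst s) + sz (snd s) + 100).
    { intros [ts es] x. unfold parse_step. cbn [fst snd].
      pose proof (sz_hd_tl ts) as B0. pose proof (sz_hd_tl (tl ts)) as B1.
      pose proof (sz_hd_tl (tl (tl ts))) as B2. pose proof (sz_hd_tl (tl3 ts)) as B3.
      pose proof (sz_hd_tl (tl (tl3 ts))) as B4. pose proof (sz_hd_tl (tl (tl (tl3 ts)))) as B5.
      pose proof (sz_length_nat (tl (hd [] ts))) as L0. pose proof (sz_tl (hd [] ts)) as L0'.
      pose proof (sz_length_nat (hd [] (tl ts))) as L1.
      pose proof (sz_length_nat (hd [] (tl (tl ts)))) as L2.
      pose proof (sz_length_nat (hd [] (tl3 ts))) as L3.
      pose proof (sz_length_nat (hd [] (tl (tl3 ts)))) as L4.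
      pose proof (sz_tok_num (hd [] (tl (tl3 ts)))) as N4.
      pose proof (sz_tok_num (hd [] (tl (tl (tl3 ts))))) as N5.
      assert (Z0 : sz 0 = 1) by reflexivity. assert (Z2 : sz 2 = 5) by reflexivity.
      assert (ZN : sz (@nil aedge) = 1) by reflexivity.
      destruct (is_nil (tl ts)); [cbn [fst snd]; lia|].
      destruct (length (hd [] (tl3 ts)) =? 2); cbn [fst snd];
        match goal with |- context [sz (es ++ ?l)] => pose proof (sz_app es l) as SA end;
        rewrite sz_cons, !sz_pair, sz_var in SA; lia. }
    exists (fun n => 3 * n + 10 + 100 * n). split; [poly|]. intros a r1 r2 E.
    assert (G : forall r s,
      2 * sz (fst (fold_left parse_step r s)) + sz (snd (fold_left parse_step r s)) <=
      2 * sz (fst s) + sz (snd s) + 100 * length r).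
    { clear -St. induction r as [|x r IH]; intros s; cbn [fold_left length]; [lia|].
      specialize (IH (parse_step s x)). specialize (St s x). lia. }
    specialize (G r1 (a, [])). destruct (fold_left parse_step r1 (a, [])) as [u v]. cbn [fst snd] in G.
    rewrite sz_pair. assert (ZN : sz (@nil aedge) = 1) by reflexivity.
    pose proof (sz_length r1). pose proof (sz_app r1 r2). pose proof (sz_pos r2). rewrite <- E in *. lia.
Qed.

Lemma FP_parse : FP parse.
Proof.
  apply (FP_comp parse_tokens tokens); [|apply FP_tokens]. unfold parse_tokens. fp.
  apply (FP_comp parse_edges (fun ts : list (list nat) => tl3 ts)); [apply FP_parse_edges|fp].
Qed.

Lemma split3_cons x l : split3 (x :: l) = split_step (split3 l) x.
Proof. unfold split3. simpl rev. rewrite fold_left_app. reflexivity. Qed.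

Lemma tokens_app t r : ~ In 3 t -> tokens (t ++ 3 :: r) = t :: tokens r.
Proof.
  intros H. assert (E : split3 (t ++ 3 :: r) = (t, tokens r)).
  { induction t as [|x t IH]; cbn [app]; rewrite split3_cons.
    - reflexivity.
    - rewrite IH by (intros Hi; apply H; right; auto). unfold split_step.
      destruct (Nat.eqb_spec x 3) as [->|]; [exfalso; apply H; left; auto|reflexivity]. }
  unfold tokens at 1. rewrite E. reflexivity.
Qed.

Lemma no3_repeat n : ~ In 3 (repeat 1 n).
Proof. intros H. apply repeat_spec in H. discriminate. Qed.

Lemma tokens_unary n r : tokens (unary n ++ r) = repeat 1 n :: tokens r.
Proof. unfold unary. rewrite <- app_assoc. apply tokens_app, no3_repeat. Qed.

Definition tok_Z (z : Z) : list nat :=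
  match z with Z0 => [2] | Zpos p => 2 :: bin_pos p | Zneg p => 4 :: bin_pos p end.

Lemma bin_pos_12 p x : In x (bin_pos p) -> x = 1 \/ x = 2.
Proof.
  induction p as [p IH|p IH|]; simpl; rewrite ?in_app_iff; simpl; intuition.
Qed.

Lemma tokens_Z z r : tokens (enc_Z z ++ r) = tok_Z z :: tokens r.
Proof.
  assert (E : enc_Z z ++ r = tok_Z z ++ 3 :: r).
  { destruct z; simpl; rewrite <- ?app_assoc; reflexivity. }
  rewrite E. apply tokens_app. destruct z; simpl; intros H; intuition (try discriminate);
    apply bin_pos_12 in H0; intuition discriminate.
Qed.

Lemma bval_bin_pos p : bval (map (fun x => x =? 2) (rev (bin_pos p))) = Zpos p.
Proof.
  induction p as [p IH|p IH|]; cbn [bin_pos]; rewrite ?rev_app_distr;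
    cbn [rev app map bval Nat.eqb Z.b2z]; rewrite ?IH; reflexivity.
Qed.

Lemma tok_Z_val z : nval (tok_num (tok_Z z)) = z.
Proof.
  destruct z; unfold tok_num, tok_bits, nval; simpl hd; simpl tl; cbn [Nat.eqb fst snd];
    rewrite ?bval_bin_pos; reflexivity.
Qed.

Definition edge_tokens (e : edge) : list (list nat) :=
  (4 :: repeat 1 (e_src e)) :: repeat 1 (e_top e) :: repeat 1 (e_dst e) ::
  repeat 1 (kind (e_com e)) ::
  match e_com e with Push z => [repeat 1 z] | _ => [] end ++ [tok_Z (e_w e)].

Lemma tokens_edge e r : tokens (4 :: enc_edge e ++ r) = edge_tokens e ++ tokens r.
Proof.
  unfold enc_edge, edge_tokens. unfold unary at 1.
  assert (H4 : ~ In 3 (4 :: repeat 1 (e_src e))).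
  { intros [H|H]; [discriminate|]. eapply no3_repeat; eauto. }
  rewrite <- !app_assoc. cbn [app]. rewrite app_comm_cons, tokens_app, !tokens_unary by exact H4.
  destruct (e_com e); unfold enc_com; rewrite <- ?app_assoc, !tokens_unary, tokens_Z; reflexivity.
Qed.

Definition edge_num (e : edge) : num := tok_num (tok_Z (e_w e)).

Lemma parse_step_edge e r acc x :
  parse_step (edge_tokens e ++ tokens r, acc) x = (tokens r, acc ++ [edge_of edge_num e]).
Proof.
  unfold parse_step, edge_tokens, edge_of, edge_num.
  destruct (e_com e); cbn [fst snd app hd tl is_nil kind csym repeat length Nat.eqb];
    rewrite !repeat_length; reflexivity.
Qed.

Lemma parse_edges_fold es : forall r acc, length es <= length r ->
  snd (fold_left parse_step r (tokens (flat_map (fun e => 4 :: enc_edge e) es), acc)) =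
  acc ++ map (edge_of edge_num) es.
Proof.
  induction es as [|e es IH]; intros r acc Hl.
  - simpl map. rewrite app_nil_r. clear Hl.
    assert (E : forall x, parse_step (tokens [], acc) x = (tokens [], acc)) by reflexivity.
    change (flat_map (fun e => 4 :: enc_edge e) []) with (@nil nat).
    induction r as [|x r IH]; [reflexivity|]. cbn [fold_left]. rewrite E. exact IH.
  - destruct r as [|x r]; [simpl in Hl; lia|]. cbn [fold_left flat_map map].
    change ((4 :: enc_edge e) ++ flat_map (fun e => 4 :: enc_edge e) es) with
      (4 :: enc_edge e ++ flat_map (fun e => 4 :: enc_edge e) es).
    rewrite tokens_edge, parse_step_edge, IH by (simpl in Hl; lia).
    rewrite <- app_assoc. reflexivity.
Qed.

Lemma parse_enc A : parse (enc_WPS A) = psys_of A edge_num.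
Proof.
  unfold parse, parse_tokens, enc_WPS, psys_of. rewrite !tokens_unary. cbn [hd tl].
  rewrite !repeat_length. f_equal. unfold parse_edges.
  rewrite parse_edges_fold; [reflexivity|].
  (* Every edge yields at least one token, so there are enough rounds. *)
  induction (edges A) as [|e es IH]; [apply Nat.le_0_l|].
  cbn [flat_map]. change ((4 :: enc_edge e) ++ flat_map (fun e => 4 :: enc_edge e) es) with
    (4 :: enc_edge e ++ flat_map (fun e => 4 :: enc_edge e) es).
  rewrite tokens_edge, length_app.
  assert (1 <= length (edge_tokens e)) by (simpl; lia). cbn [length]. lia.
Qed.

Lemma enc_WPS_sym A : exists x, enc_WPS A = map toN x.
Proof.
  assert (G : forall l, (forall x, In x l -> 1 <= x <= 4) -> exists y, l = map toN y).
  { induction l as [|x l IH]; intros H; [exists []; reflexivity|].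
    destruct IH as [y ->]; [intros; apply H; right; auto|].
    assert (Hx : 1 <= x <= 4) by (apply H; left; auto).
    destruct x as [|[|[|[|[|x]]]]]; try lia;
      [exists (s1 :: y)|exists (s2 :: y)|exists (s3 :: y)|exists (s4 :: y)]; reflexivity. }
  apply G. clear G.
  assert (U : forall n x, In x (unary n) -> 1 <= x <= 4).
  { intros n x H. unfold unary in H. apply in_app_iff in H. destruct H as [H|[<-|[]]]; [|lia].
    apply repeat_spec in H. lia. }
  assert (Z : forall z x, In x (enc_Z z) -> 1 <= x <= 4).
  { intros z x H. destruct z; simpl in H; rewrite ?in_app_iff in H; simpl in H;
      intuition (try lia); apply bin_pos_12 in H; lia. }
  intros x H. unfold enc_WPS in H. rewrite !in_app_iff, in_flat_map in H.
  destruct H as [H|[H|[H|(e & _ & [<-|H])]]]; eauto; try lia.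
  unfold enc_edge in H. rewrite !in_app_iff in H.
  destruct H as [H|[H|[H|[H|H]]]]; eauto.
  unfold enc_com in H. destruct (e_com e); [| |apply in_app_iff in H; destruct H]; eauto.
Qed.

Lemma decide_parse_cyc A t : wf_WPS A ->
  decide ([], []) t (parse (enc_WPS A)) = true <-> exists w l, cyc A w l /\ (nval t <= w)%Z.
Proof.
  intros HA. rewrite parse_enc.
  rewrite (decide_cyc A HA 1 0 edge_num ([], [])).
  - split; intros (w & l & Hc & Hw); exists w, l; split; auto; lia.
  - intros e. unfold edge_num. rewrite tok_Z_val. lia.
  - reflexivity.
Qed.

Lemma decide_scale_cyc A : wf_WPS A ->
  decide ([true], []) ([], []) (scale (parse (enc_WPS A))) = true <->
  forall K : Z, (0 < K)%Z -> exists w l, cyc A w l /\ (0 <= K * w + Z.of_nat l)%Z.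
Proof.
  intros HA. rewrite parse_enc, scale_psys.
  set (N := length (all_vars (psys_of A edge_num))).
  apply (decide_all_cyc A HA (2 ^ Z.of_nat (N + 2)) 1 (scaleW A edge_num) ([true], []))
    with (K := 2 ^ (N + 2)).
  - intros e. rewrite scaleW_val. unfold edge_num at 2. rewrite tok_Z_val. reflexivity.
  - reflexivity.
  - rewrite Nat2Z.inj_pow. reflexivity.
  - reflexivity.
  (* The variables depend only on the numbers of states and symbols, so scaling does not change
     [N]. *)
  - change (length (all_vars (psys_of A (scaleW A edge_num)))) with N.
    pose proof (lbound_pow (S N)). replace (N + 2) with (S N + 1) by lia. auto.
Qed.

Theorem theorem3 :
  (forall (k : avg_kind) (b : cmp), poly_time_decidable (exists_path_problem k b)) /\
  (forall k : avg_kind, poly_time_decidable (sup_problem k)).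
Proof.
  split.
  - intros k b.
    (* Weights are integers, so the strict comparison amounts to the threshold 1. *)
    apply (FP_decides _ (fun x =>
      decide ([], []) (match b with Ge => [] | Gt => [true] end, []) (parse x))).
    + apply (FP_comp (decide ([], []) (match b with Ge => [] | Gt => [true] end, [])) parse);
        [apply FP_decide|apply FP_parse].
    + intros A _. apply enc_WPS_sym.
    + intros A HA. rewrite (decide_parse_cyc A _ HA). destruct b.
      * apply exists_path_ge, HA.
      * apply exists_path_gt, HA.
  - intros k.
    apply (FP_decides _ (fun x => decide ([true], []) ([], []) (scale (parse x)))).
    + apply (FP_comp (decide ([true], []) ([], [])) (fun x => scale (parse x))); [apply FP_decide|].
      apply (FP_comp scale parse); [apply FP_scale|apply FP_parse].
    + intros A _. apply enc_WPS_sym.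
    + intros A HA. rewrite (decide_scale_cyc A HA). apply sup_problem_cyc, HA.
Qed.
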